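(* Let $T>0$, let $\sigma\in[0,1]$, and let $H$, $\mathfrak{A}=\mathcal{A}+\mathscr{A}$ and $\mathfrak{B}$ satisfy the structural assumptions (i)–(iii) of the context with this $\sigma$. Then there exists $r>0$ such that for all $(f,g)\in L^2(0,T;D(\mathcal{A}^{\frac{1-\sigma}{2}})^* )\times D(\mathcal{A}^{\frac{\sigma}{2}})$ with $$\|(f,g)\|_{L^2(0,T;D(\mathcal{A}^{\frac{1-\sigma}{2}})^* )\times D(\mathcal{A}^{\frac{\sigma}{2}})}<r$$ there exists a unique solution $$u\in X:=L^2(0,T;D(\mathcal{A}^{\frac{1+\sigma}{2}}))\cap H^1(0,T;D(\mathcal{A}^{\frac{1-\sigma}{2}})^* )$$ of the nonlinear Cauchy problem $$\partial_t u+\mathfrak{A}u+\mathfrak{B}[u,u]=f,\qquad u(0)=g.$$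
   Context: Structural assumptions. (i) $H$ is a real infinite-dimensional separable Hilbert space with scalar product $\langle\cdot,\cdot\rangle$. (ii) $\mathfrak{A}:D(\mathfrak{A})\subset H\to H$ is linear, densely defined, and $\mathfrak{A}=\mathcal{A}+\mathscr{A}$, where $\mathcal{A}:D(\mathfrak{A})\subset H\to H$ (so $D(\mathcal{A})=D(\mathfrak{A})$) is self-adjoint with pure point spectrum: it has real eigenvalues $0<\lambda_1\le\lambda_2\le\dots$, $\lambda_k\to\infty$, and the eigenvectors $\{\phi_k\}_{k\ge1}$ form an orthonormal Hilbert basis of $H$. The operator $\mathscr{A}:D(\mathfrak{A})\subset H\to H$ is linear and skew symmetric (in particular $\langle\mathscr{A}u,u\rangle=0$ for $u\in D(\mathfrak{A})$), and $\mathscr{A}:D(\mathcal{A}^{1/2})\to H$ is bounded. (iii) $\mathfrak{B}:D(\mathfrak{A})\times D(\mathfrak{A})\to H$ is bilinear and there is $C_{\mathfrak{B}}>0$ with $$|\langle\mathfrak{B}[u,w],v\rangle|\le C_{\mathfrak{B}}\|\mathcal{A}^{\frac{\sigma+1}{2}}u\|_H\,\|\mathcal{A}^{\frac{\sigma}{2}}w\|_H\,\|\mathcal{A}^{\frac{1-\sigma}{2}}v\|_H$$ for all $u\in D(\mathcal{A}^{\frac{\sigma+1}{2}})$, $w\in D(\mathcal{A}^{\frac{\sigma}{2}})$, $v\in D(\mathcal{A}^{\frac{1-\sigma}{2}})$ (with $\mathfrak{B}$ understood as extended accordingly by continuity). Fractional powers: $\mathcal{A}^su=\sum_k\lambda_k^s\langle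 u,\phi_k\rangle\phi_k$, and for $s\ge0$, $D(\mathcal{A}^s)=\{u\in H:\sum_k\lambda_k^{2s}\langle u,\phi_k\rangle^2<\infty\}$ with norm $\|\mathcal{A}^su\|_H$; $D(\mathcal{A}^{-s}):=D(\mathcal{A}^s)^*$ (duality with pivot space $H$). Conventions: $\mathfrak{A}$ and $\mathfrak{B}$ act pointwise in time on time-dependent functions. $\mathfrak{A}$ extends to a bounded operator $D(\mathcal{A}^{\frac{1+\sigma}{2}})\to D(\mathcal{A}^{\frac{1-\sigma}{2}})^*$. The evolution equation is understood as an equality in $L^2(0,T;D(\mathcal{A}^{\frac{1-\sigma}{2}})^* )$. Since $X$ embeds continuously into $C([0,T];D(\mathcal{A}^{\frac{\sigma}{2}}))$, the initial condition is meaningful in $D(\mathcal{A}^{\frac{\sigma}{2}})$. *)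

(* Defs.v *)
From HB Require Import structures.
From mathcomp Require Export all_boot all_order all_algebra.
From mathcomp Require Export all_classical all_reals all_analysis.
Export numFieldNormedType.Exports.

Set Implicit Arguments.
Unset Strict Implicit.
Unset Printing Implicit Defensive.
Import Order.TTheory GRing.Theory Num.Theory.

Local Open Scope classical_set_scope.
Local Open Scope ring_scope.

(* A normed space is given here as a carrier set V in an ambient vector space E
   together with a function N : E -> R, which need only be a norm on V.  This
   covers both the domains D(A^s), inside H, and their duals, inside the space
   of all functions H -> R. *)
Section bochner_spaces.
Context (R : realType) (E : lmodType R).
Implicit Types (V : set E) (N : E -> R) (I : set R) (u : R -> E).

Definition simple_fun V u : Prop :=
  exists (m : nat) (J : 'I_m -> set R) (x : 'I_m -> E),
    (forall i, measurable (J i) /\ V (x i)) /\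
    forall t, u t = \sum_(i < m) \1_(J i) t *: x i.

(* Pointwise limit of simple functions at every point of I.  An almost
   everywhere limit coincides almost everywhere with such a function, so the
   classes modulo almost everywhere equality are the usual ones. *)
Definition strongly_measurable I V N u : Prop :=
  (forall t, I t -> V (u t)) /\
  exists2 s : nat -> R -> E, (forall n, simple_fun V (s n)) &
    forall t, I t -> N (s n t - u t) @[n --> \oo] --> (0 : R).

Definition L2_sqint I N u : \bar R :=
  (\int[@lebesgue_measure R]_(t in I) ((N (u t)) ^+ 2)%:E)%E.

Definition L2_space I V N u : Prop :=
  strongly_measurable I V N u /\ (L2_sqint I N u < +oo)%E.

Definition L2_norm I N u : R := Num.sqrt (fine (L2_sqint I N u)).

End bochner_spaces.

Section operators.
Context (R : realType) (H : completeNormedModType R) (ip : {dot H for idfun}).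
Implicit Types (D : set H) (L : H -> H).

Definition subspace D : Prop :=
  D 0 /\ forall (a : R) u v, D u -> D v -> D (a *: u + v).

Definition linear_on (W : lmodType R) D (L : H -> W) : Prop :=
  forall (a : R) u v, D u -> D v -> L (a *: u + v) = a *: L u + L v.

Definition bilinear_on D (B : H -> H -> H) : Prop :=
  (forall w, D w -> linear_on D (B^~ w)) /\ (forall u, D u -> linear_on D (B u)).

(* The right-hand side of the equivalence says that (v, w) is in the graph of
   the Hilbert adjoint of (L, D). *)
Definition self_adjoint D L : Prop :=
  dense D /\
  forall v w, (D v /\ L v = w) <-> (forall u, D u -> ip (L u) v = ip u w).

Definition skew_symmetric_on D L : Prop :=
  forall u v, D u -> D v -> ip (L u) v = - ip u (L v).

Definition separable : Prop := exists2 Q : set H, countable Q & dense Q.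

Definition infinite_dimensional : Prop :=
  ~ exists (n : nat) (b : 'I_n -> H),
      forall x, exists c : 'I_n -> R, x = \sum_(i < n) c i *: b i.

Definition hilbert_basis (phi : nat -> H) : Prop :=
  (forall i j, ip (phi i) (phi j) = (i == j)%:R) /\
  forall x, series (fun k => ip x (phi k) *: phi k) @ \oo --> x.

End operators.

Section fractional_powers.
Context (R : realType) (H : completeNormedModType R) (ip : {dot H for idfun}).
Context (lam : nat -> R) (phi : nat -> H).
Implicit Types (s : R) (u v : H) (F : H -> R).

Definition frac_pow s u : H :=
  limn (series (fun k => (lam k `^ s * ip u (phi k)) *: phi k)).

Definition frac_dom s : set H := [set u |
  (\sum_(0 <= k <oo) (lam k `^ (2 * s) * (ip u (phi k)) ^+ 2)%:E < +oo)%E].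

Definition frac_norm s u : R := `|frac_pow s u|.

(* An element of D(A^s)^* is represented by a function F : H -> R, whose values
   outside D(A^s) are irrelevant. *)
Definition frac_dual s : set (H -> R) := [set F |
  linear_on (frac_dom s) F /\
  exists C : R, forall v, frac_dom s v -> `|F v| <= C * frac_norm s v].

Definition dual_norm s F : R :=
  sup [set `|F v| | v in [set v | frac_dom s v /\ frac_norm s v <= 1]].

Definition pivot u : H -> R := fun v => ip u v.

(* x -> u in D(A^s) with x ranging over D *)
Definition nbhs_in (D : set H) s u : set_system H :=
  filter_from [set e : R | 0 < e]
    (fun e => [set x | D x /\ frac_norm s (x - u) < e]).

(* Extensions by continuity of operators given on D, with values in a dual:
   the functionals v |-> <L u, v> and v |-> <B[u, w], v>. *)
Definition ext_op (D : set H) s (L : H -> H) u : H -> R :=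
  fun v => lim ((fun x => ip (L x) v : R) @ nbhs_in D s u).

Definition ext_bilin (D : set H) s1 s2 (B : H -> H -> H) u w : H -> R :=
  fun v => lim ((fun z : H * H => ip (B z.1 z.2) v : R) @
                filter_prod (nbhs_in D s1 u) (nbhs_in D s2 w)).

End fractional_powers.

Section structure.
Context (R : realType) (H : completeNormedModType R) (ip : {dot H for idfun}).

Record structural_assumptions (D : set H) (A S : H -> H) (B : H -> H -> H)
    (lam : nat -> R) (phi : nat -> H) (sigma : R) : Prop := {
  sa_norm : forall x, ip x x = `|x| ^+ 2 ;
  sa_infinite : infinite_dimensional H ;
  sa_separable : separable H ;
  sa_dom : subspace D ;
  sa_dense : dense D ;
  sa_A_linear : linear_on D A ;
  sa_A_self_adjoint : self_adjoint ip D A ;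
  sa_eigen_pos : forall k, 0 < lam k ;
  sa_eigen_mono : forall k, lam k <= lam k.+1 ;
  sa_eigen_infty : lam @ \oo --> +oo ;
  sa_eigenvector : forall k, D (phi k) /\ A (phi k) = lam k *: phi k ;
  sa_basis : hilbert_basis ip phi ;
  sa_S_linear : linear_on D S ;
  sa_S_skew : skew_symmetric_on ip D S ;
  sa_S_bounded : exists C : R, forall u, D u ->
    `|S u| <= C * frac_norm ip lam phi (1 / 2) u ;
  sa_B_bilinear : bilinear_on D B ;
  sa_B_bounded : exists2 C : R, 0 < C & forall u w v, D u -> D w ->
    frac_dom ip lam phi ((1 - sigma) / 2) v ->
    `|ip (B u w) v| <= C * frac_norm ip lam phi ((sigma + 1) / 2) u *
      frac_norm ip lam phi (sigma / 2) w *
      frac_norm ip lam phi ((1 - sigma) / 2) v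
}.

End structure.

Section cauchy_problem.
Context (R : realType) (H : completeNormedModType R) (ip : {dot H for idfun}).
Context (D : set H) (A S : H -> H) (B : H -> H -> H).
Context (lam : nat -> R) (phi : nat -> H) (sigma T : R).

Local Notation mu := (@lebesgue_measure R).
Local Notation dom := (frac_dom ip lam phi).
Local Notation norm := (frac_norm ip lam phi).
Local Notation dual := (frac_dual ip lam phi).
Local Notation dnorm := (dual_norm ip lam phi).

Definition test_function (h : R -> R) : Prop :=
  (forall n x, derivable (derive1n n h) x 1) /\
  exists a b : R, [/\ 0 < a, b < T & forall x, x \notin `[a, b] -> h x = 0].

(* W is the distributional derivative of U on (0, T).  The integrals are
   elements of D(A^s)^*, hence compared by their values at each v. *)
Definition weak_derivative (s : R) (U W : R -> H -> R) : Prop :=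
  forall h, test_function h -> forall v, dom s v ->
    \int[mu]_(t in `]0, T[) (derive1 h t * U t v) =
    - \int[mu]_(t in `]0, T[) (h t * W t v).

Definition L2_dual : set (R -> H -> R) :=
  L2_space `]0, T[%classic (dual ((1 - sigma) / 2)) (dnorm ((1 - sigma) / 2)).

Definition L2_dual_norm (f : R -> H -> R) : R :=
  L2_norm `]0, T[%classic (dnorm ((1 - sigma) / 2)) f.

Definition time_derivative (u : R -> H) (w : R -> H -> R) : Prop :=
  L2_dual w /\ weak_derivative ((1 - sigma) / 2) (pivot ip \o u) w.

Definition solution_space : set (R -> H) := [set u |
  L2_space `]0, T[%classic (dom ((1 + sigma) / 2)) (norm ((1 + sigma) / 2)) u /\
  (L2_dual (pivot ip \o u) /\ exists w, time_derivative u w)].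

(* u(0) = g is read on the representative of u in C([0, T]; D(A^(sigma/2))). *)
Definition initial_value (u : R -> H) (g : H) : Prop :=
  exists ub : R -> H,
    [/\ {ae mu, forall t, t \in `]0, T[ -> ub t = u t},
        forall t, t \in `[0, T] -> dom (sigma / 2) (ub t) /\
          norm (sigma / 2) (ub t' - ub t) @[t' --> within `[0, T]%classic (nbhs t)]
            --> (0 : R)
      & ub 0 = g].

Definition evolution_equation (u : R -> H) (f : R -> H -> R) : Prop :=
  exists2 w, time_derivative u w &
    {ae mu, forall t, t \in `]0, T[ -> forall v, dom ((1 - sigma) / 2) v ->
       w t v +
       ext_op ip lam phi D ((1 + sigma) / 2) (fun x => A x + S x) (u t) v +
       ext_bilin ip lam phi D ((sigma + 1) / 2) (sigma / 2) B (u t) (u t) v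
       = f t v}.

Definition is_solution (f : R -> H -> R) (g : H) (u : R -> H) : Prop :=
  [/\ solution_space u, evolution_equation u f & initial_value u g].

End cauchy_problem.

(* Main.v *)
(** Along the eigenbasis the equation is the system
    x_k' = - lam_k x_k + f_k - N(x)_k.  With the weights w0 = lam^sigma,
    w1 = lam^(1 + sigma), wm = lam^(sigma - 1), testing with exp(-2 g t) w0_k x_k
    bounds the w0-energy uniformly in time and the time integral of the energy
    for w1 + 2 g w0 by the data and the time integral of the wm-energy of the
    forcing.  The skew part is subordinate,
    |<S u, v>| <= (eps |u|_1 + K_eps |u|_0) |v|, so a large g absorbs it, and the
    quadratic part is absorbed by the smallness of the data: Picard iteration
    contracts.  A competing solution need not be small, its w1-energy being only
    integrable in time; splitting that energy into a bounded part, absorbed by g,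
    and a part of small integral gives uniqueness.  Membership in the Bochner
    spaces is read off the coordinates, and a continuous function with an
    integrable weak derivative is a primitive of it by the du Bois-Reymond
    lemma, so the two problems have the same solutions. *)
Require Import Defs.
From mathcomp Require Import measurable_realfun ring lra.
Set Implicit Arguments.
Unset Strict Implicit.
Unset Printing Implicit Defensive.
Import Order.TTheory GRing.Theory Num.Theory.
Local Open Scope classical_set_scope.
Local Open Scope ring_scope.

(** The proof rests on an asymmetry in [B[x,x] - B[y,y] = B[x,x-y] + B[x-y,y]]: the strong energy
    [w1] of the difference is multiplied only by the weak energy [w0] of [y], and the strong energy
    of [x] only by the weak energy of the difference. Absorbing the strong energy of the difference
    therefore takes smallness of [y] alone, uniformly in time. In the uniqueness proof the Picard
    solution takes the place of [y] and the arbitrary competitor that of [x]. The order of choice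
    matters: the rate [g] is fixed by the skew part, then the radius by [g], [T] and the bilinear
    constant; for uniqueness a second rate is chosen once the competitor is known. Energies are
    squared norms with values in the extended reals, so estimates can be stated without membership
    conditions. Squares turn the triangle inequality into one with factors 2, and the contraction
    factor 1/4 is calibrated to pay for them. The skew part may couple all coordinates, so it is
    counted in the nonlinearity [N]; only the diagonal part is solved exactly. *)

Section integrable_real.
Context d (T : measurableType d) (R : realType).
Variables (m : {measure set T -> \bar R}) (D : set T).
Hypothesis mD : measurable D.
Implicit Types f g : T -> R.

Lemma integrable_measurable f :
  m.-integrable D (EFin \o f) -> measurable_fun D f.
Proof. by move=> /integrableP[/measurable_EFinP]. Qed.

Lemma integrable_le f g : measurable_fun D f ->
  (forall x, D x -> `|f x| <= `|g x|) ->
  m.-integrable D (EFin \o g) -> m.-integrable D (EFin \o f).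
Proof.
by move=> mf fg; apply: le_integrable => //; exact/measurable_EFinP.
Qed.

Lemma integrable_indicM f (A : set T) : measurable A ->
  m.-integrable D (EFin \o f) ->
  m.-integrable D (EFin \o (fun x => f x * \1_A x)).
Proof.
move=> mA fi; apply: (integrable_le _ _ (fi)).
  by apply: measurable_funM; [exact: integrable_measurable fi|
                              exact: measurable_indic].
move=> x _; rewrite normrM ler_piMr// indicE.
by case: (_ \in _); rewrite ?normr1 ?normr0.
Qed.

Lemma EFin_Rintegral f : m.-integrable D (EFin \o f) ->
  (\int[m]_(x in D) f x)%:E = (\int[m]_(x in D) (f x)%:E)%E.
Proof. by move=> fi; rewrite fineK//; exact: integrable_fin_num. Qed.

Lemma integrable_patch f : m.-integrable D (EFin \o f) ->
  m.-integrable setT (EFin \o (f \_ D)).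
Proof. by move=> /(integrable_mkcond _ mD); rewrite restrict_EFin. Qed.

Lemma integrable_scale (k : R) f : m.-integrable D (EFin \o f) ->
  m.-integrable D (EFin \o (fun x => k * f x)).
Proof. by move=> /(integrableZl mD k). Qed.

Lemma integrable_add f g : m.-integrable D (EFin \o f) ->
  m.-integrable D (EFin \o g) -> m.-integrable D (EFin \o (fun x => f x + g x)).
Proof. by move=> fi gi; have := integrableD mD fi gi. Qed.

Lemma integrable_diff f g : m.-integrable D (EFin \o f) ->
  m.-integrable D (EFin \o g) -> m.-integrable D (EFin \o (fun x => f x - g x)).
Proof. by move=> fi gi; have := integrableB mD fi gi. Qed.

Lemma measurable_patch f : measurable_fun D f -> measurable_fun setT (f \_ D).
Proof. by move=> mf; apply/(measurable_restrictT _ mD). Qed.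

Lemma integrable_bddM f g : measurable_fun D g ->
  (exists M : R, forall t, D t -> `|g t| <= M) ->
  m.-integrable D (EFin \o f) -> m.-integrable D (EFin \o (fun s => f s * g s)).
Proof.
move=> mg [M gM] fi.
apply: (integrable_le _ _ (integrable_scale M fi)).
  by apply: measurable_funM => //; exact: integrable_measurable fi.
move=> s Ds; rewrite !normrM mulrC ler_wpM2r//.
by rewrite (le_trans (gM _ Ds))// ler_norm.
Qed.

End integrable_real.

(** * Integration by parts for integrable functions, from Fubini's theorem *)

Section product_rule.
Context {R : realType}.
Local Notation mu := (@lebesgue_measure R).
Implicit Types a b : R -> R.

Local Notation below x := `]-oo, x]%classic.

Lemma measurable_below_indic (s : bool) :
  measurable_fun setT
    (fun z : R * R => \1_(if s then [set z : R * R | z.2 <= z.1]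
                          else [set z | z.1 < z.2]) z : R).
Proof.
apply: measurable_indic; case: s.
- rewrite (_ : [set _ | _] = (fun z : R * R => z.1 - z.2) @^-1` `[0, +oo[).
    rewrite -[X in measurable X]setTI; apply: measurable_funB => //.
  by apply/seteqP; split => z /=; rewrite in_itv/= andbT subr_ge0.
- rewrite (_ : [set _ | _] = (fun z : R * R => z.2 - z.1) @^-1` `]0, +oo[).
    rewrite -[X in measurable X]setTI; apply: measurable_funB => //.
  by apply/seteqP; split => z /=; rewrite in_itv/= andbT subr_gt0.
Qed.

Lemma integrable_tensor a b :
  mu.-integrable setT (EFin \o a) -> mu.-integrable setT (EFin \o b) ->
  (mu \x mu)%E.-integrable setT (EFin \o (fun z : R * R => a z.1 * b z.2)).
Proof.
move=> ia ib.
have ma := integrable_measurable ia; have mb := integrable_measurable ib.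
apply/integrable12ltyP.
  by apply/measurable_EFinP; apply: measurable_funM; apply: measurableT_comp.
rewrite /comp /=.
under eq_integral => x _.
  under eq_integral => y _ do rewrite normrM EFinM.
  rewrite ge0_integralZl//; last 1 first.
    by apply/measurable_EFinP/measurableT_comp.
  over.
have /integrableP[_ ia1] := ia; have /integrableP[_ ib1] := ib.
rewrite ge0_integralZr//; last exact: integral_ge0.
  rewrite lte_mul_pinfty//; first exact: integral_ge0.
  by rewrite ge0_fin_numE//; exact: integral_ge0.
by apply/measurable_EFinP/measurableT_comp.
Qed.

(** The flag chooses between the closed half plane below the diagonal and its open complement. The
    diagonal belongs to exactly one of them, so the two indicators add up to 1 everywhere, as
    [below_indicD] records. *)
Lemma integrable_tensor_cut a b (s : bool) :
  mu.-integrable setT (EFin \o a) -> mu.-integrable setT (EFin \o b) ->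
  (mu \x mu)%E.-integrable setT (fun z : R * R => (a z.1 * b z.2 *
    \1_(if s then [set z : R * R | z.2 <= z.1]
        else [set z | z.1 < z.2]) z)%:E).
Proof.
move=> ia ib.
have ma := integrable_measurable ia; have mb := integrable_measurable ib.
have mm : measurable_fun setT (fun z : R * R => a z.1 * b z.2).
  by apply: measurable_funM; apply: measurableT_comp.
have iab := integrable_tensor ia ib.
apply: (integrable_le _ _ _ iab) => //.
  by apply: measurable_funM => //; exact: measurable_below_indic.
move=> z _; rewrite normrM ler_piMr// indicE.
by case: (_ \in _); rewrite ?normr1 ?normr0.
Qed.

Lemma integral_below_cut b (x : R) :
  mu.-integrable setT (EFin \o b) ->
  (\int[mu]_y (b y * \1_(below x) y)%:E = (\int[mu]_(y in below x) b y)%:E)%E.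
Proof.
move=> ib; rewrite /Rintegral fineK; last first.
  by apply: integrable_fin_num => //; exact: integrableS ib.
rewrite [RHS]integral_mkcond; apply: eq_integral => y _.
by rewrite patchE indicE; case: (_ \in _); rewrite ?mulr1 ?mulr0.
Qed.

(** Sections of the open half plane are open half lines. The missing endpoint is a null set, so both
    halves of the plane lead to integrals over [below x]. *)
Lemma integral_below_cuto b (x : R) :
  mu.-integrable setT (EFin \o b) ->
  (\int[mu]_y (b y * \1_(`]-oo, x[%classic) y)%:E =
   (\int[mu]_(y in below x) b y)%:E)%E.
Proof.
move=> ib; rewrite -Rintegral_itv_bndo_bndc; last first.
  exact: integrableS ib.
rewrite /Rintegral fineK; last first.
  by apply: integrable_fin_num => //; exact: integrableS ib.
rewrite [RHS]integral_mkcond; apply: eq_integral => y _.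
by rewrite patchE indicE; case: (_ \in _); rewrite ?mulr1 ?mulr0.
Qed.

Lemma below_indicD (z : R * R) :
  \1_[set z : R * R | z.2 <= z.1] z + \1_[set z : R * R | z.1 < z.2] z = 1 :> R.
Proof.
case: z => x y; rewrite !indicE /=; case: (leP y x) => yx.
- by rewrite mem_set// memNset ?addr0//= ltNge yx.
- by rewrite memNset ?mem_set ?add0r//= leNgt yx.
Qed.

(* The square is cut along its diagonal. *)
Lemma product_ruleT a b :
  mu.-integrable setT (EFin \o a) -> mu.-integrable setT (EFin \o b) ->
  ((\int[mu]_x a x)%:E * (\int[mu]_x b x)%:E =
   \int[mu]_x (a x * \int[mu]_(y in below x) b y)%:E +
   \int[mu]_x (b x * \int[mu]_(y in below x) a y)%:E)%E.
Proof.
move=> ia ib.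
have i1 := integrable_tensor_cut true ia ib.
have i2 := integrable_tensor_cut false ia ib.
transitivity (\int[mu \x mu]_z ((a z.1 * b z.2 *
    \1_[set z : R * R | z.2 <= z.1] z)%:E +
    (a z.1 * b z.2 * \1_[set z : R * R | z.1 < z.2] z)%:E))%E; last first.
  rewrite integralD//; congr (_ + _)%E.
  - rewrite -integral12_prod_meas1//; apply: eq_integral => x _ /=.
    rewrite /fubini_F EFinM -integral_below_cut// -integralZl//; last exact: integrable_indicM.
    apply: eq_integral => y _; rewrite -EFinM mulrA !indicE /=.
    by rewrite !mem_setE /= in_itv.
  - rewrite -integral21_prod_meas1//; apply: eq_integral => x _ /=.
    rewrite /fubini_G EFinM -integral_below_cuto// -integralZl//; last exact: integrable_indicM.
    apply: eq_integral => y _; rewrite -EFinM mulrA (mulrC (b x)) !indicE /=.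
    by rewrite !mem_setE /= in_itv.
transitivity (\int[mu \x mu]_z (a z.1 * b z.2)%:E)%E; last first.
  apply: eq_integral => z _.
  by rewrite -EFinD -mulrDr (below_indicD z) mulr1.
rewrite -integral12_prod_meas1//; last exact: integrable_tensor.
under [RHS]eq_integral => x _.
  rewrite /fubini_F /=.
  under eq_integral => y _ do rewrite EFinM.
  rewrite integralZl//.
  over.
rewrite /= -[(\int[mu]_y (b y)%:E)%E]fineK; last exact: integrable_fin_num.
rewrite integralZr// /Rintegral fineK//; exact: integrable_fin_num.
Qed.

End product_rule.

(** * Absolutely continuous functions as primitives *)

Section primitives.
Context {R : realType}.
Local Notation mu := (@lebesgue_measure R).
Implicit Types (a b z w F : R -> R) (T t x y : R).

Definition prim a t : R := \int[mu]_(s in `[0, t]) a s.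

(** This encodes [z' = a], [z 0 = x0] for an absolutely continuous [z] with a merely integrable
    density: only integrals occur, never pointwise derivatives of [z]. Nothing is asked of [z]
    outside [[0, T]]. *)
Definition is_prim T x0 a z : Prop :=
  mu.-integrable `[0, T] (EFin \o a) /\
  forall t, t \in `[0, T] -> z t = x0 + prim a t.

Lemma integrable_sub T t a : t \in `[0, T] ->
  mu.-integrable `[0, T] (EFin \o a) -> mu.-integrable `[0, t] (EFin \o a).
Proof.
rewrite in_itv/= => /andP[t0 tT]; apply: integrableS => //.
by apply: subset_itvl; rewrite bnd_simp.
Qed.

Lemma prim0 a : prim a 0 = 0.
Proof. by rewrite /prim set_itv1 Rintegral_set1. Qed.

Lemma primD t a b : mu.-integrable `[0, t] (EFin \o a) ->
  mu.-integrable `[0, t] (EFin \o b) ->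
  prim (fun s => a s + b s) t = prim a t + prim b t.
Proof. by move=> ia ib; rewrite /prim RintegralD. Qed.

Lemma primZ t k a : mu.-integrable `[0, t] (EFin \o a) ->
  prim (fun s => k * a s) t = k * prim a t.
Proof. by move=> ia; rewrite /prim RintegralZl. Qed.

Lemma prim_continuous T a : 0 <= T -> mu.-integrable `[0, T] (EFin \o a) ->
  {within `[0, T], continuous (prim a)}.
Proof. by move=> T0 ia; exact: parameterized_integral_continuous. Qed.

Lemma is_prim_continuous T x0 a z : 0 <= T -> is_prim T x0 a z ->
  {within `[0, T], continuous z}.
Proof.
move=> T0 [ia za].
have : {within `[0, T], continuous (fun t => x0 + prim a t)}.
  by move=> t; apply: cvgD; [exact: cvg_cst|exact: prim_continuous].
apply: subspace_eq_continuous => t; rewrite inE /from_subspace => tT.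
by rewrite za ?inE.
Qed.

Lemma within_continuous_measurable T (z : R -> R) :
  {within `[0, T], continuous z} -> measurable_fun `[0, T] z.
Proof. by move=> cz; exact: subspace_continuous_measurable_fun. Qed.

Lemma is_prim_measurable T x0 a z : 0 <= T -> is_prim T x0 a z ->
  measurable_fun `[0, T]%classic z.
Proof.
by move=> T0 za; apply: within_continuous_measurable; exact: is_prim_continuous za.
Qed.

Lemma is_prim_bounded T x0 a z : 0 <= T -> is_prim T x0 a z ->
  exists2 M, 0 <= M & forall t, t \in `[0, T] -> `|z t| <= M.
Proof.
move=> T0 [ia za]; exists (`|x0| + \int[mu]_(s in `[0, T]) `|a s|).
  by rewrite addr_ge0// Rintegral_ge0.
move=> t tT; rewrite za// (le_trans (ler_normD _ _))// lerD2l.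
have iat := integrable_sub tT ia.
rewrite (le_trans (le_normr_Rintegral _ iat))//.
have ian : mu.-integrable `[0, T] (EFin \o (fun s => `|a s|)).
  exact: integrable_norm.
rewrite -lee_fin !EFin_Rintegral//; last exact: integrable_norm.
apply: ge0_subset_integral => //.
  exact: (measurable_int _ ian).
by move: tT; rewrite in_itv/= => /andP[_ tT]; apply: subset_itvl; rewrite bnd_simp.
Qed.

Lemma is_prim_integrableM T x0 a z b : 0 <= T -> is_prim T x0 a z ->
  mu.-integrable `[0, T] (EFin \o b) ->
  mu.-integrable `[0, T] (EFin \o (fun s => b s * z s)).
Proof.
move=> T0 za ib; apply: integrable_bddM => //.
  exact: is_prim_measurable za.
by have [M _ zM] := is_prim_bounded T0 za; exists M => t; exact: zM.
Qed.

Lemma eq_is_prim T x0 a b z w : is_prim T x0 a z ->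
  (forall t, t \in `[0, T] -> a t = b t) ->
  (forall t, t \in `[0, T] -> z t = w t) -> is_prim T x0 b w.
Proof.
move=> [ia za] ab zw; split.
  by apply: eq_integrable ia => // t; rewrite inE /= => tT; rewrite ab.
move=> t tT; rewrite -zw// za//; congr (_ + _); apply: eq_Rintegral => s.
rewrite inE/= => st; apply: ab; move: tT st; rewrite !in_itv/=.
by move=> /andP[_ tT] /andP[-> /le_trans]; exact.
Qed.

Lemma is_primD T x0 y0 a b z w : is_prim T x0 a z -> is_prim T y0 b w ->
  is_prim T (x0 + y0) (a \+ b) (z \+ w).
Proof.
move=> [ia za] [ib wb]; split.
  exact: integrable_add.
move=> t tT; have iat := integrable_sub tT ia; have ibt := integrable_sub tT ib.
by rewrite /= za// wb// primD// addrACA.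
Qed.

Lemma is_primZ T x0 a z k : is_prim T x0 a z ->
  is_prim T (k * x0) (fun t => k * a t) (fun t => k * z t).
Proof.
move=> [ia za]; split.
  exact: integrable_scale.
move=> t tT; have iat := integrable_sub tT ia.
by rewrite /= za// primZ// mulrDr.
Qed.

Lemma is_primB T x0 y0 a b z w : is_prim T x0 a z -> is_prim T y0 b w ->
  is_prim T (x0 - y0) (a \- b) (z \- w).
Proof.
move=> za wb; have := is_primD za (is_primZ (-1) wb).
rewrite mulN1r => h; apply: (eq_is_prim h) => t _ /=; by rewrite mulN1r.
Qed.

Lemma integral_cut0 T (f : R -> R) t : t \in `[0, T] ->
  \int[mu]_(s in `]-oo, t]) (f \_ `[0, T]) s = prim f t.
Proof.
rewrite in_itv/= => /andP[t0 tT].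
rewrite Rintegral_mkcond /prim [RHS]Rintegral_mkcond; congr fine.
apply: eq_integral => s _; congr EFin.
rewrite !patchE !mem_setE !in_itv/=; case: (leP s t) => //= st.
  by rewrite (le_trans st tT) andbT.
by rewrite andbF.
Qed.

(** Extending [a] and [b] by zero outside [[0, T]] turns the half-line integrals of [product_ruleT]
    into [prim]. *)
Lemma prim_product T a b : 0 <= T ->
  mu.-integrable `[0, T] (EFin \o a) -> mu.-integrable `[0, T] (EFin \o b) ->
  prim a T * prim b T = prim (fun s => a s * prim b s + prim a s * b s) T.
Proof.
move=> T0 ia ib.
have pa : is_prim T 0 a (prim a) by split => // t _; rewrite add0r.
have pb : is_prim T 0 b (prim b) by split => // t _; rewrite add0r.
have TT : T \in `[0, T] by rewrite in_itv/= T0 lexx.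
have iar : mu.-integrable setT (EFin \o (a \_ `[0, T])).
  exact: integrable_patch.
have ibr : mu.-integrable setT (EFin \o (b \_ `[0, T])).
  exact: integrable_patch.
have := product_ruleT iar ibr.
have cut (f g : R -> R) : (\int[mu]_x ((f \_ `[0%R, T]) x *
    \int[mu]_(y in `]-oo, x]) (g \_ `[0%R, T]) y)%:E)%E =
    (\int[mu]_(x in `[0%R, T]) (f x * prim g x)%:E)%E.
  rewrite [RHS]integral_mkcond; apply: eq_integral => x _.
  rewrite !patchE; case: ifPn => [|_]; last by rewrite mul0r.
  by rewrite mem_setE => xT; rewrite integral_cut0.
rewrite !cut /prim !(Rintegral_mkcond mu `[0, T]).
move=> /(congr1 fine); rewrite -EFinM /= => ->.
rewrite -Rintegral_mkcond /Rintegral -integralD//=; last 2 first.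
  exact: is_prim_integrableM pb ia.
  exact: is_prim_integrableM pa ib.
by congr fine; apply: eq_integral => x _; rewrite -EFinD (mulrC (b x)).
Qed.

(** The product of [x0 + prim a] and [y0 + prim b] is expanded: the mixed terms are linear, and only
    [prim a * prim b] calls for [prim_product], applied on [[0, t]]. *)
Lemma is_primM T x0 y0 a b z w : 0 <= T ->
  is_prim T x0 a z -> is_prim T y0 b w ->
  is_prim T (x0 * y0) (fun t => a t * w t + z t * b t) (fun t => z t * w t).
Proof.
move=> T0 za wb; have [ia zE] := za; have [ib wE] := wb.
have iaw : mu.-integrable `[0, T] (EFin \o (fun t => a t * w t)).
  exact: is_prim_integrableM wb ia.
have izb : mu.-integrable `[0, T] (EFin \o (fun t => z t * b t)).
  rewrite (_ : (fun t => _) = (fun t => b t * z t)); last first.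
    by apply/funext => t; rewrite mulrC.
  exact: is_prim_integrableM za ib.
split; first exact: integrable_add.
move=> t tT; move: (tT); rewrite in_itv/= => /andP[t0 _].
have iat := integrable_sub tT ia; have ibt := integrable_sub tT ib.
have sub s : s \in `[0, t] -> s \in `[0, T].
  move: tT; rewrite !in_itv/=.
  by move=> /andP[_ tT] /andP[-> /le_trans]; exact.
have pat : is_prim t 0 a (prim a) by split => // s _; rewrite add0r.
have pbt : is_prim t 0 b (prim b) by split => // s _; rewrite add0r.
have i1 := is_prim_integrableM t0 pbt iat.
have i2 : mu.-integrable `[0, t] (EFin \o (fun s => prim a s * b s)).
  rewrite (_ : (fun t => _) = (fun t => b t * prim a t)); last first.
    by apply/funext => s; rewrite mulrC.
  exact: is_prim_integrableM pat ibt.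
have ixb : mu.-integrable `[0, t] (EFin \o (fun s => x0 * b s)).
  exact: integrable_scale.
have iya : mu.-integrable `[0, t] (EFin \o (fun s => y0 * a s)).
  exact: integrable_scale.
rewrite zE// wE// mulrDl !mulrDr -addrA; congr (_ + _).
rewrite prim_product//.
transitivity (prim (fun s =>
   (x0 * b s + y0 * a s) + (a s * prim b s + prim a s * b s)) t); last first.
  apply: eq_Rintegral => s; rewrite inE/= => /sub sT.
  by rewrite zE// wE// /prim; ring.
rewrite [RHS]primD; [|exact: integrable_add|exact: integrable_add].
by rewrite [X in _ = X + _]primD// !primZ// addrA (mulrC y0).
Qed.

Lemma is_prim_expR T k : 0 <= T ->
  is_prim T 1 (fun t => k * expR (k * t)) (fun t => expR (k * t)).
Proof.
move=> T0.
have ck : continuous (fun t => k * expR (k * t)).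
  move=> t; apply: cvgM; first exact: cvg_cst.
  apply: (@cvg_comp _ _ _ (fun t => k * t) expR); last exact: continuous_expR.
  by apply: cvgM; [exact: cvg_cst|exact: cvg_id].
split.
  apply: continuous_compact_integrable; first exact: segment_compact.
  exact: continuous_subspaceT.
move=> t; rewrite in_itv/= => /andP[]; rewrite le_eqVlt => /predU1P[<- _|t0 _].
  by rewrite prim0 mulr0 expR0 addr0.
have dk (x : R) : is_derive x 1 (fun t => expR (k * t)) (k * expR (k * x)).
  have dkx : is_derive x 1 (fun t => k * t) (k *: (1 : R)) by exact: is_deriveZ.
  have := is_derive1_comp (is_derive_expR (k * x)) dkx.
  by rewrite /GRing.scale /= mulr1 mulrC.
rewrite /prim /Rintegral (continuous_FTC2 (F := fun t => expR (k * t)) t0).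
- by rewrite /= mulr0 expR0 addrCA subrr addr0.
- exact: continuous_subspaceT.
- have ce : continuous (fun t => expR (k * t)).
    move=> x; apply: differentiable_continuous.
    by apply/derivable1_diffP; have [] := dk x.
  split; first by move=> x _; have [] := dk x.
  + exact/cvg_at_right_filter/ce.
  + exact/cvg_at_left_filter/ce.
- by move=> x _; rewrite derive1E; have [_ ->] := dk x.
Qed.

End primitives.

(** * One scalar equation: Duhamel's formula and the weighted energy inequality *)

Section scalar_equation.
Context {R : realType}.
Local Notation mu := (@lebesgue_measure R).
Implicit Types (a b z w F : R -> R) (T t x y l g : R).

(** Variation of constants for [z' = - l z + F] with [z 0 = x]. *)
Definition duhamel l x F t : R :=
  expR (- l * t) * (x + prim (fun s => expR (l * s) * F s) t).

Lemma duhamel_is_prim T l x F : 0 <= T ->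
  mu.-integrable `[0, T] (EFin \o F) ->
  is_prim T x (fun t => - l * duhamel l x F t + F t) (duhamel l x F).
Proof.
move=> T0 iF.
have iG : mu.-integrable `[0, T] (EFin \o (fun s => expR (l * s) * F s)).
  rewrite (_ : (fun s => _) = (fun s => F s * expR (l * s))); last first.
    by apply/funext => s; rewrite mulrC.
  exact: is_prim_integrableM (is_prim_expR l T0) iF.
have pG : is_prim T x (fun s => expR (l * s) * F s)
    (fun t => x + prim (fun s => expR (l * s) * F s) t) by split.
have := is_primM T0 (is_prim_expR (- l) T0) pG; rewrite mul1r => h.
apply: (eq_is_prim h) => // t _.
rewrite /duhamel mulrA -mulrA; congr (_ + _).
by rewrite ?mulrA -expRD mulNr addNr expR0 mul1r.
Qed.

(** The square of [exp(- g t)]: thus [wt g t * z t ^+ 2] is the square of one function, to which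
    [is_primM] applies. On [[0, T]], for [g >= 0], it lies between [wt g T] and 1, which is how the
    weight is inserted and removed later. *)
Definition wt g t : R := expR (- (2 * g) * t).

Lemma wt_gt0 g t : 0 < wt g t. Proof. exact: expR_gt0. Qed.

Lemma wt_ge0 g t : 0 <= wt g t. Proof. exact/ltW/wt_gt0. Qed.

Lemma wt_le1 g t : 0 <= g -> 0 <= t -> wt g t <= 1.
Proof.
by move=> g0 t0; rewrite -expR0 ler_expR mulNr oppr_le0 !mulr_ge0.
Qed.

Lemma wt_ge g T t : 0 <= g -> t <= T -> wt g T <= wt g t.
Proof.
by move=> g0 tT; rewrite ler_expR !mulNr lerN2 ler_wpM2l// mulr_ge0.
Qed.

Lemma measurable_wt g (D : set R) : measurable_fun D (wt g).
Proof.
apply: measurableT_comp; first exact: measurable_expR.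
exact: measurable_funM.
Qed.

(** Made for a forcing whose square need not be integrable: the right-hand side may be infinite. *)
Lemma Rintegral_le_ge0 (D : set R) a b : measurable D ->
  mu.-integrable D (EFin \o a) -> measurable_fun D b ->
  (forall s, D s -> 0 <= b s) -> (forall s, D s -> a s <= b s) ->
  ((\int[mu]_(s in D) a s)%:E <= \int[mu]_(s in D) (b s)%:E)%E.
Proof.
move=> mD ia mb b0 ab.
have [bi|] := ltP (\int[mu]_(s in D) (b s)%:E)%E +oo%E; last first.
  by rewrite leye_eq => /eqP ->; rewrite leey.
have ib : mu.-integrable D (EFin \o b).
  apply/integrableP; split; first exact/measurable_EFinP.
  apply: le_lt_trans bi; rewrite le_eqVlt; apply/orP; left; apply/eqP; apply: eq_integral => s.
  by rewrite inE => Ds /=; rewrite ger0_norm// b0.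
rewrite EFin_Rintegral//; apply: le_integral => // s; rewrite inE => Ds.
by rewrite lee_fin ab.
Qed.

Lemma is_prim_force_measurable T l x F z : 0 <= T ->
  is_prim T x (fun t => - l * z t + F t) z -> measurable_fun `[0, T] F.
Proof.
move=> T0 zP; have [/integrable_measurable ma _] := zP.
have mz := is_prim_measurable T0 zP.
rewrite (_ : F = (fun s => (- l * z s + F s) + l * z s)); last first.
  by apply/funext => s; rewrite mulNr addrAC addNr add0r.
by apply: measurable_funD => //; exact: measurable_funM.
Qed.

(** By the product rule the derivative of [wt g * z ^+ 2] is [wt g] times
    [2 z F - 2 l z^2 - 2 g z^2]. Adding [(l + 2 g) z^2] leaves [2 z F - l z^2], which is at most
    [F^2 / l] by completing the square: half of the damping [2 l z^2] pays for the forcing, the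
    other half stays on the left. *)
Lemma scalar_energy T g l x F z : 0 <= T -> 0 <= g -> 0 < l ->
  is_prim T x (fun t => - l * z t + F t) z ->
  forall t, t \in `[0, T] ->
  ((wt g t * z t ^+ 2)%:E +
     \int[mu]_(s in `[0%R, t]) (wt g s * ((l + 2 * g) * z s ^+ 2))%:E <=
   (x ^+ 2)%:E + \int[mu]_(s in `[0%R, t]) (wt g s * (l^-1 * F s ^+ 2))%:E)%E.
Proof.
move=> T0 g0 l0 zP t tT.
have t0 : 0 <= t by move: tT; rewrite in_itv/= => /andP[].
have cz := is_prim_continuous T0 zP.
have yP := is_primM T0 (is_prim_expR (- g) T0) zP.
rewrite mul1r in yP.
have := is_primM T0 yP yP; set h := (fun t => _ + _ * _).
move=> [ih /(_ _ tT)] => hE.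
have wtE s : wt g s = expR (- g * s) * expR (- g * s).
  by rewrite -expRD /wt; congr expR; ring.
have -> : wt g t * z t ^+ 2 = x ^+ 2 + prim h t.
  by rewrite [x ^+ 2]expr2 -hE wtE; ring.
have sub : `[0, t] `<=` `[0, T].
  by move: tT; rewrite in_itv/= => /andP[_ tT]; apply: subset_itvl; rewrite bnd_simp.
have iht := integrable_sub tT ih.
have mz : measurable_fun `[0, t] z.
  by apply: measurable_funS (is_prim_measurable T0 zP).
have mF : measurable_fun `[0, t] F.
  by apply: measurable_funS (is_prim_force_measurable T0 zP).
have iq : mu.-integrable `[0, t] (EFin \o (fun s => wt g s * ((l + 2 * g) * z s ^+ 2))).
  have i1 : mu.-integrable `[0, T] (EFin \o (fun s => z s * z s)).
    apply: is_prim_integrableM zP _ => //.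
    by apply: continuous_compact_integrable; [exact: segment_compact|].
  have i2 : mu.-integrable `[0, T] (EFin \o (fun s => (l + 2 * g) * (z s * z s))).
    exact: integrable_scale.
  have := integrable_sub tT (is_prim_integrableM T0 (is_prim_expR (- (2 * g)) T0) i2).
  rewrite (_ : (fun s => _) = (fun s => wt g s * ((l + 2 * g) * z s ^+ 2)))//.
  by apply/funext => s; rewrite mulrC expr2.
rewrite EFinD -addeA leeD2l// -EFin_Rintegral// -EFinD.
rewrite -[X in (_ + X)%:E]/(prim _ t) -primD//; apply: Rintegral_le_ge0 => //.
- exact: integrable_add.
- apply: measurable_funM; first exact: measurable_wt.
  by apply: measurable_funM => //; exact: measurable_funX.
- by move=> s _; rewrite mulr_ge0 ?wt_ge0// mulr_ge0 ?sqr_ge0// invr_ge0 ltW.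
- move=> s _; rewrite /h wtE.
  rewrite [leLHS](_ : _ = expR (- g * s) * expR (- g * s) *
     (2 * z s * F s - l * z s ^+ 2)); last by ring.
  rewrite ler_wpM2l// ?mulr_ge0 ?expR_ge0//.
  rewrite -subr_ge0 (_ : _ - _ = l^-1 * (F s - l * z s) ^+ 2).
    by rewrite mulr_ge0 ?sqr_ge0// invr_ge0 ltW.
  by field; rewrite gt_eqF.
Qed.

End scalar_equation.

(** * Weighted l2 energies of sequences, and their limits *)

Section weighted_sums.
Context {R : realType}.
Implicit Types (w : nat -> R) (x y z : nat -> R) (c : R).
Local Open Scope ereal_scope.

(** Squared norm of a weighted l2 space, equal to [+oo] off that space, so that inequalities between
    energies can be stated for all sequences. *)
Definition wsum w x : \bar R := \sum_(0 <= k <oo) (w k * x k ^+ 2)%:E.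

Section fixed_weights.
Variable w : nat -> R.
Hypothesis w0 : forall k, (0 <= w k)%R.

Lemma wsum_term_ge0 x k : 0 <= (w k * x k ^+ 2)%:E.
Proof. by rewrite lee_fin mulr_ge0// sqr_ge0. Qed.

Lemma wsum_ge0 x : 0 <= wsum w x.
Proof. by apply: nneseries_ge0 => k _ _; exact: wsum_term_ge0. Qed.

Lemma eq_wsum x y : x =1 y -> wsum w x = wsum w y.
Proof. by move=> xy; congr (wsum w _); apply/funext. Qed.

Lemma wsum_partial_le x n : (\sum_(k < n) w k * x k ^+ 2)%:E <= wsum w x.
Proof.
rewrite -sumEFin -(big_mkord xpredT (fun k => (w k * x k ^+ 2)%:E)).
by apply: nneseries_lim_ge => k _ _; exact: wsum_term_ge0.
Qed.

Lemma wsum_term_le x k : (w k * x k ^+ 2)%:E <= wsum w x.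
Proof.
apply: le_trans (wsum_partial_le x k.+1); rewrite lee_fin big_ord_recr/=.
by rewrite lerDr sumr_ge0// => i _; rewrite mulr_ge0// sqr_ge0.
Qed.

Lemma wsum_cvg x :
  (\sum_(k < n) w k * x k ^+ 2)%:E @[n --> \oo] --> wsum w x.
Proof.
rewrite /wsum.
rewrite (_ : (fun n => _) = (fun n => \sum_(0 <= k < n) (w k * x k ^+ 2)%:E)).
  by apply: is_cvg_nneseries => k _ _; exact: wsum_term_ge0.
by apply/funext => n; rewrite big_mkord sumEFin.
Qed.

Lemma wsum_le x (b : \bar R) :
  (forall n, (\sum_(k < n) w k * x k ^+ 2)%:E <= b) -> wsum w x <= b.
Proof.
move=> xb; rewrite -(cvg_lim (@ereal_hausdorff R) (@wsum_cvg x)); apply: lime_le.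
  by apply/cvg_ex; exists (wsum w x); exact: wsum_cvg.
exact: nearW.
Qed.

Lemma wsum_cvg_real x : wsum w x < +oo ->
  (\sum_(k < n) w k * x k ^+ 2)%R @[n --> \oo] --> fine (wsum w x).
Proof.
move=> xoo; have := @wsum_cvg x.
rewrite -[X in _ --> X -> _]fineK; first by move/fine_cvg.
by rewrite ge0_fin_numE// wsum_ge0.
Qed.

Lemma wsumZ c x : wsum w (fun k => c * x k)%R = (c ^+ 2)%:E * wsum w x.
Proof.
rewrite /wsum -nneseriesZl; last by move=> k _; exact: wsum_term_ge0.
by apply: eq_eseriesr => k _; rewrite -EFinM exprMn mulrCA.
Qed.

Lemma wsumN x : wsum w (fun k => - x k)%R = wsum w x.
Proof. by apply: eq_eseriesr => k _; rewrite sqrrN. Qed.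

Lemma wsumBC x y : wsum w (fun k => x k - y k)%R = wsum w (fun k => y k - x k)%R.
Proof. by rewrite -wsumN; apply: eq_wsum => k; rewrite opprB. Qed.

Lemma wsumD_le x y :
  wsum w (fun k => x k + y k)%R <= 2%:E * wsum w x + 2%:E * wsum w y.
Proof.
rewrite /wsum -!nneseriesZl; try by move=> k _; exact: wsum_term_ge0.
rewrite -nneseriesD; last 2 first.
- by move=> k _ _; rewrite mule_ge0// wsum_term_ge0.
- by move=> k _ _; rewrite mule_ge0// wsum_term_ge0.
apply: lee_nneseries => [k _ _|k _].
  exact: (wsum_term_ge0 (fun k => x k + y k)%R).
rewrite -!EFinM -EFinD lee_fin -subr_ge0.
rewrite (_ : (_ - _ = w k * (x k - y k) ^+ 2)%R); last by ring.
by rewrite mulr_ge0// sqr_ge0.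
Qed.

Lemma wsumB_le x y :
  wsum w (fun k => x k - y k)%R <= 2%:E * wsum w x + 2%:E * wsum w y.
Proof. by rewrite -(wsumN y); exact: wsumD_le. Qed.

Lemma wsum0 : wsum w (fun=> 0%R) = 0.
Proof. by rewrite /wsum eseries0// => k _ _; rewrite expr0n mulr0. Qed.

Lemma wsum_eq0 x k : (0 < w k)%R -> wsum w x <= 0 -> x k = 0%R.
Proof.
move=> wk /(le_trans (wsum_term_le x k)); rewrite lee_fin => h.
apply/eqP; rewrite -sqrf_eq0 eq_le sqr_ge0 andbT.
by rewrite -(pmulr_rle0 _ wk).
Qed.

Lemma cvg_wsum_partial (I : Type) (F : set_system I) {FF : Filter F}
    (y : I -> nat -> R) x n : (forall k, y i k @[i --> F] --> x k) ->
  (\sum_(k < n) w k * y i k ^+ 2)%R @[i --> F] -->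
  (\sum_(k < n) w k * x k ^+ 2)%R.
Proof.
move=> yx; apply: (@cvg_big _ _ _ _ _ _ _ _ _ (fun k : 'I_n => fun i => w k * y i k ^+ 2)%R
  (fun k : 'I_n => w k * x k ^+ 2)%R).
  exact: add_continuous.
move=> k _; apply: cvgM; first exact: cvg_cst.
by apply: cvgM; exact: yx.
Qed.

(** Lower semicontinuity under coordinatewise convergence: each partial sum is continuous in
    finitely many coordinates and inherits the bound. *)
Lemma wsum_limit (y : nat -> nat -> R) x (b : \bar R) :
  (forall k, y n k @[n --> \oo] --> x k) ->
  (\forall n \near \oo, wsum w (y n) <= b) -> wsum w x <= b.
Proof.
move=> cy yb; apply: wsum_le => m.
have cs : (\sum_(k < m) w k * y n k ^+ 2)%:E @[n --> \oo] -->
    (\sum_(k < m) w k * x k ^+ 2)%:E.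
  by apply: cvg_EFin; [exact: nearW|exact: cvg_wsum_partial].
rewrite -(cvg_lim (@ereal_hausdorff R) cs).
apply: lime_le; first by apply/cvg_ex; eexists; exact: cs.
by apply: filterS yb => n; apply: le_trans; exact: wsum_partial_le.
Qed.

End fixed_weights.

Lemma wsum_weights_le w (v : nat -> R) c x : (forall k, 0 <= w k)%R -> (forall k, 0 <= v k)%R ->
  (forall k, w k <= c * v k)%R -> wsum w x <= c%:E * wsum v x.
Proof.
move=> w0 v0 wv; rewrite /wsum -nneseriesZl; last by move=> k _; exact: wsum_term_ge0.
apply: lee_nneseries => [k _ _|k _]; first exact: wsum_term_ge0.
by rewrite -EFinM lee_fin [leRHS]mulrA ler_wpM2r// sqr_ge0.
Qed.

Lemma wsum_weightsD w (v : nat -> R) c x : (forall k, 0 <= w k)%R -> (forall k, 0 <= v k)%R ->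
  (0 <= c)%R ->
  wsum (fun k => w k + c * v k)%R x = wsum w x + c%:E * wsum v x.
Proof.
move=> w0 v0 c0; rewrite /wsum -nneseriesZl; last by move=> k _; exact: wsum_term_ge0.
rewrite -nneseriesD; last 2 first.
- by move=> k _ _; exact: wsum_term_ge0.
- by move=> k _ _; rewrite mule_ge0 ?lee_fin// mulr_ge0// sqr_ge0.
by apply: eq_eseriesr => k _; rewrite -EFinM -EFinD; congr EFin; ring.
Qed.

(** The tail of the series is at most the tail of the majorant [b], which is small from some [N] on,
    independently of [i]; the first [N] terms form a finite sum tending to 0. *)
Lemma wsum_dominated (I : Type) (F : set_system I) {FF : Filter F} w
    (x : I -> nat -> R) (b : nat -> R) :
  (forall k, 0 <= w k)%R -> wsum w b < +oo ->
  (\forall i \near F, forall k, (`|x i k| <= `|b k|)%R) ->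
  (forall k, x i k @[i --> F] --> (0 : R)%R) ->
  fine (wsum w (x i)) @[i --> F] --> (0 : R)%R.
Proof.
move=> w0 boo xb x0.
have xoo : \forall i \near F, wsum w (x i) <= wsum w b.
  apply: filterS xb => i xb; apply: lee_nneseries => [k _ _|k _].
    exact: wsum_term_ge0.
  by rewrite lee_fin ler_wpM2l// -(real_normK (num_real (x i k))) -(real_normK (num_real (b k))) ler_pXn2r ?nnegrE.
have := nneseries_tail_cvg boo (fun k _ => wsum_term_ge0 w0 b k).
move=> tl; apply/cvgrPdist_le => e e0.
have e20 : (0 < e / 2)%R by rewrite divr_gt0.
have [N _ /(_ N (leqnn N)) tN] :
    \forall n \near \oo, \sum_(n <= k <oo) (w k * b k ^+ 2)%:E <= (e / 2)%:E.
  move: tl => /fine_cvgP[tf /cvgrPdist_le /(_ _ e20)] tl; near=> n.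
  rewrite -(@fineK _ (\sum_(n <= k <oo) _)); last by near: n.
  rewrite lee_fin; suff : (`|0 - fine (\sum_(n <= k <oo) (w k * b k ^+ 2)%:E)%E| <= e / 2)%R.
    by rewrite sub0r normrN; apply: le_trans; exact: ler_norm.
  by near: n.
have := @cvg_wsum_partial w I F FF x (fun=> 0%R) N x0.
rewrite big1 => [sN|k _]; last by rewrite expr0n mulr0.
move/cvgrPdist_le : sN => /(_ _ e20) sN.
near=> i.
have xi : forall k, (`|x i k| <= `|b k|)%R by near: i.
have si : (`|0 - \sum_(k < N) w k * x i k ^+ 2| <= e / 2)%R by near: i.
rewrite sub0r normrN ger0_norm; last by rewrite fine_ge0// wsum_ge0.
rewrite -lee_fin fineK; last first.
  rewrite ge0_fin_numE ?wsum_ge0//.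
  by apply: le_lt_trans boo; near: i.
rewrite /wsum (nneseries_split _ N); last by move=> k _; exact: wsum_term_ge0.
rewrite add0n [e]splitr EFinD; apply: leeD.
  rewrite big_mkord sumEFin lee_fin; apply: le_trans si.
  by rewrite sub0r normrN ler_norm.
apply: le_trans tN; apply: lee_nneseries => [k _ _|k _].
  exact: wsum_term_ge0.
by rewrite lee_fin ler_wpM2l// -(real_normK (num_real (x i k))) -(real_normK (num_real (b k))) ler_pXn2r ?nnegrE.
Unshelve. all: by end_near. Qed.

Section measurable_wsum.
Context d (T : measurableType d) (m : {measure set T -> \bar R}).
Variables (D : set T) (w : nat -> R) (x : T -> nat -> R).
Hypothesis w0 : forall k, (0 <= w k)%R.
Hypothesis mx : forall k, measurable_fun D (x ^~ k).

Lemma measurable_wsum : measurable_fun D (fun t => wsum w (x t)).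
Proof.
apply: ge0_emeasurable_sum => [k t Dt _|k _]; first exact: wsum_term_ge0.
apply/measurable_EFinP; apply: measurable_funM => //.
exact: measurable_funX.
Qed.

Lemma integral_wsum (p : T -> R) : measurable D -> measurable_fun D p ->
  (forall t, D t -> 0 <= p t)%R ->
  \int[m]_(t in D) ((p t)%:E * wsum w (x t)) =
  \sum_(0 <= k <oo) \int[m]_(t in D) (p t * (w k * x t k ^+ 2))%:E.
Proof.
move=> mD mp p0; rewrite -integral_nneseries//.
- apply: eq_integral => t; rewrite inE => Dt.
  rewrite /wsum -nneseriesZl//; last by move=> k _; exact: wsum_term_ge0.
- move=> k; apply/measurable_EFinP; apply: measurable_funM => //.
  by apply: measurable_funM => //; exact: measurable_funX.
- by move=> k t Dt; rewrite lee_fin mulr_ge0 ?p0// mulr_ge0// sqr_ge0.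
Qed.

End measurable_wsum.

Lemma cvg_le_limn_einf (u v : nat -> \bar R) l :
  u @ \oo --> l -> (forall n, u n <= v n) -> l <= limn_einf v.
Proof.
move=> ul uv; rewrite limn_einf_lim.
rewrite -(cvg_lim (@ereal_hausdorff R) (cvg_einfs ul)).
apply: lee_lim; [by apply/cvg_ex; eexists; exact: cvg_einfs ul|exact: is_cvg_einfs|].
apply: nearW => n; apply: le_ereal_inf_tmp => /= _ [k /= nk <-].
by apply: le_trans (uv k); apply: ereal_inf_lbound; exists k.
Qed.

Lemma limn_einf_le (v : nat -> \bar R) b :
  (forall n, v n <= b) -> limn_einf v <= b.
Proof.
move=> vb; rewrite limn_einf_lim; apply: lime_le; first exact: is_cvg_einfs.
by apply: nearW => n; apply: le_trans (vb n); apply: ereal_inf_lbound; exists n => /=.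
Qed.

Lemma wsum_weightsZ w c x : (forall k, 0 <= w k)%R ->
  wsum (fun k => c * w k)%R x = c%:E * wsum w x.
Proof.
move=> w0; rewrite /wsum -nneseriesZl; last by move=> k _; exact: wsum_term_ge0.
by apply: eq_eseriesr => k _; rewrite -EFinM; congr EFin; ring.
Qed.

(** Fatou's lemma in time on top of the same principle for the series: at each [t] the partial sums
    converge and stay below the full sums. Energy bounds thus pass to the Picard limit by
    convergence of coordinates. *)
Lemma fatou_wsum d (T : measurableType d) (m : {measure set T -> \bar R})
    (D : set T) (w : nat -> R) (p : T -> R) (y : nat -> T -> nat -> R)
    (x : T -> nat -> R) (b : \bar R) :
  measurable D -> (forall k, 0 <= w k)%R -> (forall t, D t -> 0 <= p t)%R ->
  measurable_fun D p ->
  (forall n k, measurable_fun D (fun t => y n t k)) ->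
  (forall t, D t -> forall k, y n t k @[n --> \oo] --> x t k) ->
  (forall n, \int[m]_(t in D) ((p t)%:E * wsum w (y n t)) <= b) ->
  \int[m]_(t in D) ((p t)%:E * wsum w (x t)) <= b.
Proof.
move=> mD w0 p0 mp my yx yb.
have mx k : measurable_fun D (x ^~ k).
  by apply: (measurable_fun_cvg (fun n => my n k)) => t Dt; exact: yx.
have mpw (z : T -> nat -> R) : (forall k, measurable_fun D (z ^~ k)) ->
    measurable_fun D (fun t => (p t)%:E * wsum w (z t)).
  move=> mz; apply: emeasurable_funM; first exact/measurable_EFinP.
  exact: measurable_wsum.
have pw0 (z : T -> nat -> R) t : D t -> 0 <= (p t)%:E * wsum w (z t).
  by move=> Dt; rewrite mule_ge0 ?wsum_ge0// lee_fin p0.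
apply: le_trans (limn_einf_le yb).
apply: le_trans (@fatou _ _ _ m D mD (fun n t => (p t)%:E * wsum w (y n t)) _ _).
- apply: ge0_le_integral => //.
  + by move=> t Dt; exact: pw0.
  + exact: mpw.
  + apply: (@emeasurable_fun_cvg _ _ _ _
      (fun n t => einfs (fun i => (p t)%:E * wsum w (y i t)) n)).
      by move=> n; apply: measurable_fun_einfs => i; exact: mpw.
    by move=> t Dt; rewrite limn_einf_lim; exact: is_cvg_einfs.
  + move=> t Dt; rewrite -wsum_weightsZ//.
    have pw k : (0 <= p t * w k)%R by rewrite mulr_ge0// p0.
    apply: wsum_le => // n.
    apply: (@cvg_le_limn_einf (fun i => (\sum_(k < n) p t * w k * y i t k ^+ 2)%:E)).
      by apply: cvg_EFin; [exact: nearW|exact: (@cvg_wsum_partial (fun k => p t * w k)%R _ _ _ (fun i => y i t) (x t) n (yx t Dt))].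
    by move=> i; rewrite -wsum_weightsZ//; exact: wsum_partial_le.
- by move=> n; exact: mpw.
- by move=> n t Dt; exact: pw0.
Qed.

End weighted_sums.

(** * The energy inequality for the infinite diagonal system *)

Section system_energy.
Context {R : realType}.
Local Notation mu := (@lebesgue_measure R).
Variables (T : R) (lam w0 w1 wm : nat -> R).
Hypothesis T0 : 0 <= T.
Hypothesis lam0 : forall k, 0 < lam k.
Hypothesis w00 : forall k, 0 < w0 k.
Hypothesis w1E : forall k, w1 k = lam k * w0 k.
Hypothesis wmE : forall k, wm k = (lam k)^-1 * w0 k.

Lemma w0_ge0 k : 0 <= w0 k. Proof. exact: ltW. Qed.

Lemma w1_ge0 k : 0 <= w1 k.
Proof. by rewrite w1E mulr_ge0// ltW. Qed.

Lemma wm_gt0 k : 0 < wm k.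
Proof. by rewrite wmE mulr_gt0// invr_gt0. Qed.

Lemma wm_ge0 k : 0 <= wm k. Proof. exact/ltW/wm_gt0. Qed.

Local Ltac nonneg := rewrite ?lee_fin;
  repeat first [exact: wt_ge0 | exact: sqr_ge0 | exact: w0_ge0 | exact: wm_ge0
    | by [] | exact: ltW | apply: mulr_ge0 | by rewrite invr_ge0 ltW].

(* Under the weight wt g the dissipation w1 gains the multiple 2 g of w0. *)
Definition wg (g : R) k : R := w1 k + 2 * g * w0 k.

Lemma wg_ge0 g k : 0 <= g -> 0 <= wg g k.
Proof. by move=> g0; rewrite addr_ge0 ?w1_ge0// !mulr_ge0 ?w0_ge0. Qed.

(** The scalar inequality in coordinate [k] is multiplied by [w0 k] and summed: [w0 k] times
    [lam k + 2 g] is [wg g k], and [w0 k] over [lam k] is [wm k]. Nonnegativity allows sums and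
    integrals to be exchanged, infinite values included. *)
Lemma system_energy g (x F : R -> nat -> R) (x0 : nat -> R) t : 0 <= g ->
  (forall k, is_prim T (x0 k) (fun t => - lam k * x t k + F t k) (x ^~ k)) ->
  t \in `[0, T] ->
  ((wt g t)%:E * wsum w0 (x t) +
     \int[mu]_(s in `[0%R, t]) ((wt g s)%:E * wsum (wg g) (x s)) <=
   wsum w0 x0 + \int[mu]_(s in `[0%R, t]) ((wt g s)%:E * wsum wm (F s)))%E.
Proof.
move=> g0 xP tT.
have sub : `[0, t] `<=` `[0, T].
  by move: tT; rewrite in_itv/= => /andP[_ tT]; apply: subset_itvl; rewrite bnd_simp.
have mx k : measurable_fun `[0, t] (x ^~ k).
  by apply: measurable_funS (is_prim_measurable T0 (xP k)).
have mF k : measurable_fun `[0, t] (F ^~ k).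
  by apply: measurable_funS (is_prim_force_measurable T0 (xP k)).
have wg0 k : 0 <= wg g k by exact: wg_ge0.
rewrite integral_wsum//; [|exact: measurable_wt|by move=> s _; exact: wt_ge0].
rewrite integral_wsum//; [|exact: wm_ge0|exact: measurable_wt|by move=> s _; exact: wt_ge0].
rewrite -wsum_weightsZ; last exact: w0_ge0.
have e0 k : (0 <= (wt g t * w0 k * x t k ^+ 2)%:E)%E.
  nonneg.
have e1 k : (0 <= (w0 k * x0 k ^+ 2)%:E)%E.
  nonneg.
have i0 (v : nat -> R) (y : R -> nat -> R) k : (forall k, 0 <= v k) ->
    (0 <= \int[mu]_(s in `[0%R, t]) (wt g s * (v k * y s k ^+ 2))%:E)%E.
  move=> v0; apply: integral_ge0 => s _.
  nonneg; exact: v0.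
rewrite /wsum -!nneseriesD; [|by move=> *; exact: e1|by move=> *; apply: i0; exact: wm_ge0|by move=> *; exact: e0|by move=> *; exact: i0].
apply: lee_nneseries => [k _ _|k _]; first by rewrite adde_ge0// i0.
have scale (c a b d e : \bar R) : (0 <= c -> 0 <= a -> 0 <= b -> 0 <= d ->
    0 <= e -> a + b <= d + e -> c * a + c * b <= c * d + c * e)%E.
  by move=> c0 a0 b0 d0 f0 h; rewrite -!ge0_muleDr// lee_wpmul2l.
have pull (c : R) (y : R -> R) : 0 <= c -> measurable_fun `[0, t] y ->
    ((w0 k)%:E * \int[mu]_(s in `[0%R, t]) (wt g s * (c * y s ^+ 2))%:E =
     \int[mu]_(s in `[0%R, t]) (wt g s * (w0 k * c * y s ^+ 2))%:E)%E.
  move=> c0 my; rewrite -ge0_integralZl//.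
  - by apply: eq_integral => s _; rewrite -EFinM; congr EFin; ring.
  - apply/measurable_EFinP; apply: measurable_funM; first exact: measurable_wt.
    by apply: measurable_funM => //; exact: measurable_funX.
  - by move=> s _; nonneg.
  - by rewrite lee_fin w0_ge0.
have lg0 : 0 <= lam k + 2 * g by rewrite addr_ge0 ?mulr_ge0// ltW.
have := scale (w0 k)%:E _ _ _ _ _ _ _ _ _
  (scalar_energy T0 g0 (lam0 k) (xP k) tT).
rewrite !pull// ?invr_ge0; last exact: ltW.
move=> h.
rewrite (_ : wg g k = w0 k * (lam k + 2 * g)); last by rewrite /wg w1E; ring.
rewrite (_ : wm k = w0 k * (lam k)^-1); last by rewrite wmE mulrC.
rewrite (_ : wt g t * w0 k * x t k ^+ 2 = w0 k * (wt g t * x t k ^+ 2)); last by ring.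
apply: h; try by nonneg.
- by apply: integral_ge0 => s _; nonneg.
- by apply: integral_ge0 => s _; nonneg.
Qed.

(** Duhamel's formula needs each coordinate of the forcing to be integrable. On a bounded interval
    [|F k| <= 1 + F k ^+ 2], and one square is at most the whole energy divided by its weight, which
    is bounded below on [[0, T]]. *)
Lemma integrable_of_wsum g (F : R -> nat -> R) k : 0 <= g ->
  (forall k, measurable_fun setT (F ^~ k)) ->
  (\int[mu]_(s in `[0%R, T]) ((wt g s)%:E * wsum wm (F s)) < +oo)%E ->
  mu.-integrable `[0, T] (EFin \o (F ^~ k)).
Proof.
move=> g0 mF Foo; set c := (wt g T * wm k)^-1.
have c0 : 0 < c by rewrite invr_gt0 mulr_gt0 ?wt_gt0 ?wm_gt0.
have mFk (D : set R) : measurable_fun D (F ^~ k).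
  by apply: measurable_funS (mF k).
have mWT : measurable_fun `[0, T] (fun s => (wt g s)%:E * wsum wm (F s))%E.
  apply: emeasurable_funM; first by apply/measurable_EFinP; exact: measurable_wt.
  by apply: measurable_wsum => [i|i]; [exact: wm_ge0|apply: measurable_funS (mF i)].
apply: (@integrable_le _ _ _ mu _ _ _ (fun s => 1 + F s k ^+ 2)) => //; first exact: mFk.
  move=> s _; rewrite [leRHS]ger0_norm ?addr_ge0 ?sqr_ge0//.
  rewrite -(real_normK (num_real (F s k))).
  have := sqr_ge0 (`|F s k| - 1); have := normr_ge0 (F s k).
  rewrite sqrrB mulr1 expr1n; lra.
apply: integrable_add => //.
  apply: continuous_compact_integrable; first exact: segment_compact.
  by apply: continuous_subspaceT => s; exact: cvg_cst.
apply/integrableP; split.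
  by apply/measurable_EFinP; apply: measurable_funX; exact: mFk.
apply: (@le_lt_trans _ _ (c%:E * \int[mu]_(s in `[0%R, T]) ((wt g s)%:E * wsum wm (F s)))%E).
  have ws0 s : (0 <= (wt g s)%:E * wsum wm (F s))%E.
    by rewrite mule_ge0 ?wsum_ge0 ?lee_fin ?wt_ge0//; exact: wm_ge0.
  rewrite -ge0_integralZl//; last by rewrite lee_fin ltW.
  apply: ge0_le_integral => //.
  - apply/measurable_EFinP/measurableT_comp => //.
    by apply: measurable_funX; exact: mFk.
  - exact: emeasurable_funM.
  move=> s /=; rewrite in_itv/= => /andP[s0 sT].
  rewrite /= ger0_norm ?sqr_ge0//.
  apply: (@le_trans _ _ (c%:E * ((wt g s)%:E * (wm k * F s k ^+ 2)%:E)))%E.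
    rewrite -!EFinM lee_fin /c.
    rewrite [leRHS](_ : _ = F s k ^+ 2 * (wt g s / wt g T)); last first.
      by field; rewrite !gt_eqF ?wm_gt0 ?wt_gt0.
    by rewrite ler_peMr ?sqr_ge0// ler_pdivlMr ?wt_gt0// mul1r wt_ge.
  rewrite lee_wpmul2l ?lee_fin ?(ltW c0)// lee_wpmul2l ?lee_fin ?wt_ge0//.
  by apply: wsum_term_le => i; exact: wm_ge0.
by rewrite lte_mul_pinfty// lee_fin ltW.
Qed.

End system_energy.

(** * Picard iteration in a ball of the weighted energy *)

Section nonlinear_iteration.
Context {R : realType}.
Local Notation mu := (@lebesgue_measure R).
Variables (T : R) (lam w0 w1 wm : nat -> R).
Hypothesis T0 : 0 <= T.
Hypothesis lam0 : forall k, 0 < lam k.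
Hypothesis w00 : forall k, 0 < w0 k.
Hypothesis w1E : forall k, w1 k = lam k * w0 k.
Hypothesis wmE : forall k, wm k = (lam k)^-1 * w0 k.
Variables (N : (nat -> R) -> nat -> R) (C K : R).
Hypothesis C0 : 0 <= C.
Hypothesis K0 : 0 <= K.
Hypothesis N0 : forall k, N (fun=> 0) k = 0.
Hypothesis Nm : forall x : R -> nat -> R, (forall k, measurable_fun setT (x ^~ k)) ->
  forall k, measurable_fun setT (fun t => N (x t) k).
Hypothesis Nlip : forall x y, (wsum wm (fun k => N x k - N y k)%R <=
  ((1 / 16)%:E + C%:E * wsum w0 y) * wsum w1 (fun k => x k - y k)%R +
  (K%:E + C%:E * wsum w1 x) * wsum w0 (fun k => x k - y k)%R)%E.

Let w0ge k : 0 <= w0 k. Proof. exact: ltW. Qed.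
Let w1ge k : 0 <= w1 k. Proof. exact: (w1_ge0 lam0 w00 w1E). Qed.
Let wmge k : 0 <= wm k. Proof. exact: (wm_ge0 lam0 w00 wmE). Qed.

Definition coord_measurable (x : R -> nat -> R) := forall k, measurable_fun setT (x ^~ k).

(** A ball of squared radius [c] for two quantities under the exponential weight: the supremum of
    the [w0]-energy and the integral of the [wg]-energy. The iteration tracks radii as numbers
    instead of using a norm on a function space. *)
Definition energy_bounded (g c : R) (x : R -> nat -> R) : Prop :=
  (forall t : R, t \in `[0%R, T] -> (wt g t)%:E * wsum w0 (x t) <= c%:E)%E /\
  (\int[mu]_(s in `[0%R, T]) ((wt g s)%:E * wsum (wg w0 w1 g) (x s)) <= c%:E)%E.

(** Estimate at one time [s]: [p = wt g s], [q = wt g T], [a] is the [w0]-energy of [y], [b + b0]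
    the [wg]-energy of [x], and [d1], [d0] are the energies of the difference. The coefficient of
    [d1] is at most 1/16 + 1/16; [K d0] is at most 1/8 of [2 g d0]; in [C b d0] the factor [p d0] is
    replaced by its bound [c], which leaves [b], integrable in time. *)
Lemma weighted_lipschitz_bound (p q g c r : R) (a b b0 d1 d0 : \bar R) :
  0 < q -> q <= p -> 0 <= c -> C * r / q <= 1 / 16 -> K <= g / 4 ->
  (0 <= a -> 0 <= b -> 0 <= b0 -> 0 <= d1 -> 0 <= d0 ->
   p%:E * a <= r%:E -> p%:E * d0 <= c%:E ->
   p%:E * (((1 / 16)%:E + C%:E * a) * d1 + (K%:E + C%:E * b) * d0) <=
   (1 / 8)%:E * (p%:E * (d1 + (2 * g)%:E * d0)) + (C * c / q)%:E * (p%:E * (b + b0)))%E.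
Proof.
move=> q0 qp c0 Cr Kg a0 b0' b00 d10 d00 ar dc.
have p0 : 0 < p by exact: lt_le_trans qp.
have p0e : (0 <= p%:E)%E by rewrite lee_fin ltW.
have C0e : (0 <= C%:E)%E by rewrite lee_fin.
have g0 : 0 <= g by move: (le_trans K0 Kg); lra.
have aq : (a <= (r / q)%:E)%E.
  rewrite mulrC EFinM lee_pdivlMl// (le_trans _ ar)// lee_wpmul2r//.
have A8 : ((1 / 16)%:E + C%:E * a <= (1 / 8)%:E)%E.
  apply: (@le_trans _ _ ((1 / 16)%:E + C%:E * (r / q)%:E)%E).
    by rewrite leeD2l// lee_wpmul2l.
  rewrite -EFinM -EFinD lee_fin mulrA; lra.
have Ca0 : (0 <= C%:E * a)%E by rewrite mule_ge0.
have Cb0 : (0 <= C%:E * b)%E by rewrite mule_ge0.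
have B0 : (0 <= K%:E + C%:E * b)%E by rewrite adde_ge0// lee_fin.
have A0 : (0 <= (1 / 16)%:E + C%:E * a)%E by rewrite adde_ge0// lee_fin.
have gd0 : (0 <= (2 * g)%:E * d0)%E by rewrite mule_ge0// lee_fin mulr_ge0.
have pd0 : (0 <= p%:E * d0)%E by rewrite mule_ge0.
rewrite ge0_muleDr ?mule_ge0// [in leRHS]ge0_muleDr// [in leRHS]ge0_muleDr ?mule_ge0//.
rewrite -addeA; apply: leeD.
  by rewrite (muleCA (1 / 8)%:E) lee_wpmul2l// lee_wpmul2r.
rewrite (muleCA p%:E (_ + _)%E) ge0_muleDl ?lee_fin//; apply: leeD.
  rewrite [leRHS](_ : _ = ((1 / 8) * (2 * g))%:E * (p%:E * d0))%E; last first.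
    by rewrite (muleCA p%:E) muleA EFinM.
  rewrite lee_wpmul2r// lee_fin; lra.
apply: (@le_trans _ _ (C%:E * b * c%:E)%E); first by rewrite lee_wpmul2l.
rewrite muleAC -EFinM [in leRHS]EFinM -muleA lee_wpmul2l ?lee_fin ?mulr_ge0//.
rewrite lee_pdivlMl//; apply: (@le_trans _ _ (p%:E * b)%E).
  by rewrite lee_wpmul2r.
by rewrite lee_wpmul2l// leeDl.
by rewrite lee_fin mulr_ge0.
Qed.

Lemma measurable_wt_wsum g (v : nat -> R) (x : R -> nat -> R) (D : set R) :
  (forall k, 0 <= v k) -> coord_measurable x ->
  measurable_fun D (fun s => (wt g s)%:E * wsum v (x s))%E.
Proof.
move=> v0 xm; apply: emeasurable_funM.
  by apply/measurable_EFinP; exact: measurable_wt.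
by apply: measurable_wsum => // k; apply: measurable_funS (xm k).
Qed.

Lemma wt_wsum_ge0 g (v x : nat -> R) s : (forall k, 0 <= v k) ->
  (0 <= (wt g s)%:E * wsum v x)%E.
Proof. by move=> v0; rewrite mule_ge0 ?wsum_ge0// lee_fin wt_ge0. Qed.

Lemma coord_measurableD x y : coord_measurable x -> coord_measurable y ->
  coord_measurable (fun t k => x t k + y t k).
Proof. by move=> xm ym k; apply: measurable_funD; [exact: xm|exact: ym]. Qed.

Lemma coord_measurableB x y : coord_measurable x -> coord_measurable y ->
  coord_measurable (fun t k => x t k - y t k).
Proof. by move=> xm ym k; apply: measurable_funB; [exact: xm|exact: ym]. Qed.

(** Each half of [energy_bounded] comes from [system_energy] by dropping the other nonnegative term,
    at time [t] for the supremum and at time [T] for the integral. *)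
Lemma energy_bounded_force g c (x F : R -> nat -> R) (x0 : nat -> R) : 0 <= g ->
  (forall k, is_prim T (x0 k) (fun t => - lam k * x t k + F t k) (x ^~ k)) ->
  (forall k, measurable_fun `[0, T] (F ^~ k)) ->
  (wsum w0 x0 + \int[mu]_(s in `[0%R, T]) ((wt g s)%:E * wsum wm (F s)) <= c%:E)%E ->
  energy_bounded g c x.
Proof.
move=> g0 xP mF h.
have wg0 k : 0 <= wg w0 w1 g k by exact: (wg_ge0 lam0 w00 w1E).
have I0 (v : nat -> R) (y : R -> nat -> R) t : (forall k, 0 <= v k) ->
    (0 <= \int[mu]_(s in `[0%R, t]) ((wt g s)%:E * wsum v (y s)))%E.
  by move=> v0; apply: integral_ge0 => s _; exact: wt_wsum_ge0.
split.
  move=> t tT; apply: le_trans h.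
  have := system_energy T0 lam0 w00 w1E wmE g0 xP tT.
  move=> /(le_trans _) h; apply: (le_trans (h _ _)); first by rewrite leeDl// I0.
  rewrite leeD2l//; apply: ge0_subset_integral => //.
  - apply: emeasurable_funM; first by apply/measurable_EFinP; exact: measurable_wt.
    exact: measurable_wsum.
  - by move=> s _; exact: wt_wsum_ge0.
  - by move: tT; rewrite in_itv/= => /andP[_ tT]; apply: subset_itvl; rewrite bnd_simp.
apply: le_trans h.
have TT : T \in `[0, T] by rewrite in_itv/= T0 lexx.
have := system_energy T0 lam0 w00 w1E wmE g0 xP TT.
by apply: le_trans; rewrite leeDr// wt_wsum_ge0.
Qed.

(** For squared norms the triangle inequality becomes [(p + q)^2 <= 2 p^2 + 2 q^2]. *)
Lemma energy_boundedD g a b (x y : R -> nat -> R) : 0 <= g -> coord_measurable x -> coord_measurable y ->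
  energy_bounded g a x -> energy_bounded g b y ->
  energy_bounded g (2 * a + 2 * b) (fun t k => x t k + y t k).
Proof.
move=> g0 xm ym [xa xb] [ya yb].
have wg0 k : 0 <= wg w0 w1 g k by exact: (wg_ge0 lam0 w00 w1E).
have pt (v : nat -> R) t : (forall k, 0 <= v k) ->
   ((wt g t)%:E * wsum v (fun k => x t k + y t k)%R <=
   2%:E * ((wt g t)%:E * wsum v (x t)) + 2%:E * ((wt g t)%:E * wsum v (y t)))%E.
  move=> v0; rewrite !(muleCA 2%:E) -ge0_muleDr ?mule_ge0 ?wsum_ge0//.
  by rewrite lee_wpmul2l ?wsumD_le// lee_fin wt_ge0.
split.
  move=> t tT; apply: le_trans (pt _ _ w0ge) _.
  by rewrite (EFinD (2 * a)) (EFinM 2 a) (EFinM 2 b) leeD// lee_wpmul2l// ?xa ?ya.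
apply: (@le_trans _ _ (\int[mu]_(s in `[0%R, T])
   (2%:E * ((wt g s)%:E * wsum (wg w0 w1 g) (x s)) +
    2%:E * ((wt g s)%:E * wsum (wg w0 w1 g) (y s))))%E).
  apply: ge0_le_integral => //.
  - by move=> s _; exact: wt_wsum_ge0.
  - by apply: measurable_wt_wsum => //; exact: coord_measurableD.
  - by apply: emeasurable_funD; apply: emeasurable_funM => //; exact: measurable_wt_wsum.
  - by move=> s _; exact: pt.
rewrite ge0_integralD//; last 4 first.
- by move=> s _; rewrite mule_ge0// wt_wsum_ge0.
- by apply: emeasurable_funM => //; exact: measurable_wt_wsum.
- by move=> s _; rewrite mule_ge0// wt_wsum_ge0.
- by apply: emeasurable_funM => //; exact: measurable_wt_wsum.
rewrite !ge0_integralZl//; try by [exact: measurable_wt_wsum|move=> s _; exact: wt_wsum_ge0].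
by rewrite (EFinD (2 * a)) (EFinM 2 a) (EFinM 2 b) leeD// lee_wpmul2l.
Qed.

Lemma nonlin_integral g r c x y : 0 <= r -> 0 <= c -> K <= g / 4 ->
  C * r / wt g T <= 1 / 16 -> coord_measurable x -> coord_measurable y ->
  energy_bounded g r x -> energy_bounded g r y ->
  energy_bounded g c (fun t k => x t k - y t k) ->
  (\int[mu]_(s in `[0%R, T]) ((wt g s)%:E * wsum wm (fun k => N (x s) k - N (y s) k)%R)
    <= (c / 4)%:E)%E.
Proof.
move=> r0 c0 Kg Cr xm ym [_ xb] [ya _] [da db].
have g0 : 0 <= g by move: (le_trans K0 Kg); lra.
have wg0 k : 0 <= wg w0 w1 g k by exact: (wg_ge0 lam0 w00 w1E).
have dm := coord_measurableB xm ym.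
set q := wt g T; have q0 : 0 < q := wt_gt0 g T.
have cq0 : 0 <= C * c / q by rewrite mulr_ge0 ?invr_ge0 ?(ltW q0)// mulr_ge0.
apply: (@le_trans _ _ (\int[mu]_(s in `[0%R, T])
   ((1 / 8)%:E * ((wt g s)%:E * wsum (wg w0 w1 g) (fun k => x s k - y s k)%R) +
    (C * c / q)%:E * ((wt g s)%:E * wsum (wg w0 w1 g) (x s))))%E).
  apply: ge0_le_integral => //.
  - by move=> s _; exact: wt_wsum_ge0.
  - by apply: measurable_wt_wsum => // k; apply: measurable_funB; exact: Nm.
  - by apply: emeasurable_funD; apply: emeasurable_funM => //; exact: measurable_wt_wsum.
  move=> s /= sT; have sT' := sT; rewrite in_itv/= in sT'; case/andP: sT' => s0 sT'.
  apply: (@le_trans _ _ ((wt g s)%:E * (((1 / 16)%:E + C%:E * wsum w0 (y s)) *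
      wsum w1 (fun k => x s k - y s k)%R +
      (K%:E + C%:E * wsum w1 (x s)) * wsum w0 (fun k => x s k - y s k)%R))%E).
    by rewrite lee_wpmul2l ?lee_fin ?wt_ge0.
  rewrite /wg !wsum_weightsD//; try by rewrite mulr_ge0.
  apply: (@weighted_lipschitz_bound _ _ _ _ r) => //; try exact: wsum_ge0.
  - exact: wt_ge.
  - by rewrite mule_ge0 ?wsum_ge0// lee_fin mulr_ge0.
  - exact: ya.
  - exact: da.
rewrite ge0_integralD//; last 4 first.
- by move=> s _; rewrite mule_ge0 ?wt_wsum_ge0.
- by apply: emeasurable_funM => //; exact: measurable_wt_wsum.
- by move=> s _; rewrite mule_ge0 ?wt_wsum_ge0.
- by apply: emeasurable_funM => //; exact: measurable_wt_wsum.
rewrite !ge0_integralZl//; try by [exact: measurable_wt_wsum|move=> s _; exact: wt_wsum_ge0|rewrite lee_fin].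
apply: (@le_trans _ _ ((1 / 8)%:E * c%:E + (C * c / q)%:E * r%:E)%E).
  by rewrite leeD// lee_wpmul2l// lee_fin.
rewrite -!EFinM -EFinD lee_fin.
(* The total is at most [c/8 + c/16], below [c/4]. The value 1/4 is chosen so that squared radii
   close up after the factors 2 of [energy_boundedD]. *)
have -> : C * c / q * r = c * (C * r / q) by ring.
have := ler_wpM2l c0 Cr; lra.
Qed.

Variables (f : R -> nat -> R) (x0 : nat -> R).
Hypothesis fm : coord_measurable f.

(** The linear solution, coordinate by coordinate, with forcing [f - N x]. The value 0 outside
    [[0, T]] keeps the iterates measurable on the whole line, as [coord_measurable] asks. *)
Definition picard_map (x : R -> nat -> R) (t : R) k : R :=
  if t \in `[0, T] then duhamel (lam k) (x0 k) (fun s => f s k - N (x s) k) t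
  else 0.

(** Neither smallness nor a bound uniform in time is included: this is the class in which uniqueness
    is proved, and an arbitrary solution of the Cauchy problem provides exactly such data. *)
Definition solves (x : R -> nat -> R) : Prop :=
  [/\ coord_measurable x,
      forall k, is_prim T (x0 k)
        (fun t => - lam k * x t k + (f t k - N (x t) k)) (x ^~ k),
      (\int[mu]_(s in `[0%R, T]) wsum w1 (x s) < +oo)%E &
      (\int[mu]_(s in `[0%R, T]) wsum wm (N (x s)) < +oo)%E].

Lemma picard_map_prim g x : 0 <= g -> coord_measurable x ->
  (\int[mu]_(s in `[0%R, T]) ((wt g s)%:E * wsum wm (f s)) < +oo)%E ->
  (\int[mu]_(s in `[0%R, T]) ((wt g s)%:E * wsum wm (N (x s))) < +oo)%E ->
  forall k, is_prim T (x0 k)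
    (fun t => - lam k * picard_map x t k + (f t k - N (x t) k)) (picard_map x ^~ k).
Proof.
move=> g0 xm foo Noo k.
have i1 := integrable_of_wsum lam0 w00 wmE k g0 fm foo.
have i2 := integrable_of_wsum lam0 w00 wmE k g0 (fun k => Nm xm k) Noo.
have i3 : mu.-integrable `[0, T] (EFin \o (fun s => f s k - N (x s) k)).
  exact: integrable_diff.
have := duhamel_is_prim (lam k) (x0 k) T0 i3 => h.
by apply: (eq_is_prim h) => t tT; rewrite /picard_map tT.
Qed.

Lemma picard_map_coord_measurable x : (forall k, is_prim T (x0 k)
    (fun t => - lam k * picard_map x t k + (f t k - N (x t) k)) (picard_map x ^~ k)) ->
  coord_measurable (picard_map x).
Proof.
move=> xP k; have mP := is_prim_measurable T0 (xP k).
have -> : picard_map x ^~ k = (picard_map x ^~ k) \_ `[0, T].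
  by apply/funext => t; rewrite patchE mem_setE /picard_map; case: ifPn => // ->.
exact: measurable_patch.
Qed.

Lemma eq_bdd g c x y : (forall t, t \in `[0, T] -> x t =1 y t) ->
  energy_bounded g c x -> energy_bounded g c y.
Proof.
move=> xy [xa xb]; split.
  by move=> t tT; rewrite -(eq_wsum w0 (xy t tT)) xa.
rewrite (_ : (\int[mu]_(s in _) _)%E =
  (\int[mu]_(s in `[0%R, T]) ((wt g s)%:E * wsum (wg w0 w1 g) (x s)))%E)//.
by apply: eq_integral => s; rewrite inE => sT; rewrite (eq_wsum _ (xy s sT)).
Qed.

Lemma energy_bounded0 g c : 0 <= c -> energy_bounded g c (fun _ _ => 0).
Proof.
move=> c0; split=> [t _|]; first by rewrite wsum0 mule0 lee_fin.
by under eq_integral do rewrite wsum0 mule0; rewrite integral0 lee_fin.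
Qed.

Lemma energy_boundedN g c x y : energy_bounded g c (fun t k => x t k - y t k) ->
  energy_bounded g c (fun t k => y t k - x t k).
Proof.
move=> [a b]; split=> [t tT|]; first by rewrite wsumBC a.
by under eq_integral do rewrite wsumBC.
Qed.

Lemma coord_measurable0 : coord_measurable (fun _ _ => 0). Proof. by move=> k; exact: measurable_cst. Qed.

(** Lower semicontinuity at each time gives the supremum part, [fatou_wsum] the integral part. *)
Lemma energy_bounded_closed g c (y : nat -> R -> nat -> R) x : 0 <= g ->
  (forall n, coord_measurable (y n)) -> (forall n, energy_bounded g c (y n)) ->
  (forall t k, y n t k @[n --> \oo] --> x t k) -> energy_bounded g c x.
Proof.
move=> g0 ym yb yx.
have wg0 k : 0 <= wg w0 w1 g k by exact: (wg_ge0 lam0 w00 w1E).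
split.
  move=> t tT; rewrite -wsum_weightsZ//.
  have wt0 k : 0 <= wt g t * w0 k by rewrite mulr_ge0// wt_ge0.
  apply: (wsum_limit wt0 (yx t)); apply: nearW => n.
  by rewrite wsum_weightsZ//; have [h _] := yb n; exact: h.
apply: (@fatou_wsum _ _ _ mu _ _ _ y) => //.
- by move=> s _; exact: wt_ge0.
- exact: measurable_wt.
- by move=> n k; apply: measurable_funS (ym n k).
- by move=> n; have [_] := yb n.
Qed.

Lemma energy_bounded_eq0 g c x : (forall n, energy_bounded g (c / 4 ^+ n) x) ->
  forall t k, t \in `[0, T] -> x t k = 0.
Proof.
move=> xb t k tT.
have h n : wt g t * w0 k * x t k ^+ 2 <= c / 4 ^+ n.
  have [/(_ t tT) + _] := xb n; rewrite -lee_fin; apply: le_trans.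
  by rewrite -mulrA EFinM lee_wpmul2l ?lee_fin ?wt_ge0 ?wsum_term_le.
have : wt g t * w0 k * x t k ^+ 2 <= 0.
  have ch : c / 4 ^+ n @[n --> \oo] --> (c * 0 : R).
    apply: cvgM; first exact: cvg_cst.
    under eq_fun do rewrite -exprVn.
    by apply: cvg_expr; rewrite ger0_norm ?invr_ge0// invf_lt1// ltr1n.
  rewrite mulr0 in ch; rewrite -(cvg_lim (@Rhausdorff R) ch).
  by apply: limr_ge; [apply/cvg_ex; eexists; exact: ch|exact: nearW].
rewrite pmulr_rle0 ?mulr_gt0 ?wt_gt0// => h2.
by apply/eqP; rewrite -sqrf_eq0 eq_le h2 sqr_ge0.
Qed.

(** One coordinate is controlled by [w0 k * x k ^+ 2 <= wsum w0 x], so the values form a Cauchy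
    sequence of reals. The limit of the iteration is built coordinate by coordinate. *)
Lemma energy_bounded_geometric_cvg g c (y : nat -> R -> nat -> R) t k : t \in `[0, T] ->
  (forall n j, energy_bounded g (c / 4 ^+ n) (fun t k => y (n + j)%N t k - y n t k)) ->
  cvg (y n t k @[n --> \oo]).
Proof.
move=> tT yb; apply/cauchy_cvgP/cauchy_exP => e e0.
have q0 : 0 < wt g t * w0 k by rewrite mulr_gt0 ?wt_gt0.
have ch : c / 4 ^+ n @[n --> \oo] --> (c * 0 : R).
  apply: cvgM; first exact: cvg_cst.
  under eq_fun do rewrite -exprVn.
  by apply: cvg_expr; rewrite ger0_norm ?invr_ge0// invf_lt1// ltr1n.
have he : 0 < wt g t * w0 k * e ^+ 2 by rewrite mulr_gt0// exprn_gt0.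
rewrite mulr0 in ch.
move/cvgrPdist_lt : ch => /(_ _ he) [n _ /(_ n (leqnn n))].
rewrite /= sub0r normrN => /(le_lt_trans (ler_norm _)) ne.
exists (y n t k); exists n => // m /= nm; rewrite /ball/= distrC.
have [/(_ t tT) h _] := yb n (m - n)%N; rewrite subnKC// in h.
have {}h : wt g t * w0 k * (y m t k - y n t k) ^+ 2 <= c / 4 ^+ n.
  rewrite -lee_fin; apply: le_trans h.
  rewrite -mulrA EFinM lee_wpmul2l ?lee_fin ?wt_ge0//.
  exact: (wsum_term_le w0ge (fun k => y m t k - y n t k)).
have := le_lt_trans h ne; rewrite ltr_pM2l// => {}h.
by rewrite -(ltr_pXn2r (n := 2))// ?nnegrE ?ltW// real_normK// num_real.
Qed.

Section ball.
Variables (g r : R).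
Hypothesis r0 : 0 <= r.
Hypothesis Kg : K <= g / 4.
Hypothesis Cr : C * r / wt g T <= 1 / 16.
Hypothesis data : (wsum w0 x0 +
  \int[mu]_(s in `[0%R, T]) ((wt g s)%:E * wsum wm (f s)) <= (r / 4)%:E)%E.

Let g0 : 0 <= g. Proof. by move: (le_trans K0 Kg); lra. Qed.

(** The Lipschitz estimate against the zero sequence, where [N] vanishes, with [c = r]. *)
Lemma nonlin_finite x : coord_measurable x -> energy_bounded g r x ->
  (\int[mu]_(s in `[0%R, T]) ((wt g s)%:E * wsum wm (N (x s))) <= (r / 4)%:E)%E.
Proof.
move=> xm xb.
have := nonlin_integral r0 r0 Kg Cr xm coord_measurable0 xb (energy_bounded0 g r0).
have e : energy_bounded g r (fun t k => x t k - 0).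
  by apply: eq_bdd xb => t _ k; rewrite subr0.
move=> /(_ e); congr (_ <= _)%E; apply: eq_integral => s _; congr (_ * _)%E.
by apply: eq_wsum => k; rewrite N0 subr0.
Qed.

Let data_finite :
  (\int[mu]_(s in `[0%R, T]) ((wt g s)%:E * wsum wm (f s)) < +oo)%E.
Proof.
apply: le_lt_trans (ltry (r / 4)); apply: le_trans data.
by rewrite leeDr// wsum_ge0.
Qed.

Lemma picard_map_equation x : coord_measurable x -> energy_bounded g r x ->
  forall k, is_prim T (x0 k)
    (fun t => - lam k * picard_map x t k + (f t k - N (x t) k)) (picard_map x ^~ k).
Proof.
move=> xm xb; apply: (picard_map_prim g0) => //.
by apply: le_lt_trans (nonlin_finite xm xb) (ltry _).
Qed.

(** The difference of two images solves the linear system with initial value 0 and forcing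
    [N y - N x]: the data cancel, and [nonlin_integral] bounds the forcing. *)
Lemma picard_map_contract c x y : 0 <= c -> coord_measurable x -> coord_measurable y ->
  energy_bounded g r x -> energy_bounded g r y ->
  energy_bounded g c (fun t k => x t k - y t k) ->
  energy_bounded g (c / 4) (fun t k => picard_map x t k - picard_map y t k).
Proof.
move=> c0 xm ym xb yb db.
have nm : coord_measurable (fun t k => N (y t) k - N (x t) k).
  by apply: coord_measurableB => k; exact: Nm.
apply: (@energy_bounded_force _ _ _ (fun t k => N (y t) k - N (x t) k) (fun=> 0) g0).
- move=> k; have h := is_primB (picard_map_equation xm xb k) (picard_map_equation ym yb k).
  rewrite subrr in h; apply: (eq_is_prim h) => // t _ /=; ring.
- by move=> k; apply: measurable_funS (nm k).
- rewrite wsum0 add0e; under eq_integral do rewrite wsumBC.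
  exact: (nonlin_integral r0 c0 Kg Cr xm ym xb yb db).
Qed.

Lemma Phi0_bdd : energy_bounded g (r / 4) (picard_map (fun _ _ => 0)).
Proof.
apply: (@energy_bounded_force _ _ _ f x0 g0) => //.
- move=> k; have h := picard_map_equation coord_measurable0 (energy_bounded0 g r0) k.
  by apply: (eq_is_prim h) => // t _ /=; rewrite N0 subr0.
- by move=> k; apply: measurable_funS (fm k).
Qed.

(** The image of [x] is its difference from the image of 0 plus the image of 0. Both have squared
    radius [r / 4], and [2 r / 4 + 2 r / 4 = r]. *)
Lemma picard_map_ball x : coord_measurable x -> energy_bounded g r x ->
  coord_measurable (picard_map x) /\ energy_bounded g r (picard_map x).
Proof.
move=> xm xb; have Pm := picard_map_coord_measurable (picard_map_equation xm xb).
have P0m := picard_map_coord_measurable (picard_map_equation coord_measurable0 (energy_bounded0 g r0)).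
split=> //.
have e : energy_bounded g r (fun t k => x t k - 0).
  by apply: eq_bdd xb => t _ k; rewrite subr0.
have h := picard_map_contract r0 xm coord_measurable0 xb (energy_bounded0 g r0) e.
have := energy_boundedD g0 (coord_measurableB Pm P0m) P0m h Phi0_bdd.
rewrite (_ : 2 * _ + 2 * _ = r); last by field.
by apply: eq_bdd => t _ k; rewrite subrK.
Qed.

Lemma picard : exists x, solves x /\ energy_bounded g r x.
Proof.
pose y n := iter n picard_map (fun _ _ => 0).
have yb n : coord_measurable (y n) /\ energy_bounded g r (y n).
  elim: n => [|n [ym yb]]; first by split; [exact: coord_measurable0|exact: energy_bounded0].
  exact: picard_map_ball.
have ym n := (yb n).1; have {}yb n := (yb n).2.
have q4 n : 0 <= r / 4 ^+ n by rewrite divr_ge0// exprn_ge0.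
have step n : energy_bounded g (r / 4 ^+ n) (fun t k => y n.+1 t k - y n t k).
  elim: n => [|n IH].
    rewrite expr0 divr1; apply: eq_bdd (yb 1) => t _ k; by rewrite /= subr0.
  have := picard_map_contract (q4 n) (ym n.+1) (ym n) (yb n.+1) (yb n) IH.
  by rewrite -mulrA -invfM -exprSr.
(* The constant 4 reproduces itself: the difference from [y_n] is the one from [y_(n+1)] plus one
   step, with squared radius [2 (4 r / 4^(n+1)) + 2 (r / 4^n) = 4 r / 4^n]. *)
have tele j n : energy_bounded g (4 * r / 4 ^+ n) (fun t k => y (n + j)%N t k - y n t k).
  elim: j n => [|j IH] n.
    rewrite addn0; apply: (@eq_bdd _ _ (fun _ _ => 0)).
      by move=> t _ k; rewrite subrr.
    by apply: energy_bounded0; rewrite -mulrA mulr_ge0.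
  have := energy_boundedD g0 (coord_measurableB (ym (n.+1 + j)%N) (ym n.+1)) (coord_measurableB (ym n.+1) (ym n))
    (IH n.+1) (step n).
  rewrite (_ : 2 * _ + 2 * _ = 4 * r / 4 ^+ n); last first.
    by rewrite exprS; field; rewrite expf_neq0.
  by rewrite addSnnS; apply: eq_bdd => t _ k; rewrite addrA subrK.
pose x t k := limn (fun n => y n t k).
have yx t k : y n t k @[n --> \oo] --> x t k.
  have [tT|tT] := boolP (t \in `[0, T]).
    exact: (energy_bounded_geometric_cvg (c := 4 * r) tT).
  (* Off [[0, T]] all iterates vanish, so the limit exists at every real [t]. *)
  have y0 n : y n t k = 0 by case: n => [|n] //=; rewrite /picard_map (negbTE tT).
  by rewrite /x; under eq_fun do rewrite y0; rewrite lim_cst//; exact: cvg_cst.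
have xm : coord_measurable x by move=> k; apply: (measurable_fun_cvg (fun n => ym n k)) => t _; exact: yx.
have xb : energy_bounded g r x by exact: energy_bounded_closed yx.
have dxb n : energy_bounded g (4 * r / 4 ^+ n) (fun t k => x t k - y n t k).
  apply: (@energy_bounded_closed _ _ (fun j t k => y (n + j)%N t k - y n t k)) => //.
    by move=> j; exact: coord_measurableB.
  move=> t k; apply: cvgB; last exact: cvg_cst.
  exact: (cvg_comp (addn n) (fun m => y m t k) (cvg_addnl n) (yx t k)).
have Pm := picard_map_coord_measurable (picard_map_equation xm xb).
have c0 n : 0 <= 4 * r / 4 ^+ n by rewrite -mulrA mulr_ge0.
(* The limit is compared with the next iterate: [picard_map x - y_(n+1)] is small by contraction and
   [y_(n+1) - x] by [dxb]. The sum has squared radius [4 r / 4^n] for every [n], hence vanishes. *)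
have eqx t k : t \in `[0, T] -> picard_map x t k = x t k.
  move=> tT; apply/eqP; rewrite -subr_eq0; apply/eqP.
  apply: (@energy_bounded_eq0 g (4 * r) (fun t k => picard_map x t k - x t k)) => // n.
  have h1 := picard_map_contract (c0 n) xm (ym n) xb (yb n) (dxb n).
  have h2 := energy_boundedN (dxb n.+1).
  have := energy_boundedD g0 (coord_measurableB Pm (ym n.+1)) (coord_measurableB (ym n.+1) xm) h1 h2.
  rewrite (_ : 2 * _ + 2 * _ = 4 * r / 4 ^+ n); last first.
    by rewrite exprS; field; rewrite expf_neq0.
  by apply: eq_bdd => s _ i; rewrite addrA subrK.
(* Back to integrals without the exponential, since [wt g s >= wt g T > 0] on [[0, T]]. *)
have drop (v : nat -> R) (z : R -> nat -> R) (c : R) : (forall k, 0 <= v k) -> coord_measurable z ->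
    (\int[mu]_(s in `[0%R, T]) ((wt g s)%:E * wsum v (z s)) <= c%:E)%E ->
    (\int[mu]_(s in `[0%R, T]) wsum v (z s) < +oo)%E.
  move=> v0 zm zc; have q0 := wt_gt0 g T.
  apply: (@le_lt_trans _ _ ((wt g T)^-1%:E *
     \int[mu]_(s in `[0%R, T]) ((wt g s)%:E * wsum v (z s)))%E).
    rewrite -ge0_integralZl//; first last.
    - by rewrite lee_fin invr_ge0 ltW.
    - by move=> s _; exact: wt_wsum_ge0.
    - exact: measurable_wt_wsum.
    apply: ge0_le_integral => //.
    - by move=> s _; exact: wsum_ge0.
    - by apply: measurable_wsum => // k; apply: measurable_funS (zm k).
    - by apply: emeasurable_funM => //; exact: measurable_wt_wsum.
    move=> s /=; rewrite in_itv/= => /andP[_ sT].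
    rewrite muleA -EFinM -[leLHS]mul1e lee_wpmul2r ?wsum_ge0// lee_fin.
    by rewrite mulrC ler_pdivlMr// mul1r wt_ge.
  apply: (@le_lt_trans _ _ ((wt g T)^-1%:E * c%:E)%E); last by rewrite -EFinM ltry.
  by rewrite lee_wpmul2l// lee_fin invr_ge0 ltW.
exists x; split=> //; split=> //.
- move=> k; have h := picard_map_equation xm xb k.
  by apply: (eq_is_prim h) => t tT; rewrite eqx.
- have [_ xi] := xb.
  apply: (drop w1 x r) => //; apply: le_trans xi.
  apply: ge0_le_integral => //.
  + by move=> s _; exact: wt_wsum_ge0.
  + exact: measurable_wt_wsum.
  + by apply: measurable_wt_wsum => // k; exact: (wg_ge0 lam0 w00 w1E).
  move=> s _; rewrite lee_wpmul2l ?lee_fin ?wt_ge0// /wg wsum_weightsD//.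
    by rewrite leeDl// mule_ge0 ?wsum_ge0// lee_fin mulr_ge0.
  by rewrite mulr_ge0.
- apply: (drop wm (fun s => N (x s)) (r / 4)) => //; last exact: nonlin_finite.
  by move=> k; exact: Nm.
Qed.

End ball.

End nonlinear_iteration.

(** Truncation: [h] is [f] restricted to the set where [f > n]. Its integral tends to 0 by dominated
    convergence, because an integrable [f] is finite almost everywhere. *)
Lemma integrable_excess d (T : measurableType d) (R : realType)
    (m : {measure set T -> \bar R}) (D : set T) (f : T -> \bar R) (e : R) :
  measurable D -> measurable_fun D f -> (forall x, D x -> (0 <= f x)%E) ->
  (\int[m]_(x in D) f x < +oo)%E -> 0 < e ->
  exists (n : nat) (h : T -> \bar R), [/\ measurable_fun D h,
    forall x, D x -> (0 <= h x)%E,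
    forall x, D x -> (f x <= n%:R%:E + h x)%E &
    (\int[m]_(x in D) h x <= e%:E)%E].
Proof.
move=> mD mf f0 foo e0.
pose A n := D `&` [set x | (n%:R%:E < f x)%E].
have mA n : measurable (A n) by exact: emeasurable_fun_o_infty.
pose h n := f \_ (A n).
have hf n x : D x -> (0 <= h n x <= f x)%E.
  by move=> Dx; rewrite /h patchE; case: ifPn => _; rewrite ?lexx ?f0.
have mh n : measurable_fun D (h n).
  by apply/measurable_restrict => //; apply: measurable_funS mf => // x [[]].
have If : m.-integrable D f.
  apply/integrableP; split=> //.
  rewrite (_ : (\int[m]_(x in D) _)%E = (\int[m]_(x in D) f x)%E)//.
  by apply: eq_integral => x; rewrite inE => Dx; rewrite gee0_abs// f0.
have c1 : {ae m, forall x, D x -> h^~ x @ \oo --> cst 0%E x}.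
  have := integrable_ae mD If; apply: filterS => x fx Dx.
  have fin := fx Dx.
  have [n nf] : exists n : nat, fine (f x) <= n%:R.
    by exists (Num.truncn (fine (f x))).+1; rewrite ltW// truncnS_gt.
  apply: (@cvg_trans _ (cst 0%E @ \oo)); last exact: cvg_cst.
  apply: near_eq_cvg; exists n => // k /= nk; rewrite /h patchE.
  case: ifPn => //; rewrite inE => -[_ /=]; rewrite -(fineK fin) lte_fin.
  by rewrite ltNge (le_trans nf)// ler_nat.
have c2 : {ae m, forall x n, D x -> (`|h n x| <= f x)%E}.
  by apply: aeW => x n Dx; have /andP[h0 ?] := hf n x Dx; rewrite gee0_abs.
have [_ _] := @dominated_convergence _ _ _ m D mD h (cst 0%E) f mh
  (measurable_cst _) c1 If c2.
rewrite integral0 => /fine_cvgP[fn /cvgrPdist_le/(_ _ e0) ce].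
have [n _ /(_ n (leqnn n)) [nfin ne]] := filterI fn ce.
exists n, (h n); split=> //.
- by move=> x Dx; have /andP[] := hf n x Dx.
- move=> x Dx; rewrite /h patchE; case: ifPn => [_|].
    by rewrite leeDr// lee_fin.
  move=> nA; rewrite adde0 leNgt; apply: contra nA => nf; rewrite inE; split => //.
- have /= nfin' := nfin; rewrite -(fineK nfin') lee_fin (le_trans _ ne)//= sub0r normrN.
  exact: ler_norm.
Qed.

(** * Uniqueness against arbitrary competitors, by iterated halving *)

Section nonlinear_uniqueness.
Context {R : realType}.
Local Notation mu := (@lebesgue_measure R).
Variables (T : R) (lam w0 w1 wm : nat -> R).
Hypothesis T0 : 0 <= T.
Hypothesis lam0 : forall k, 0 < lam k.
Hypothesis w00 : forall k, 0 < w0 k.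
Hypothesis w1E : forall k, w1 k = lam k * w0 k.
Hypothesis wmE : forall k, wm k = (lam k)^-1 * w0 k.
Variables (N : (nat -> R) -> nat -> R) (C K : R).
Hypothesis C0 : 0 <= C.
Hypothesis K0 : 0 <= K.
Hypothesis Nm : forall x : R -> nat -> R, (forall k, measurable_fun setT (x ^~ k)) ->
  forall k, measurable_fun setT (fun t => N (x t) k).
Hypothesis Nlip : forall x y, (wsum wm (fun k => N x k - N y k)%R <=
  ((1 / 16)%:E + C%:E * wsum w0 y) * wsum w1 (fun k => x k - y k)%R +
  (K%:E + C%:E * wsum w1 x) * wsum w0 (fun k => x k - y k)%R)%E.
Variables (f : R -> nat -> R) (x0 : nat -> R).

Let w0ge k : 0 <= w0 k. Proof. exact: ltW. Qed.
Let w1ge k : 0 <= w1 k. Proof. exact: (w1_ge0 lam0 w00 w1E). Qed.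
Let wmge k : 0 <= wm k. Proof. exact: (wm_ge0 lam0 w00 wmE). Qed.

(** Three absorptions: the coefficient of [d1] is at most 1 and goes into the dissipation; the
    bounded part [n] of [b], together with [B], goes into the rate [2 g]; the excess [h] keeps the
    factor [p d0 <= c] and will have a small integral. *)
Lemma gronwall_bound (p g c A B n : R) (a b h d1 d0 : \bar R) :
  0 <= p -> 0 <= c -> A <= 1 -> B + C * n <= 2 * g -> 0 <= B -> 0 <= n ->
  (0 <= a -> 0 <= b -> 0 <= h -> 0 <= d1 -> 0 <= d0 -> a <= A%:E ->
   b <= n%:E + h -> p%:E * d0 <= c%:E ->
   p%:E * (a * d1 + (B%:E + C%:E * b) * d0) <=
   p%:E * (d1 + (2 * g)%:E * d0) + (C * c)%:E * h)%E.
Proof.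
move=> p0 c0 A1 Bg B0 n0 a0 b0 h0 d10 d00 aA bn dc.
have C0e : (0 <= C%:E)%E by rewrite lee_fin.
have n0e : (0 <= n%:E)%E by rewrite lee_fin.
have B0e : (0 <= B%:E)%E by rewrite lee_fin.
have p0e : (0 <= p%:E)%E by rewrite lee_fin.
have g0 : 0 <= 2 * g by rewrite (le_trans _ Bg)// addr_ge0// mulr_ge0.
have Cn0 : (0 <= C%:E * n%:E)%E by rewrite mule_ge0.
have Ch0 : (0 <= C%:E * h)%E by rewrite mule_ge0.
apply: (@le_trans _ _ (p%:E * (1%:E * d1 + (B%:E + C%:E * (n%:E + h)) * d0))%E).
  rewrite lee_wpmul2l// leeD//.
    by rewrite lee_wpmul2r// (le_trans aA)// lee_fin.
  by rewrite lee_wpmul2r// leeD2l// lee_wpmul2l.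
rewrite mul1e (ge0_muleDr C%:E)// addeA (@ge0_muleDl _ d0 (B%:E + _)%E)//; last exact: adde_ge0.
rewrite addeA ge0_muleDr; last 2 first.
- by rewrite adde_ge0// mule_ge0// adde_ge0.
- by rewrite mule_ge0.
apply: leeD.
  by rewrite lee_wpmul2l// leeD2l// lee_wpmul2r// -EFinM -EFinD lee_fin.
by rewrite muleCA (EFinM C) -!muleA lee_wpmul2l// muleC lee_wpmul2r.
Qed.

(** If [b] bounds the weighted [w0]-energy of [d = y - x] on [[0, T]], so does [b / 2]: in the
    energy inequality the dissipation cancels, and only the excess of the competitor's [w1]-energy
    remains. Iterating from a finite bound gives [d = 0]. Only [x] is assumed to lie in the small
    ball. *)
Lemma solution_unique g r x y : 0 <= g -> C * r / wt g T <= 1 / 16 ->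
  energy_bounded T w0 w1 g r x -> solves T lam w1 wm N f x0 x ->
  solves T lam w1 wm N f x0 y ->
  forall t k, t \in `[0, T] -> y t k = x t k.
Proof.
move=> g0 Cr [xr _] [xm xP x1 xN] [ym yP y1 yN].
have Nxm := Nm xm; have Nym := Nm ym.
(* Threshold for the excess: [C b] times [1 / (2 + 2 C)] is at most [b / 2]. *)
have Cpos : 0 < 1 / (2 + (C + C)) by rewrite divr_gt0//; move: C0; lra.
have [n [h [mh h0 yh hi]]] := integrable_excess (m := mu) (measurable_itv `[0, T])
  (measurable_wsum w1ge (fun k => measurable_funS measurableT (@subsetT _ _) (ym k)))
  (fun s _ => wsum_ge0 w1ge (y s)) y1 Cpos.
(* The new rate depends on the competitor through [n]; [K + C n <= 2 G] is the condition of
   [gronwall_bound]. *)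
pose G := K + C * n%:R.
have G0 : 0 <= G by rewrite addr_ge0// mulr_ge0.
have wg0 k : 0 <= wg w0 w1 G k by exact: (wg_ge0 lam0 w00 w1E).
pose d t k := y t k - x t k.
have dm : coord_measurable d by exact: coord_measurableB.
have Fm : coord_measurable (fun t k => N (x t) k - N (y t) k) by apply: coord_measurableB.
have dP k : is_prim T 0 (fun t => - lam k * d t k + (N (x t) k - N (y t) k)) (d ^~ k).
  have e := is_primB (yP k) (xP k); rewrite subrr in e.
  by apply: (eq_is_prim e) => // t _ /=; rewrite /d; ring.
pose J t := (\int[mu]_(s in `[0%R, t]) ((wt G s)%:E * wsum wm (fun k => N (x s) k - N (y s) k)%R))%E.
pose P t := (\int[mu]_(s in `[0%R, t]) ((wt G s)%:E * wsum (wg w0 w1 G) (d s)))%E.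
have en t : t \in `[0, T] -> ((wt G t)%:E * wsum w0 (d t) + P t <= J t)%E.
  move=> tT; have := system_energy T0 lam0 w00 w1E wmE G0 dP tT.
  by rewrite wsum0 add0e.
have q0 := wt_gt0 G T.
have sub t : t \in `[0, T] -> `[0, t] `<=` `[0, T].
  by rewrite in_itv/= => /andP[_ tT]; apply: subset_itvl; rewrite bnd_simp.
(* A finite bound for the forcing starts the halving, and makes the dissipation [P t] finite, so
   that it can be cancelled. *)
have [c cJ] : exists c : R, forall t, t \in `[0, T] -> (J t <= c%:E)%E.
  have Jm (z : R -> nat -> R) : coord_measurable z -> measurable_fun `[0, T] (fun s => wsum wm (z s)).
    by move=> zm; apply: measurable_wsum => // k; apply: measurable_funS (zm k).
  have : (2%:E * \int[mu]_(s in `[0%R, T]) wsum wm (N (x s)) +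
      2%:E * \int[mu]_(s in `[0%R, T]) wsum wm (N (y s)) < +oo)%E.
    by rewrite lte_add_pinfty// lte_mul_pinfty.
  have i0 z : (0 <= \int[mu]_(s in `[0%R, T]) wsum wm (N (z s)))%E.
    by apply: integral_ge0 => s _; exact: wsum_ge0.
  rewrite -ge0_fin_numE; last by rewrite adde_ge0// mule_ge0.
  move=> fin; exists (fine (2%:E * \int[mu]_(s in `[0%R, T]) wsum wm (N (x s)) +
      2%:E * \int[mu]_(s in `[0%R, T]) wsum wm (N (y s)))%E) => t tT.
  rewrite fineK//.
  apply: (@le_trans _ _ (\int[mu]_(s in `[0%R, T]) ((wt G s)%:E * wsum wm (fun k => N (x s) k - N (y s) k)%R))%E).
    apply: ge0_subset_integral => //; last exact: sub.
      exact: measurable_wt_wsum.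
    by move=> s _; exact: wt_wsum_ge0.
  rewrite -!ge0_integralZl//; try by [exact: Jm|move=> s _; exact: wsum_ge0].
  rewrite -ge0_integralD//; last 4 first.
  - by move=> s _; rewrite mule_ge0// wsum_ge0.
  - by apply: emeasurable_funM => //; exact: Jm.
  - by move=> s _; rewrite mule_ge0// wsum_ge0.
  - by apply: emeasurable_funM => //; exact: Jm.
  apply: ge0_le_integral => //.
  - by move=> s _; exact: wt_wsum_ge0.
  - exact: measurable_wt_wsum.
  - by apply: emeasurable_funD; apply: emeasurable_funM => //; exact: Jm.
  move=> s /=; rewrite in_itv/= => /andP[s0 _].
  rewrite (le_trans _ (wsumB_le wmge _ _))// -[leRHS]mul1e lee_wpmul2r ?wsum_ge0//.
  by rewrite lee_fin wt_le1.
have half b : 0 <= b -> (forall t, t \in `[0, T] -> ((wt G t)%:E * wsum w0 (d t) <= b%:E)%E) ->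
    forall t, t \in `[0, T] -> ((wt G t)%:E * wsum w0 (d t) <= (b / 2)%:E)%E.
  move=> b0 db t tT.
  have P0 : (0 <= P t)%E by apply: integral_ge0 => s _; exact: wt_wsum_ge0.
  have w0d : (0 <= (wt G t)%:E * wsum w0 (d t))%E by exact: wt_wsum_ge0.
  have Pfin : P t \is a fin_num.
    rewrite ge0_fin_numE//; apply: le_lt_trans (ltry c).
    by apply: le_trans (cJ t tT); apply: le_trans (en t tT); rewrite leeDr.
  (* [P t] is added to both sides; what remains is to bound [J t] by [P t] plus [b / 2]. *)
  rewrite -(@leeD2lE _ (P t))// addeC (le_trans (en t tT))//.
  have mht : measurable_fun `[0, t] h by apply: measurable_funS mh => //; exact: sub.
  have ht0 s : `[0, t]%classic s -> (0 <= h s)%E by move=> st; apply: h0; exact: sub st.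
  apply: (@le_trans _ _ (\int[mu]_(s in `[0%R, t]) ((wt G s)%:E * wsum (wg w0 w1 G) (d s) + (C * b)%:E * h s))%E).
    apply: ge0_le_integral => //.
    - by move=> s _; exact: wt_wsum_ge0.
    - exact: measurable_wt_wsum.
    - apply: emeasurable_funD; first exact: measurable_wt_wsum.
      exact: emeasurable_funM.
    move=> s st; have sT := sub t tT s st.
    apply: (@le_trans _ _ ((wt G s)%:E * (((1 / 16)%:E + C%:E * wsum w0 (x s)) *
        wsum w1 (d s) + (K%:E + C%:E * wsum w1 (y s)) * wsum w0 (d s)))%E).
      (* The difference is reversed so that the competitor [y] takes the first place in [Nlip],
         where its [w1]-energy enters, and the small [x] the second. *)
      by rewrite wsumBC lee_wpmul2l ?lee_fin ?wt_ge0//; exact: Nlip.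
    rewrite /wg wsum_weightsD//; last by rewrite mulr_ge0.
    apply: (@gronwall_bound _ _ _ (1 / 8) _ n%:R) => //; try exact: wsum_ge0.
    - exact: wt_ge0.
    - lra.
    - by rewrite /G; move: G0; rewrite /G; lra.
    - by rewrite adde_ge0 ?lee_fin// mule_ge0 ?wsum_ge0 ?lee_fin.
    - exact: ht0.
    - have [s0 sT'] : 0 <= s /\ s <= T by move: sT; rewrite /= in_itv/= => /andP[].
      have xs : (wsum w0 (x s) <= (r / wt g T)%:E)%E.
        rewrite mulrC EFinM lee_pdivlMl ?wt_gt0// (le_trans _ (xr s _))//.
        by rewrite lee_wpmul2r ?wsum_ge0// lee_fin wt_ge.
      apply: (@le_trans _ _ ((1 / 16)%:E + C%:E * (r / wt g T)%:E)%E).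
        by rewrite leeD2l// lee_wpmul2l// lee_fin.
      rewrite -EFinM -EFinD lee_fin mulrA; lra.
    - exact: yh.
    - exact: db.
  rewrite ge0_integralD//; last 4 first.
  - by move=> s _; exact: wt_wsum_ge0.
  - exact: measurable_wt_wsum.
  - by move=> s st; rewrite mule_ge0 ?ht0// lee_fin mulr_ge0.
  - exact: emeasurable_funM.
  rewrite leeD2l// ge0_integralZl//; last by rewrite lee_fin mulr_ge0.
  apply: (@le_trans _ _ ((C * b)%:E * (1 / (2 + (C + C)))%:E)%E).
    rewrite lee_wpmul2l ?lee_fin ?mulr_ge0//; apply: le_trans hi.
    by apply: ge0_subset_integral => //; exact: sub.
  rewrite -EFinM lee_fin (mulrC C) -mulrA ler_wpM2l// mulrA mulr1 ler_pdivrMr; last by move: C0; lra.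
  move: C0; lra.
have c0 : 0 <= c.
  have TT : 0 \in `[0, T] by rewrite in_itv/= T0 lexx.
  have := cJ 0 TT; rewrite -lee_fin; apply: le_trans.
  by apply: integral_ge0 => s _; exact: wt_wsum_ge0.
have all m t : t \in `[0, T] -> ((wt G t)%:E * wsum w0 (d t) <= (c / 2 ^+ m)%:E)%E.
  elim: m t => [|m IH] t tT.
    rewrite expr0 divr1; apply: le_trans (cJ t tT); apply: le_trans (en t tT).
    by rewrite leeDl//; apply: integral_ge0 => s _; exact: wt_wsum_ge0.
  have := half (c / 2 ^+ m) _ IH t tT.
  rewrite -mulrA -invfM -exprSr; apply.
  by rewrite divr_ge0// exprn_ge0.
move=> t k tT; apply/eqP; rewrite -subr_eq0; apply/eqP.
apply: (@wsum_eq0 _ w0 w0ge (d t) k (w00 k)).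
rewrite -(pmule_rle0 _ (_ : (0 < (wt G t)%:E)%E)) ?lte_fin ?wt_gt0//.
have ch : (c / 2 ^+ m)%:E @[m --> \oo] --> (c * 0)%:E.
  apply: cvg_EFin; first exact: nearW.
  apply: cvgM; first exact: cvg_cst.
  under eq_fun do rewrite -exprVn.
  by apply: cvg_expr; rewrite ger0_norm ?invr_ge0// invf_lt1// ltr1n.
rewrite mulr0 in ch; rewrite -[leRHS]/(0%:E) -(cvg_lim (@ereal_hausdorff R) ch).
by apply: lime_ge; [apply/cvg_ex; eexists; exact: ch|apply: nearW => m; exact: all].
Qed.

(* Taking g = 0 in the scalar energy inequality bounds every coordinate
   uniformly in time by a sequence of finite energy. *)
Lemma solves_dominated x : coord_measurable f -> solves T lam w1 wm N f x0 x ->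
  (wsum w0 x0 < +oo)%E -> (\int[mu]_(s in `[0%R, T]) wsum wm (f s) < +oo)%E ->
  exists b : nat -> R, (wsum w0 b < +oo)%E /\
    forall t k, t \in `[0, T] -> `|x t k| <= `|b k|.
Proof.
move=> fm [xm xP x1 xN] x00 foo.
pose F s k := f s k - N (x s) k.
have Fm : coord_measurable F by apply: coord_measurableB => //; exact: Nm.
have Foo : (\int[mu]_(s in `[0%R, T]) wsum wm (F s) < +oo)%E.
  have Jm (z : R -> nat -> R) : coord_measurable z -> measurable_fun `[0, T] (fun s => wsum wm (z s)).
    by move=> zm; apply: measurable_wsum => // k; apply: measurable_funS (zm k).
  apply: (@le_lt_trans _ _ (2%:E * \int[mu]_(s in `[0%R, T]) wsum wm (f s) +
      2%:E * \int[mu]_(s in `[0%R, T]) wsum wm (N (x s))))%E; last first.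
    by rewrite lte_add_pinfty// lte_mul_pinfty.
  have Nxm : coord_measurable (fun s => N (x s)) by exact: Nm.
  rewrite -!ge0_integralZl//; try by [exact: Jm|move=> s _; exact: wsum_ge0].
  rewrite -ge0_integralD//; last 4 first.
  - by move=> s _; rewrite mule_ge0// wsum_ge0.
  - by apply: emeasurable_funM => //; exact: Jm.
  - by move=> s _; rewrite mule_ge0// wsum_ge0.
  - by apply: emeasurable_funM => //; exact: Jm.
  apply: ge0_le_integral => //.
  - by move=> s _; exact: wsum_ge0.
  - exact: Jm.
  - by apply: emeasurable_funD; apply: emeasurable_funM => //; exact: Jm.
  - by move=> s _; exact: wsumB_le.
pose I k := (\int[mu]_(s in `[0%R, T]) (1 * (wm k * F s k ^+ 2))%:E)%E.
have IE : (\sum_(0 <= k <oo) I k = \int[mu]_(s in `[0%R, T]) wsum wm (F s))%E.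
  rewrite -(@integral_wsum _ _ _ mu `[0, T] wm F wmge _ (cst 1))//.
    by apply: eq_integral => s _; rewrite mul1e.
  by move=> k; apply: measurable_funS (Fm k).
have I0 k : (0 <= I k)%E.
  by apply: integral_ge0 => s _; rewrite lee_fin mul1r mulr_ge0 ?sqr_ge0.
have Ifin k : I k \is a fin_num.
  rewrite ge0_fin_numE//; apply: le_lt_trans Foo; rewrite -IE.
  apply: le_trans (nneseries_lim_ge k.+1 (fun i _ _ => I0 i)).
  by rewrite big_mkord big_ord_recr/= leeDr// sume_ge0.
(* Since [lam^-1 = wm / w0], the scalar inequality gives this majorant: [w0 k * b k ^+ 2] is
   [w0 k * x0 k ^+ 2] plus the [k]-th part of the energy integral of the forcing, and both are
   summable. *)
pose b k := Num.sqrt (x0 k ^+ 2 + (w0 k)^-1 * fine (I k)).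
have q0 k : 0 <= x0 k ^+ 2 + (w0 k)^-1 * fine (I k).
  by rewrite addr_ge0 ?sqr_ge0// mulr_ge0 ?invr_ge0// fine_ge0.
exists b; split.
  rewrite /wsum (eq_eseriesr (g := fun k => (w0 k * x0 k ^+ 2)%:E + I k)%E); last first.
    move=> k _; rewrite sqr_sqrtr//.
    rewrite (_ : _ * _ = w0 k * x0 k ^+ 2 + fine (I k)); last by field; rewrite gt_eqF.
    by rewrite EFinD fineK.
  rewrite nneseriesD; last 2 first.
  - by move=> k _ _; exact: wsum_term_ge0.
  - by move=> k _ _; exact: I0.
  by rewrite IE lte_add_pinfty.
move=> t k tT.
rewrite [X in _ <= X]ger0_norm ?sqrtr_ge0//.
rewrite -(ler_pXn2r (n := 2)) ?nnegrE ?sqrtr_ge0// sqr_sqrtr// real_normK ?num_real//.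
have := scalar_energy T0 (lexx 0) (lam0 k) (xP k) tT.
rewrite /wt mulr0 oppr0 mul0r expR0 mul1r => h.
rewrite -lee_fin (EFinD (x0 k ^+ 2)) (EFinM (w0 k)^-1) fineK//.
apply: (@le_trans _ _ ((x0 k ^+ 2)%:E + \int[mu]_(s in `[0%R, t]) ((lam k)^-1 * F s k ^+ 2)%:E)%E).
  rewrite (_ : (\int[mu]_(s in _) _)%E = (\int[mu]_(s in `[0%R, t]) (expR (0 * s) * ((lam k)^-1 * (f s k - N (x s) k) ^+ 2))%:E)%E); last first.
    by apply: eq_integral => s _; rewrite mul0r expR0 mul1r.
  apply: le_trans h; rewrite leeDl// integral_ge0// => s _.
  by rewrite lee_fin mulr_ge0 ?expR_ge0// mulr_ge0 ?sqr_ge0// addr0 ltW.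
rewrite leeD2l// /I -ge0_integralZl//; first last.
- by rewrite lee_fin invr_ge0.
- by move=> s _; rewrite lee_fin mul1r mulr_ge0 ?sqr_ge0.
- apply/measurable_EFinP; apply: measurable_funM => //; apply: measurable_funM => //.
  by apply: measurable_funX; apply: measurable_funS (Fm k).
rewrite [leRHS](_ : _ = \int[mu]_(s in `[0%R, T]) ((lam k)^-1 * F s k ^+ 2)%:E)%E; last first.
  apply: eq_integral => s _; rewrite -EFinM mul1r wmE; congr EFin; field.
  by rewrite !gt_eqF.
apply: ge0_subset_integral => //.
- apply/measurable_EFinP; apply: measurable_funM => //.
  by apply: measurable_funX; apply: measurable_funS (Fm k).
- by move=> s _; rewrite lee_fin mulr_ge0 ?sqr_ge0// invr_ge0 ltW.
- by move: tT; rewrite in_itv/= => /andP[_ tT]; apply: subset_itvl; rewrite bnd_simp.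
Qed.

End nonlinear_uniqueness.

Lemma system_wellposed (R : realType) (T : R) (lam w0 w1 wm : nat -> R)
    (N : (nat -> R) -> nat -> R) (C K : R) :
  0 <= T -> (forall k, 0 < lam k) -> (forall k, 0 < w0 k) ->
  (forall k, w1 k = lam k * w0 k) -> (forall k, wm k = (lam k)^-1 * w0 k) ->
  0 <= C -> 0 <= K -> (forall k, N (fun=> 0) k = 0) ->
  (forall x : R -> nat -> R, (forall k, measurable_fun setT (x ^~ k)) ->
    forall k, measurable_fun setT (fun t => N (x t) k)) ->
  (forall x y, (wsum wm (fun k => N x k - N y k)%R <=
    ((1 / 16)%:E + C%:E * wsum w0 y) * wsum w1 (fun k => x k - y k)%R +
    (K%:E + C%:E * wsum w1 x) * wsum w0 (fun k => x k - y k)%R)%E) ->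
  exists2 r : R, 0 < r & forall (f : R -> nat -> R) (x0 : nat -> R), coord_measurable f ->
    (wsum w0 x0 + \int[@lebesgue_measure R]_(s in `[0%R, T]) wsum wm (f s) <= r%:E)%E ->
    exists2 x, solves T lam w1 wm N f x0 x &
      forall y, solves T lam w1 wm N f x0 y ->
        forall t k, t \in `[0, T] -> y t k = x t k.
Proof.
move=> T0 lam0 w00 w1E wmE C0 K0 N0 Nm Nlip.
(* This [g] gives [K <= g / 4]. The radius then makes [C r / wt g T <= 1 / 16], with [C + 1] in the
   denominator so that [C = 0] is allowed; the data receive a quarter of it, as [picard] asks. *)
pose g := 4 * K; have g0 : 0 <= g by rewrite mulr_ge0.
have q0 := wt_gt0 g T.
pose r := wt g T / (16 * (C + 1)).
have C1 : 0 < C + 1 by lra.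
have r0 : 0 < r by rewrite divr_gt0// mulr_gt0.
have Kg : K <= g / 4 by rewrite /g; lra.
have Cr : C * r / wt g T <= 1 / 16.
  rewrite /r (_ : _ / _ = C / (16 * (C + 1))); last by field; rewrite !gt_eqF.
  by rewrite ler_pdivrMr ?mulr_gt0//; lra.
exists (r / 4) => [|f x0 fm fx]; first by rewrite divr_gt0.
have wm0 k : 0 <= wm k by exact: (wm_ge0 lam0 w00 wmE).
have data : (wsum w0 x0 + \int[@lebesgue_measure R]_(s in `[0%R, T])
    ((wt g s)%:E * wsum wm (f s)) <= (r / 4)%:E)%E.
  apply: le_trans fx; rewrite leeD2l//; apply: ge0_le_integral => //.
  - by move=> s _; exact: wt_wsum_ge0.
  - exact: measurable_wt_wsum.
  - by apply: measurable_wsum => // k; apply: measurable_funS (fm k).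
  move=> s /=; rewrite in_itv/= => /andP[s0 _].
  by rewrite -[leRHS]mul1e lee_wpmul2r ?wsum_ge0// lee_fin wt_le1.
have [x [xs xb]] := picard T0 lam0 w00 w1E wmE C0 K0 N0 Nm Nlip fm (ltW r0) Kg Cr data.
exists x => // y ys.
exact: (solution_unique T0 lam0 w00 w1E wmE C0 K0 Nm Nlip g0 Cr xb xs ys).
Qed.

(** * Duality between a weighted l2 space and the inverse weight *)

Section finite_cauchy_schwarz.
Context {R : realType}.
Implicit Types (w v c : nat -> R).

(** The sum of [w k] times the square of [A c k / w k - P v k] is nonnegative and equals
    [A (A B - P^2)]; for [A = 0] all [v k] vanish. *)
Lemma sum_cauchy_schwarz w v c n : (forall k, 0 < w k) ->
  (\sum_(k < n) v k * c k) ^+ 2 <=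
  (\sum_(k < n) w k * v k ^+ 2) * (\sum_(k < n) (w k)^-1 * c k ^+ 2).
Proof.
move=> w0; set P := \sum_(k < n) v k * c k; set A := \sum_(k < n) w k * _.
set B := \sum_(k < n) _^-1 * _.
have A0 : 0 <= A by rewrite sumr_ge0// => k _; rewrite mulr_ge0 ?sqr_ge0// ltW.
have : 0 <= \sum_(k < n) w k * (A * ((w k)^-1 * c k) - P * v k) ^+ 2.
  by rewrite sumr_ge0// => k _; rewrite mulr_ge0 ?sqr_ge0// ltW.
have expand (a p : R) : \sum_(k < n) w k * (a * ((w k)^-1 * c k) - p * v k) ^+ 2 =
    a ^+ 2 * B - 2 * a * p * P + p ^+ 2 * A.
  rewrite /B /P /A !mulr_sumr -sumrB -big_split/=.
  by apply: eq_bigr => k _; field; rewrite gt_eqF.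
rewrite expand (_ : _ + _ = A * (A * B - P ^+ 2)); last by ring.
move: A0; rewrite le_eqVlt => /predU1P[A0 _|A0]; last by rewrite pmulr_rge0// subr_ge0.
have v0 (k : 'I_n) : v k = 0.
  have /eqP := esym A0; rewrite psumr_eq0; last first.
    by move=> i _; rewrite mulr_ge0 ?sqr_ge0// ltW.
  move=> /allP /(_ k (mem_index_enum _)) /=.
  by rewrite mulf_eq0 gt_eqF//= sqrf_eq0 => /eqP.
by rewrite /P big1 ?expr0n -?A0 ?mul0r// => k _; rewrite v0 mul0r.
Qed.

(** Testing with [v = c / w] makes both sides powers of one partial sum [S], so that [S^2 <= K S].
    This turns a bound on a functional over finite combinations into a bound of its dual norm. *)
Lemma wsum_inv_le w c (K : R) : (forall k, 0 < w k) ->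
  (forall n v, (\sum_(k < n) v k * c k) ^+ 2 <= K * \sum_(k < n) w k * v k ^+ 2) ->
  (wsum (fun k => (w k)^-1)%R c <= K%:E)%E.
Proof.
move=> w0 h; apply: wsum_le => [k|n]; first by rewrite invr_ge0 ltW.
rewrite lee_fin; set S := \sum_(k < n) _.
have S0 : 0 <= S by rewrite sumr_ge0// => k _; rewrite mulr_ge0 ?sqr_ge0// invr_ge0 ltW.
have := h n (fun k => (w k)^-1 * c k).
rewrite (eq_bigr (fun k : 'I_n => (w k)^-1 * c k ^+ 2)); last by move=> k _; rewrite -mulrA.
rewrite [X in _ <= K * X](eq_bigr (fun k : 'I_n => (w k)^-1 * c k ^+ 2)); last first.
  by move=> k _; field; rewrite gt_eqF.
(* For [S = 0] there is nothing to divide by, and [0 <= K] comes from the one-term test [v = 1]. *)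
rewrite -/S; move: S0; rewrite le_eqVlt => /predU1P[<- _|S0].
  have := h 1%N (fun=> 1); rewrite !big_ord1 => /(le_trans (sqr_ge0 _)).
  by rewrite expr1n mulr1 pmulr_lge0.
by rewrite expr2 ler_pM2r.
Qed.

End finite_cauchy_schwarz.

(** * Coordinates in a Hilbert basis *)

Section hilbert.
Context (R : realType) (H : completeNormedModType R) (ip : {dot H for idfun}).
Hypothesis ipn : forall x, ip x x = `|x| ^+ 2.
Implicit Types (u v : H).

Lemma ipC u v : ip u v = ip v u.
Proof. by rewrite hermC expr0 mul1r. Qed.

Lemma ipDl u v w : ip (u + v) w = ip u w + ip v w.
Proof. exact: linearDl. Qed.

Lemma ipZl (a : R) u v : ip (a *: u) v = a * ip u v.
Proof. exact: (linearZl_LR ip). Qed.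

Lemma ipBl u v w : ip (u - v) w = ip u w - ip v w.
Proof. exact: linearBl. Qed.

Lemma ipDr u v w : ip w (u + v) = ip w u + ip w v.
Proof. exact: linearDr. Qed.

Lemma ipZr (a : R) u v : ip v (a *: u) = a * ip v u.
Proof. by rewrite ipC ipZl ipC. Qed.

Lemma ipBr u v w : ip w (u - v) = ip w u - ip w v.
Proof. exact: linearBr. Qed.

Lemma ip_suml n (f : 'I_n -> H) v :
  ip (\sum_(k < n) f k) v = \sum_(k < n) ip (f k) v.
Proof. exact: linear_sumlz. Qed.

Lemma ip0l v : ip 0 v = 0. Proof. exact: linear0l. Qed.

Lemma ip_cauchy_schwarz u v : `|ip u v| <= `|u| * `|v|.
Proof.
have [->|v0] := eqVneq v 0; first by rewrite normr0 mulr0 ipC ip0l normr0.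
have nv : 0 < `|v| by rewrite normr_gt0.
set n2 := `|v| ^+ 2.
have : 0 <= `|n2 *: u - ip u v *: v| ^+ 2 by exact: sqr_ge0.
rewrite -ipn ipBl !ipBr !ipZl !ipZr (ipC v u) !ipn -/n2 => h.
rewrite -(ler_pXn2r (n := 2)) ?nnegrE ?mulr_ge0// real_normK ?num_real// exprMn.
rewrite -/n2 -subr_ge0 -(pmulr_rge0 _ (exprn_gt0 2 nv)) -/n2.
by apply: le_trans h _; rewrite le_eqVlt; apply/orP; left; apply/eqP; ring.
Qed.

Lemma cvg_ip (I : Type) (F : set_system I) {FF : Filter F} (f : I -> H) u v :
  f i @[i --> F] --> u -> ip (f i) v @[i --> F] --> ip u v.
Proof.
move=> fu; apply/cvgrPdist_le => e e0.
have e1 : 0 < e / (`|v| + 1) by rewrite divr_gt0// ltr_wpDl.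
move/cvgrPdist_le : fu => /(_ _ e1); apply: filterS => i fi.
rewrite -ipBl (le_trans (ip_cauchy_schwarz _ _))//.
apply: le_trans (ler_wpM2r (normr_ge0 v) fi) _.
by rewrite mulrAC ler_pdivrMr ?ltr_wpDl// ler_wpM2l ?ltW// ltrDl.
Qed.

Variable phi : nat -> H.
Hypothesis basis : hilbert_basis ip phi.

Let ortho i j : ip (phi i) (phi j) = (i == j)%:R. Proof. by case: basis. Qed.

Definition coef u k : R := ip u (phi k).

Definition proj n (a : nat -> R) : H := \sum_(k < n) a k *: phi k.

Lemma coef_phi k j : coef (phi k) j = (k == j)%:R.
Proof. exact: ortho. Qed.

Lemma coefP (c : R) u v k : coef (c *: u + v) k = c * coef u k + coef v k.
Proof. by rewrite /coef ipDl ipZl. Qed.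

Lemma coefB u v k : coef (u - v) k = coef u k - coef v k.
Proof. exact: ipBl. Qed.

Lemma coef_proj n a k : coef (proj n a) k = if (k < n)%N then a k else 0.
Proof.
rewrite /coef /proj ip_suml; under eq_bigr do rewrite ipZl ortho.
case: ltnP => kn.
  rewrite (bigD1 (Ordinal kn))//= eqxx mulr1 big1 ?addr0// => i.
  by rewrite -val_eqE /= => /negPf ->; rewrite mulr0.
rewrite big1// => i _; rewrite (_ : (_ == _) = false) ?mulr0//.
by apply/negbTE; rewrite neq_ltn (leq_trans (ltn_ord i) kn).
Qed.

Lemma ip_proj n a v : ip (proj n a) v = \sum_(k < n) a k * coef v k.
Proof. by rewrite /proj ip_suml; apply: eq_bigr => k _; rewrite ipZl ipC. Qed.

Lemma norm_proj n a : `|proj n a| ^+ 2 = \sum_(k < n) a k ^+ 2.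
Proof.
by rewrite -ipn ip_proj; apply: eq_bigr => k _; rewrite coef_proj ltn_ord.
Qed.

Lemma series_proj a : series (fun k => a k *: phi k) = proj ^~ a.
Proof. by apply/funext => n; rewrite /series/= big_mkord. Qed.

Lemma proj_coef_cvg u : proj n (coef u) @[n --> \oo] --> u.
Proof. by have [_ /(_ u)] := basis; rewrite series_proj. Qed.

Lemma parseval u : wsum (fun=> 1) (coef u) = (`|u| ^+ 2)%:E.
Proof.
have c1 := @wsum_cvg R (fun=> 1) (fun=> ler01) (coef u).
have c2 : (\sum_(k < n) 1 * coef u k ^+ 2)%:E @[n --> \oo] --> (`|u| ^+ 2)%:E.
  apply: cvg_EFin; first exact: nearW.
  rewrite (_ : _ \o _ = (fun n => `|proj n (coef u)| ^+ 2)); last first.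
    by apply/funext => n; rewrite norm_proj /=; under eq_bigr do rewrite mul1r.
  by apply: cvgM; apply: cvg_norm; exact: proj_coef_cvg.
by rewrite -(cvg_lim (@ereal_hausdorff R) c1) (cvg_lim (@ereal_hausdorff R) c2).
Qed.

Lemma coef_inj u v : (forall k, coef u k = coef v k) -> u = v.
Proof.
move=> uv; have e : coef u = coef v by apply/funext.
have h := @proj_coef_cvg v; rewrite -e in h.
by rewrite -(cvg_lim (@norm_hausdorff _ H) (@proj_coef_cvg u)) (cvg_lim (@norm_hausdorff _ H) h).
Qed.

(** Riesz-Fischer: by orthonormality the squared norm of a block of the series is the same block of
    the series of squares, so the Cauchy criterion transfers to the complete space [H]. *)
Lemma proj_cvg (a : nat -> R) : (wsum (fun=> 1%R) a < +oo)%E -> cvg (proj n a @[n --> \oo]).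
Proof.
move=> /(wsum_cvg_real (fun=> ler01)) ac.
have sc : cvgn (series (fun k => a k ^+ 2)).
  apply/cvg_ex; exists (fine (wsum (fun=> 1) a)); move: ac.
  apply: cvg_trans; apply: near_eq_cvg; apply: nearW => n.
  by rewrite /series/= big_mkord; under eq_bigr do rewrite mul1r.
rewrite -series_proj; apply/cauchy_cvgP/cauchy_seriesP => e e0.
have e20 : 0 < e ^+ 2 by rewrite exprn_gt0.
move/cauchy_cvgP/cauchy_seriesP : sc => /(_ _ e20).
apply: filterS => -[n m] /=.
have [nm|/ltnW mn] := leqP n m; last by rewrite !big_geq// !normr0.
suff -> : `|\sum_(n <= k < m) a k ^+ 2| = `|\sum_(n <= k < m) a k *: phi k| ^+ 2.
  by rewrite ltr_pXn2r ?nnegrE// ltW.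
rewrite ger0_norm; last by rewrite sumr_ge0// => i _; exact: sqr_ge0.
have -> : \sum_(n <= k < m) a k *: phi k = proj m (fun k => if (n <= k)%N then a k else 0).
  rewrite /proj -(big_mkord xpredT (fun k => (if (n <= k)%N then a k else 0) *: phi k)).
  rewrite (@big_cat_nat _ _ _ n 0 m)//= [X in _ = X + _]big_nat_cond.
  rewrite [X in _ = X + _]big1 ?add0r.
    by rewrite !big_nat; apply: eq_bigr => i /andP[-> _].
  by move=> i /andP[/andP[_]]; rewrite ltnNge => /negbTE ->; rewrite scale0r.
rewrite norm_proj -(big_mkord xpredT (fun k => (if (n <= k)%N then a k else 0) ^+ 2)).
rewrite (@big_cat_nat _ _ _ n 0 m)//= [X in _ = X + _]big_nat_cond.
rewrite [X in _ = X + _]big1 ?add0r.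
  by rewrite !big_nat; apply: eq_bigr => i /andP[-> _].
by move=> i /andP[/andP[_]]; rewrite ltnNge => /negbTE ->; rewrite expr0n.
Qed.

(** Inverse of [coef] on square summable sequences; on other sequences the value carries no
    meaning. *)
Definition fromseq a : H := limn (proj ^~ a).

Lemma coef_fromseq (a : nat -> R) : (wsum (fun=> 1%R) a < +oo)%E -> coef (fromseq a) = a.
Proof.
move=> /proj_cvg ac; apply/funext => k.
have h : ip (proj n a) (phi k) @[n --> \oo] --> coef (fromseq a) k.
  exact: cvg_ip.
rewrite -(cvg_lim (@Rhausdorff R) h).
apply: (lim_near_cst (@Rhausdorff R)); exists k.+1 => // n /= kn.
by rewrite -/(coef _ _) coef_proj kn.
Qed.

End hilbert.

(** * Fractional powers as weights on the coordinates *)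

Section fractional_norms.
Context (R : realType) (H : completeNormedModType R) (ip : {dot H for idfun}).
Variables (lam : nat -> R) (phi : nat -> H).
Hypothesis ipn : forall x, ip x x = `|x| ^+ 2.
Hypothesis basis : hilbert_basis ip phi.
Hypothesis lam0 : forall k, 0 < lam k.
Hypothesis lam_ge : forall k, lam 0%N <= lam k.
Implicit Types (u v w : H) (s : R).

Local Notation coef := (coef ip phi).
Local Notation proj := (proj phi).
Local Notation dom := (frac_dom ip lam phi).
Local Notation norm := (frac_norm ip lam phi).
Local Notation lp s := (fun k => lam k `^ s).

Lemma lp_gt0 s k : 0 < lam k `^ s. Proof. exact: powR_gt0. Qed.

Lemma lp_ge0 s k : 0 <= lam k `^ s. Proof. exact: powR_ge0. Qed.

Lemma lpD s t k : lam k `^ (s + t) = lam k `^ s * lam k `^ t.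
Proof. by rewrite powRD//; apply/implyP => _; rewrite gt_eqF. Qed.

Lemma frac_domE s u : dom s u = (wsum (lp (2 * s)) (coef u) < +oo)%E :> Prop.
Proof. by []. Qed.

Lemma wsum_lp s a : wsum (fun=> 1%R) (fun k => lam k `^ s * a k) = wsum (lp (2 * s)) a.
Proof.
apply: eq_eseriesr => k _; congr EFin.
by rewrite mul1r exprMn (_ : 2 * s = s + s) ?lpD ?expr2//; ring.
Qed.

Lemma frac_powE s u : frac_pow ip lam phi s u = fromseq phi (fun k => lam k `^ s * coef u k).
Proof. by rewrite /frac_pow series_proj. Qed.

Lemma coef_frac_pow s u k : dom s u ->
  coef (frac_pow ip lam phi s u) k = lam k `^ s * coef u k.
Proof. by move=> us; rewrite frac_powE coef_fromseq// wsum_lp. Qed.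

Lemma frac_norm_ge0 s u : 0 <= norm s u. Proof. exact: normr_ge0. Qed.

(** Parseval's identity for [frac_pow s u]. Through it the norms of the scale become instances of
    [wsum]; membership in the domain ensures that the series defining [frac_pow] converges. *)
Lemma frac_norm_sqr s u : dom s u ->
  ((norm s u) ^+ 2)%:E = wsum (lp (2 * s)) (coef u).
Proof.
move=> us; rewrite /frac_norm -(parseval ipn basis) -wsum_lp; apply: eq_wsum => k.
exact: coef_frac_pow.
Qed.

Lemma frac_dom_subspace s : subspace (dom s).
Proof.
split.
  rewrite frac_domE (@eq_wsum _ _ _ (fun=> 0)) ?wsum0// => k.
  exact: ip0l.
move=> a u v us vs; rewrite frac_domE.
rewrite (@eq_wsum _ _ _ (fun k => a * coef u k + coef v k)); last first.
  by move=> k; exact: coefP.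
apply: (le_lt_trans (wsumD_le _ _ _)) => [k|]; first exact: lp_ge0.
rewrite wsumZ; last by move=> k; exact: lp_ge0.
apply: lte_add_pinfty; last by rewrite lte_mul_pinfty.
by rewrite lte_mul_pinfty// lte_mul_pinfty// lee_fin sqr_ge0.
Qed.

Lemma frac_dom0 s : dom s 0. Proof. by case: (frac_dom_subspace s). Qed.

Lemma frac_domP s a u v : dom s u -> dom s v -> dom s (a *: u + v).
Proof. by case: (frac_dom_subspace s) => _; exact. Qed.

Lemma frac_domZ s a u : dom s u -> dom s (a *: u).
Proof. by move=> us; rewrite -[_ *: _]addr0; apply: frac_domP => //; exact: frac_dom0. Qed.

Lemma frac_domB s u v : dom s u -> dom s v -> dom s (u - v).
Proof. by move=> us vs; rewrite addrC -(scaleN1r v); exact: frac_domP. Qed.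

Lemma frac_powP s a u v : dom s u -> dom s v ->
  frac_pow ip lam phi s (a *: u + v) =
  a *: frac_pow ip lam phi s u + frac_pow ip lam phi s v.
Proof.
move=> us vs; apply: (coef_inj basis) => k.
rewrite coefP !coef_frac_pow//; last exact: frac_domP.
by rewrite coefP; ring.
Qed.

Lemma frac_normZ s a u : dom s u -> norm s (a *: u) = `|a| * norm s u.
Proof.
move=> us; rewrite /frac_norm -[a *: u]addr0 frac_powP//; last exact: frac_dom0.
rewrite (_ : frac_pow _ _ _ s 0 = 0) ?addr0 ?normrZ//.
apply: (coef_inj basis) => k; rewrite coef_frac_pow; last exact: frac_dom0.
by rewrite /coef ip0l mulr0.
Qed.

Lemma frac_normN s u : dom s u -> norm s (- u) = norm s u.
Proof. by move=> us; rewrite -scaleN1r frac_normZ// normrN1 mul1r. Qed.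

Lemma frac_normD s u v : dom s u -> dom s v -> norm s (u + v) <= norm s u + norm s v.
Proof.
move=> us vs; rewrite {1}/frac_norm -{1}[u]scale1r frac_powP// scale1r.
exact: ler_normD.
Qed.

Lemma frac_normB s u v : dom s u -> dom s v -> norm s (u - v) <= norm s u + norm s v.
Proof.
move=> us vs; rewrite -(frac_normN vs) frac_normD// -scaleN1r.
exact: frac_domZ.
Qed.

Lemma wsum_proj (w : nat -> R) n a : (forall k, 0 <= w k) ->
  wsum w (coef (proj n a)) = (\sum_(k < n) w k * a k ^+ 2)%:E.
Proof.
move=> w0; rewrite /wsum (nneseries_split _ n); last first.
  by move=> k _; exact: wsum_term_ge0.
rewrite add0n eseries0 ?adde0; last first.
  by move=> k nk _; rewrite coef_proj// ltnNge nk/= expr0n mulr0.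
rewrite big_mkord sumEFin; congr EFin; apply: eq_bigr => k _.
by rewrite coef_proj// ltn_ord.
Qed.

Lemma frac_dom_proj s n a : dom s (proj n a).
Proof. by rewrite frac_domE wsum_proj ?ltry// => k; exact: lp_ge0. Qed.

Lemma frac_norm_proj s n a :
  norm s (proj n a) ^+ 2 = \sum_(k < n) lam k `^ (2 * s) * a k ^+ 2.
Proof.
apply: EFin_inj; rewrite frac_norm_sqr; last exact: frac_dom_proj.
by rewrite wsum_proj// => k; exact: lp_ge0.
Qed.

Lemma frac_norm_proj_cvg s u : dom s u ->
  norm s (proj n (coef u) - u) @[n --> \oo] --> (0 : R).
Proof.
move=> us.
have pd n : dom s (proj n (coef u) - u) by apply: frac_domB => //; exact: frac_dom_proj.
have h : fine (wsum (lp (2 * s)) (coef (proj n (coef u) - u))) @[n --> \oo] --> (0 : R).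
  apply: (wsum_dominated (b := coef u)) => //.
  - by move=> k; exact: lp_ge0.
  - apply: nearW => n k; rewrite coefB coef_proj//; case: ifP => _.
      by rewrite subrr normr0.
    by rewrite sub0r normrN.
  - move=> k; apply: (@cvg_trans _ (cst (0 : R) @ \oo)); last exact: cvg_cst.
    apply: near_eq_cvg; exists k.+1 => // n /= kn.
    by rewrite coefB coef_proj// kn subrr.
apply/cvgrPdist_le => e e0.
have e20 : 0 < e ^+ 2 by rewrite exprn_gt0.
move/cvgrPdist_le : h => /(_ _ e20); apply: filterS => n.
rewrite -frac_norm_sqr//= !sub0r !normrN normrX (ger0_norm (frac_norm_ge0 _ _)).
by rewrite ler_pXn2r ?nnegrE ?frac_norm_ge0// ltW.
Qed.

Lemma frac_norm_proj_le s u n : dom s u -> norm s (proj n (coef u)) <= norm s u.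
Proof.
move=> us; rewrite -(ler_pXn2r (n := 2)) ?nnegrE ?frac_norm_ge0//.
rewrite frac_norm_proj -lee_fin frac_norm_sqr//.
by apply: wsum_partial_le => k; exact: lp_ge0.
Qed.

(** The power [s - s'] is nonpositive, hence largest at the lowest eigenvalue. This is where the
    positive lower bound of the spectrum yields the embeddings of the scale. *)
Lemma lp_mono s s' k : s <= s' -> lam k `^ s <= lam 0%N `^ (s - s') * lam k `^ s'.
Proof.
move=> ss; rewrite -{1}(subrK s' s) (lpD (s - s') s') ler_wpM2r ?lp_ge0//.
rewrite -(opprB s' s) !powRN lef_pV2 ?posrE ?lp_gt0//.
by apply: ge0_ler_powR; rewrite ?nnegrE ?subr_ge0// ltW.
Qed.

Lemma frac_dom_mono s s' u : s <= s' -> dom s' u -> dom s u.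
Proof.
move=> ss us; rewrite frac_domE.
apply: (@le_lt_trans _ _ ((lam 0%N `^ (2 * s - 2 * s'))%:E * wsum (lp (2 * s')) (coef u))%E).
  apply: wsum_weights_le => k; try exact: lp_ge0.
  by apply: lp_mono; rewrite ler_wpM2l.
by rewrite lte_mul_pinfty// lee_fin lp_ge0.
Qed.

Lemma frac_norm_mono s s' u : s <= s' -> dom s' u ->
  norm s u <= lam 0%N `^ (s - s') * norm s' u.
Proof.
move=> ss us; have us' := frac_dom_mono ss us.
rewrite -(ler_pXn2r (n := 2)) ?nnegrE ?mulr_ge0 ?frac_norm_ge0 ?lp_ge0//.
rewrite exprMn -lee_fin (EFinM ((lam 0%N `^ (s - s')) ^+ 2)) !frac_norm_sqr//.
rewrite (_ : (lam 0%N `^ (s - s')) ^+ 2 = lam 0%N `^ (2 * s - 2 * s')); last first.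
  by rewrite expr2 -lpD; congr powR; ring.
apply: wsum_weights_le => k; try exact: lp_ge0.
by apply: lp_mono; rewrite ler_wpM2l.
Qed.

Lemma norm_frac0 u : dom 0 u /\ norm 0 u = `|u|.
Proof.
have e : wsum (lp (2 * 0)) (coef u) = wsum (fun=> 1%R) (coef u).
  by apply: eq_eseriesr => k _; rewrite mulr0 powRr0.
have d : dom 0 u by rewrite frac_domE e parseval// ltry.
split=> //; apply/eqP; rewrite -(eqrXn2 (n := 2))// ?frac_norm_ge0//.
by apply/eqP/EFin_inj; rewrite frac_norm_sqr// e parseval.
Qed.

Lemma norm_le_frac s u : 0 <= s -> dom s u -> `|u| <= lam 0%N `^ (- s) * norm s u.
Proof.
by move=> s0 us; have [_ <-] := norm_frac0 u; rewrite -{1}[- s]add0r frac_norm_mono.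
Qed.

(* <A u, v> = <A^s1 u, A^s2 v> when s1 + s2 = 1. *)
Lemma frac_pairing_le s1 s2 u v (c : nat -> R) (l : R) : dom s1 u -> dom s2 v ->
  (forall k, c k = lam k `^ (s1 + s2) * coef u k) ->
  (\sum_(k < n) c k * coef v k) @[n --> \oo] --> l ->
  `|l| <= norm s1 u * norm s2 v.
Proof.
move=> us vs ce cl.
have -> : l = ip (frac_pow ip lam phi s1 u) (frac_pow ip lam phi s2 v).
  rewrite -(cvg_lim (@Rhausdorff R) cl); apply: (cvg_lim (@Rhausdorff R)).
  have h : ip (proj n (coef (frac_pow ip lam phi s1 u))) (frac_pow ip lam phi s2 v)
      @[n --> \oo] --> ip (frac_pow ip lam phi s1 u) (frac_pow ip lam phi s2 v).
    by apply: (cvg_ip ipn); exact: proj_coef_cvg.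
  apply: cvg_trans h; apply: near_eq_cvg; apply: nearW => n.
  rewrite ip_proj; apply: eq_bigr => k _.
  by rewrite !coef_frac_pow// ce lpD; ring.
exact: ip_cauchy_schwarz.
Qed.

End fractional_norms.

(** * Bochner measurability read off coordinates *)

Section simple_functions.
Context (R : realType) (E : lmodType R) (V : set E).
Implicit Types (u v : R -> E).

Lemma simple_fun0 : simple_fun V (fun=> 0).
Proof.
exists 0%N, (fun=> set0), (fun=> 0); split=> [[]//|t].
by rewrite big_ord0.
Qed.

Lemma simple_funD u v : simple_fun V u -> simple_fun V v ->
  simple_fun V (fun t => u t + v t).
Proof.
move=> [m [J [x [Jx uE]]]] [n [K [y [Ky vE]]]].
exists (m + n)%N, (fun i => match fintype.split i with inl j => J j | inr j => K j end),
  (fun i => match fintype.split i with inl j => x j | inr j => y j end).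
split; first by move=> i; case: fintype.splitP.
move=> t; rewrite big_split_ord/= uE vE; congr (_ + _); apply: eq_bigr => i _.
  by rewrite -[lshift n i]/(unsplit (inl i)) unsplitK.
by rewrite -[rshift m i]/(unsplit (inr i)) unsplitK.
Qed.

Lemma simple_fun_sum (I : Type) (r : seq I) (u : I -> R -> E) :
  (forall i, simple_fun V (u i)) -> simple_fun V (fun t => \sum_(i <- r) u i t).
Proof.
move=> us; elim: r => [|i r IH].
  rewrite (_ : (fun t => _) = fun=> 0); first exact: simple_fun0.
  by apply/funext => t; rewrite big_nil.
rewrite (_ : (fun t => _) = (fun t => u i t + \sum_(i <- r) u i t)).
  exact: simple_funD.
by apply/funext => t; rewrite big_cons.
Qed.

Lemma simple_fun_indic (J : set R) (x : E) : measurable J -> V x ->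
  simple_fun V (fun t => \1_J t *: x).
Proof.
move=> mJ Vx; exists 1%N, (fun=> J), (fun=> x); split=> // t.
by rewrite big_ord1.
Qed.

End simple_functions.

(* Covers both D(A^s) and its dual, with the eigenvectors as the e k. *)
Record l2_model (R : realType) (E : lmodType R) (V : set E) (N : E -> R)
    (c : nat -> E -> R) (e : nat -> E) (w : nat -> R) : Prop := {
  l2_zero : V 0 ;
  l2_lin : forall a x y, V x -> V y -> V (a *: x + y) ;
  l2_coord_lin : forall a x y k, V x -> V y -> c k (a *: x + y) = a * c k x + c k y ;
  l2_basis : forall k, V (e k) ;
  l2_coord_basis : forall j k, c k (e j) = (j == k)%:R ;
  l2_weight : forall k, 0 < w k ;
  l2_norm_ge0 : forall x, V x -> 0 <= N x ;
  l2_norm_sqr : forall x, V x -> (N x ^+ 2)%:E = wsum w (fun k => c k x) }.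

Import HBNNSimple.

(** Positive and negative parts are approximated from below, so the error never exceeds [|f t|];
    this supplies the majorant when errors are summed over all coordinates. The target space is
    quantified inside, so that one scalar sequence serves for any of them. *)
Lemma measurable_approximation (R : realType) (f : R -> R) :
  measurable_fun setT f -> exists g : nat -> R -> R,
    [/\ forall (E : lmodType R) (V : set E) (x : E) n, (forall a, V (a *: x)) ->
          simple_fun V (fun t => g n t *: x),
        forall t, g n t @[n --> \oo] --> f t &
        forall n t, `|g n t - f t| <= `|f t|].
Proof.
move=> mf.
have mp : measurable_fun setT (EFin \o f^\+) by apply/measurable_EFinP; exact: measurable_funrpos.
have mn : measurable_fun setT (EFin \o f^\-) by apply/measurable_EFinP; exact: measurable_funrneg.
pose P n : {nnsfun R >-> R} := nnsfun_approx measurableT mp n.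
pose Q n : {nnsfun R >-> R} := nnsfun_approx measurableT mn n.
pose p n t : R := P n t; pose q n t : R := Q n t.
pose fp := f^\+; pose fn := f^\-.
have p0 t : [set: R] t -> (0 <= (EFin \o fp) t)%E by rewrite lee_fin funrpos_ge0.
have n0 t : [set: R] t -> (0 <= (EFin \o fn) t)%E by rewrite lee_fin funrneg_ge0.
have pc t : p n t @[n --> \oo] --> f^\+ t.
  by have /fine_cvg := cvg_nnsfun_approx measurableT mp p0 (I : [set: R] t).
have qc t : q n t @[n --> \oo] --> f^\- t.
  by have /fine_cvg := cvg_nnsfun_approx measurableT mn n0 (I : [set: R] t).
have pl n t : 0 <= p n t <= f^\+ t.
  rewrite fun_ge0/= -lee_fin.
  rewrite /p /P nnsfun_approxE; exact: (le_approx (D := setT) n p0).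
have ql n t : 0 <= q n t <= f^\- t.
  rewrite fun_ge0/= -lee_fin.
  rewrite /q /Q nnsfun_approxE; exact: (le_approx (D := setT) n n0).
exists (fun n t => p n t - q n t); split.
- move=> E V x n Vx.
  have sf (h : {nnsfun R >-> R}) (a : R) : simple_fun V (fun t => (a * h t) *: x).
    pose r := finmap.enum_fset (fset_set (range h)).
    rewrite (_ : (fun t => _) = (fun t => \sum_(y <- r) \1_(h @^-1` [set y]) t *: ((a * y) *: x))).
      apply: simple_fun_sum => y; apply: simple_fun_indic; last exact: Vx.
      exact: measurable_funPTI.
    apply/funext => t; rewrite {1}(fimfunE h t) fsbig_finite//= mulr_sumr scaler_suml.
    by apply: eq_bigr => y _; rewrite scalerA; congr (_ *: _); ring.
  rewrite (_ : (fun t => _) = (fun t => (1 * p n t) *: x + (-1 * q n t) *: x)).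
    by apply: simple_funD; [exact: (sf (P n))|exact: (sf (Q n))].
  by apply/funext => t; rewrite -scalerDl mul1r mulN1r.
- move=> t; rewrite [X in _ --> X](_ : _ = f^\+ t - f^\- t); first exact: cvgB.
  by rewrite -[in LHS](funrposBneg f).
- move=> n t; have /andP[p1 p2] := pl n t; have /andP[q1 q2] := ql n t.
  have -> : f t = f^\+ t - f^\- t by rewrite -[in LHS](funrposBneg f).
  move: p2 q2; rewrite /funrpos /funrneg.
  have [ft|ft] := leP 0 (f t).
    rewrite (max_idPr _) ?oppr_le0// => p2 q2.
    have q0 : q n t = 0 by apply/eqP; rewrite eq_le q1 q2.
    by rewrite q0 !subr0 (ger0_norm ft) distrC ger0_norm ?subr_ge0//; lra.
  rewrite (max_idPl _) ?oppr_ge0 ?(ltW ft)// => p2 q2.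
  have q0 : p n t = 0 by apply/eqP; rewrite eq_le p1 p2.
  rewrite q0 !sub0r !opprK (ltr0_norm ft).
  by rewrite ler_norml; apply/andP; split; lra.
Qed.

Section l2_measurability.
Context (R : realType) (E : lmodType R) (V : set E) (N : E -> R).
Context (c : nat -> E -> R) (e : nat -> E) (w : nat -> R).
Hypothesis M : l2_model V N c e w.
Variable I : set R.
Hypothesis mI : measurable I.

Let V0 : V 0. Proof. by case: M. Qed.
Let VP a x y : V x -> V y -> V (a *: x + y). Proof. by case: M => ? ?; eauto. Qed.
Let VZ a x : V x -> V (a *: x).
Proof. by move=> Vx; rewrite -[_ *: _]addr0; exact: VP. Qed.
Let VB x y : V x -> V y -> V (x - y).
Proof. by move=> Vx Vy; rewrite addrC -scaleN1r; exact: VP. Qed.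
Let cP a x y k : V x -> V y -> c k (a *: x + y) = a * c k x + c k y.
Proof. by case: M; eauto. Qed.
Let c0 k : c k 0 = 0.
Proof.
have := cP (-1) k V0 V0; rewrite scaler0 addr0 mulN1r addNr; exact.
Qed.
Let cB x y k : V x -> V y -> c k (x - y) = c k x - c k y.
Proof. by move=> Vx Vy; rewrite addrC -scaleN1r cP// mulN1r addrC. Qed.

Lemma l2_sum n (a : 'I_n -> R) (x : 'I_n -> E) : (forall k, V (x k)) ->
  V (\sum_(i < n) a i *: x i) /\
  forall k, c k (\sum_(i < n) a i *: x i) = \sum_(i < n) a i * c k (x i).
Proof.
elim: n a x => [|n IH] a x Vx; first by rewrite !big_ord0; split=> // k; rewrite big_ord0.
have [IH1 IH2] := IH (fun i => a (widen_ord (leqnSn n) i)) _ (fun i => Vx (widen_ord (leqnSn n) i)).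
rewrite big_ord_recr/= addrC; split; first exact: VP.
by move=> k; rewrite cP// IH2 big_ord_recr/= addrC.
Qed.

(** Since [w k * c k x ^+ 2 <= N x ^+ 2], each coordinate is continuous for [N] and becomes a
    pointwise limit of scalar simple functions. *)
Lemma strongly_measurable_coord u : strongly_measurable I V N u ->
  forall k, measurable_fun I (fun t => c k (u t)).
Proof.
have [_ _ _ _ _ w0 N0 NE] := M.
move=> [Vu [s ss sN]] k.
have Vs n t : V (s n t).
  have [m [J [x [Jx ->]]]] := ss n.
  by have [] := @l2_sum m (fun i => \1_(J i) t) x (fun i => (Jx i).2).
apply: (@measurable_fun_cvg _ _ _ _ (fun n t => c k (s n t))).
  move=> n; have [m [J [x [Jx sE]]]] := ss n.
  rewrite (_ : (fun t => _) = (fun t => \sum_(i < m) \1_(J i) t * c k (x i))).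
    apply: measurable_sum => i; apply: measurable_funM => //.
    by apply: measurable_indic; have [] := Jx i.
  apply/funext => t; rewrite sE.
  by have [_ ->] := @l2_sum m (fun i => \1_(J i) t) x (fun i => (Jx i).2).
move=> t It; have Nc := sN t It.
apply/cvgrPdist_le => d d0.
have sw : 0 < Num.sqrt (w k) by rewrite sqrtr_gt0.
have dw : 0 < d * Num.sqrt (w k) by rewrite mulr_gt0.
move/cvgrPdist_le : Nc => /(_ _ dw); apply: filterS => n.
have Vd : V (s n t - u t) by apply: VB => //; exact: Vu.
rewrite sub0r normrN ger0_norm; last exact: N0.
move=> h; rewrite distrC -cB//; last exact: Vu.
rewrite -(ler_pM2r sw) (le_trans _ h)//.
rewrite -(ler_pXn2r (n := 2)) ?nnegrE ?mulr_ge0 ?sqrtr_ge0 ?N0//.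
rewrite exprMn real_normK ?num_real// sqr_sqrtr ?(ltW (w0 k))// mulrC.
rewrite -lee_fin NE//; apply: (wsum_term_le _ (fun k => c k (s n t - u t))) => i; exact: ltW.
Qed.

(** Diagonal choice: the [n]-th approximation keeps [n] coordinates, each at level [n]. Every
    coordinate error tends to 0 and is at most [|c k (u t)|], so [wsum_dominated] gives convergence
    in [N]. *)
Lemma coord_strongly_measurable u : (forall t, I t -> V (u t)) ->
  (forall k, measurable_fun I (fun t => c k (u t))) -> strongly_measurable I V N u.
Proof.
have [_ _ _ Ve ce w0 N0 NE] := M.
move=> Vu mu; split=> //.
have mf k : measurable_fun setT ((fun t => c k (u t)) \_ I) by exact: measurable_patch.
pose g k := projT1 (cid (measurable_approximation (mf k))).
have gP k := projT2 (cid (measurable_approximation (mf k))); rewrite -/(g _) in gP.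
exists (fun n t => \sum_(k < n) g k n t *: e k).
  move=> n; apply: simple_fun_sum => k; have [h _ _] := gP k.
  by apply: h => a; exact: VZ.
move=> t It.
have fI k : ((fun t => c k (u t)) \_ I) t = c k (u t) by rewrite patchE mem_set.
have Vs n : V (\sum_(k < n) g k n t *: e k).
  by have [] := @l2_sum n (fun k => g k n t) e (fun k => Ve k).
have cs n k : c k (\sum_(k < n) g k n t *: e k) = if (k < n)%N then g k n t else 0.
  have [_ ->] := @l2_sum n (fun k => g k n t) e (fun k => Ve k).
  case: ltnP => kn.
    rewrite (bigD1 (Ordinal kn))//= ce eqxx mulr1 big1 ?addr0// => i.
    by rewrite -val_eqE /= ce => /negPf ->; rewrite mulr0.
  rewrite big1// => i _; rewrite ce (_ : (_ == _) = false) ?mulr0//.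
  by apply/negbTE; rewrite neq_ltn (leq_trans (ltn_ord i) kn).
have h : fine (wsum w (fun k => c k (\sum_(k < n) g k n t *: e k - u t))) @[n --> \oo] --> (0 : R).
  apply: (wsum_dominated (b := fun k => c k (u t))).
  - by move=> k; exact: ltW.
  - by rewrite -NE ?ltry//; exact: Vu.
  - apply: nearW => n k; rewrite cB//; last exact: Vu.
    rewrite cs; case: ifP => _; last by rewrite sub0r normrN.
    by have [_ _] := gP k; move=> /(_ n t); rewrite fI.
  - move=> k; have [_ /(_ t) gc _] := gP k; rewrite fI in gc.
    have : g k n t - c k (u t) @[n --> \oo] --> (c k (u t) - c k (u t) : R).
      by apply: cvgB => //; exact: cvg_cst.
    rewrite subrr; apply: cvg_trans; apply: near_eq_cvg; exists k.+1 => // n /= kn.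
    by rewrite (cB _ (Vs n) (Vu t It)) cs kn.
apply/cvgrPdist_le => d d0.
have d20 : 0 < d ^+ 2 by rewrite exprn_gt0.
move/cvgrPdist_le : h => /(_ _ d20); apply: filterS => n.
have Vd : V (\sum_(k < n) g k n t *: e k - u t) by apply: VB => //; exact: Vu.
rewrite -NE//= !sub0r !normrN normrX (ger0_norm (N0 _ Vd)).
by rewrite ler_pXn2r ?nnegrE ?N0// ltW.
Qed.

Lemma L2_spaceP u :
  L2_space I V N u <->
  [/\ forall t, I t -> V (u t), forall k, measurable_fun I (fun t => c k (u t)) &
    (\int[@lebesgue_measure R]_(t in I) wsum w (fun k => c k (u t)) < +oo)%E].
Proof.
have [_ _ _ _ _ _ _ NE] := M.
have E1 : (forall t, I t -> V (u t)) -> L2_sqint I N u =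
    (\int[@lebesgue_measure R]_(t in I) wsum w (fun k => c k (u t)))%E.
  by move=> Vu; apply: eq_integral => t; rewrite inE => It; rewrite NE//; exact: Vu.
split=> [[us ul]|[Vu cu ui]].
  have [Vu _] := us; split=> //; first exact: strongly_measurable_coord.
  by rewrite -E1.
by split; [exact: coord_strongly_measurable|rewrite E1].
Qed.

End l2_measurability.

(** * Dual spaces as weighted sequence spaces *)

Section fractional_duals.
Context (R : realType) (H : completeNormedModType R) (ip : {dot H for idfun}).
Variables (lam : nat -> R) (phi : nat -> H).
Hypothesis ipn : forall x, ip x x = `|x| ^+ 2.
Hypothesis basis : hilbert_basis ip phi.
Hypothesis lam0 : forall k, 0 < lam k.
Hypothesis lam_ge : forall k, lam 0%N <= lam k.
Implicit Types (u v w : H) (s : R) (F G : H -> R).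

Local Notation coef := (coef ip phi).
Local Notation proj := (proj phi).
Local Notation dom := (frac_dom ip lam phi).
Local Notation norm := (frac_norm ip lam phi).
Local Notation dual := (frac_dual ip lam phi).
Local Notation dnorm := (dual_norm ip lam phi).
Local Notation lp s := (fun k => lam k `^ s).

Let dom0 s : dom s 0. Proof. exact: frac_dom0. Qed.
Let domZ s a u : dom s u -> dom s (a *: u). Proof. exact: frac_domZ. Qed.
Let domB s u v : dom s u -> dom s v -> dom s (u - v). Proof. exact: frac_domB. Qed.
Let domproj s n a : dom s (proj n a). Proof. exact: frac_dom_proj. Qed.
Let norm0 s u : 0 <= norm s u. Proof. exact: frac_norm_ge0. Qed.
Let normproj s n a :
  norm s (proj n a) ^+ 2 = \sum_(k < n) lam k `^ (2 * s) * a k ^+ 2.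
Proof. exact: frac_norm_proj. Qed.
Let normsqr s u : dom s u -> ((norm s u) ^+ 2)%:E = wsum (lp (2 * s)) (coef u).
Proof. exact: frac_norm_sqr. Qed.
Let normZ s a u : dom s u -> norm s (a *: u) = `|a| * norm s u.
Proof. exact: frac_normZ. Qed.

Lemma frac_dom_phi s k : dom s (phi k).
Proof.
have -> : phi k = proj k.+1 (fun j => (j == k)%:R).
  rewrite /proj big_ord_recr/= eqxx scale1r big1 ?add0r// => i _.
  by rewrite ltn_eqF ?scale0r// ltn_ord.
exact: frac_dom_proj.
Qed.

Lemma linear_on_proj s F n a : linear_on (dom s) F ->
  F (proj n a) = \sum_(k < n) a k * F (phi k).
Proof.
move=> Fl; have d0 := dom0 s.
elim: n => [|n IH].
  rewrite /proj !big_ord0; have := Fl 0 0 0 d0 d0.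
  by rewrite scaler0 addr0 => ->; rewrite scale0r add0r; have := Fl (-1) 0 0 d0 d0; rewrite scaler0 addr0 scaleN1r addNr.
rewrite /proj !big_ord_recr/= addrC Fl ?IH 1?addrC//.
  exact: frac_dom_phi.
exact: frac_dom_proj.
Qed.

Lemma frac_dual_linearB s F u v : dual s F -> dom s u -> dom s v ->
  F (u - v) = F u - F v.
Proof.
by move=> [Fl _] us vs; rewrite addrC -scaleN1r Fl// scaleN1r addrC.
Qed.

(** Projections converge to [u] in [D(A^s)] and [F] is bounded there. Hence a functional is
    determined by its values at the eigenvectors. *)
Lemma frac_dual_cvg s F u : dual s F -> dom s u ->
  (\sum_(k < n) coef u k * F (phi k)) @[n --> \oo] --> F u.
Proof.
move=> Fd us; have [Fl [C FC]] := Fd.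
have nc : norm s (proj n (coef u) - u) @[n --> \oo] --> (0 : R).
  exact: frac_norm_proj_cvg.
have Cc : `|C| * norm s (proj n (coef u) - u) @[n --> \oo] --> (`|C| * 0 : R).
  by apply: cvgM nc; exact: cvg_cst.
rewrite mulr0 in Cc; apply/cvgrPdist_le => e e0.
move/cvgrPdist_le : Cc => /(_ _ e0); apply: filterS => n.
rewrite sub0r normrN ger0_norm; last by rewrite mulr_ge0.
apply: le_trans; rewrite -(linear_on_proj _ _ Fl) distrC -(frac_dual_linearB Fd)//.
apply: le_trans (FC _ _) _; first exact: domB.
by rewrite ler_wpM2r// ler_norm.
Qed.

Lemma dual_has_sup s F : dual s F ->
  has_sup [set `|F v| | v in [set v | dom s v /\ norm s v <= 1]].
Proof.
move=> [Fl [C FC]]; split.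
  exists `|F 0|, 0 => //; split; first exact: dom0.
  have := normZ 0 (dom0 s).
  by rewrite scaler0 normr0 mul0r => ->.
exists `|C| => _ [v [vs v1] <-].
apply: le_trans (FC v vs) _; apply: le_trans (ler_norm _) _.
by rewrite normrM (ger0_norm (norm0 s v)) ler_piMr.
Qed.

Lemma dual_norm_ge0 s F : dual s F -> 0 <= dnorm s F.
Proof.
move=> Fd; have [[y [v vs e]] ub] := dual_has_sup Fd.
by apply: (@le_trans _ _ y); [rewrite -e|apply: ub_le_sup => //; exists v].
Qed.

Lemma dual_norm_bound s F v : dual s F -> dom s v -> `|F v| <= dnorm s F * norm s v.
Proof.
move=> Fd vs; have [_ ub] := dual_has_sup Fd; have [Fl [C FC]] := Fd.
(* A vector of norm 0 cannot be normalised; there the boundedness of [F] gives [F v = 0]. *)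
have := norm0 s v; rewrite le_eqVlt => /predU1P[n0|n0].
  by rewrite -n0 mulr0; have := FC v vs; rewrite -n0 mulr0.
have Fz : F ((norm s v)^-1 *: v) = (norm s v)^-1 * F v.
  have d0 := dom0 s.
  rewrite -[X in F X]addr0 Fl//.
  have := Fl (-1) 0 0 d0 d0; rewrite scaler0 addr0 scaleN1r addNr => ->.
  by rewrite addr0.
have ni0 : 0 <= (norm s v)^-1 by rewrite invr_ge0 ltW.
rewrite -ler_pdivrMr// mulrC -(ger0_norm ni0) -normrM -Fz; apply: ub_le_sup => //; eexists; last reflexivity.
split; first exact: domZ.
by rewrite normZ// ger0_norm// mulVf// gt_eqF.
Qed.

(** One inequality is [wsum_inv_le], tested on finite combinations of eigenvectors; the other is
    Cauchy-Schwarz for the partial sums of [F v], followed by the limit. *)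
Lemma dual_norm_sqr s F : dual s F ->
  ((dnorm s F) ^+ 2)%:E = wsum (lp (- (2 * s))) (fun k => F (phi k)).
Proof.
move=> Fd; have [Fl [C FC]] := Fd; have [ne ub] := dual_has_sup Fd.
have w0 k : 0 < lam k `^ (2 * s) by exact: powR_gt0.
have wE : wsum (lp (- (2 * s))) (fun k => F (phi k)) =
    wsum (fun k => (lam k `^ (2 * s))^-1) (fun k => F (phi k)).
  by apply: eq_eseriesr => k _; rewrite powRN.
have vi0 k : 0 <= (lam k `^ (2 * s))^-1 by rewrite invr_ge0 ltW.
have dn0 := dual_norm_ge0 Fd.
have le1 : (wsum (lp (- (2 * s))) (fun k => F (phi k)) <= ((dnorm s F) ^+ 2)%:E)%E.
  rewrite wE; apply: wsum_inv_le => // n v.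
  rewrite -(linear_on_proj _ _ Fl) -normproj -exprMn.
  rewrite -(real_normK (num_real (F _))) ler_pXn2r ?nnegrE ?mulr_ge0//.
  exact: dual_norm_bound.
apply/eqP; rewrite eq_le le1 andbT.
have Wfin : (wsum (lp (- (2 * s))) (fun k => F (phi k)) \is a fin_num)%E.
  rewrite ge0_fin_numE ?wsum_ge0//; last by move=> k; exact: lp_ge0.
  by apply: le_lt_trans le1 (ltry _).
rewrite -(fineK Wfin) lee_fin; set W := fine _.
have W0 : 0 <= W by rewrite fine_ge0// wsum_ge0// => k; exact: lp_ge0.
rewrite -(sqr_sqrtr W0) ler_pXn2r ?nnegrE ?sqrtr_ge0//.
apply: ge_sup => // _ [v [vs v1] <-].
have Fc := frac_dual_cvg Fd vs.
have sq : (\sum_(k < n) coef v k * F (phi k)) ^+ 2 @[n --> \oo] --> F v ^+ 2.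
  by apply: cvgM.
have : F v ^+ 2 <= W.
  rewrite -(cvg_lim (@Rhausdorff R) sq); apply: limr_le.
    by apply/cvg_ex; eexists; exact: sq.
  apply: nearW => n.
  apply: le_trans (@sum_cauchy_schwarz R (lp (2 * s)) (coef v) (fun k => F (phi k)) n w0) _.
  have h1 : \sum_(k < n) lam k `^ (2 * s) * coef v k ^+ 2 <= 1.
    apply: (@le_trans _ _ (norm s v ^+ 2)); last by rewrite expr_le1.
    rewrite -lee_fin normsqr//; apply: wsum_partial_le => k; exact: lp_ge0.
  have h2 : \sum_(k < n) (lam k `^ (2 * s))^-1 * F (phi k) ^+ 2 <= W.
    rewrite -lee_fin fineK// wE.
    exact: (wsum_partial_le vi0).
  rewrite (le_trans _ h2)// ler_piMl// sumr_ge0// => k _.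
  by rewrite mulr_ge0 ?sqr_ge0.
move=> FW; rewrite -(ler_pXn2r (n := 2)) ?nnegrE ?sqrtr_ge0// sqr_sqrtr//.
by rewrite real_normK// num_real.
Qed.

Lemma frac_dualP s (a : R) F G : dual s F -> dual s G -> dual s (a *: F + G).
Proof.
move=> [Fl [C FC]] [Gl [C' GC]]; split.
  move=> b u v us vs; rewrite !fctE/= Fl// Gl// /GRing.scale/=; ring.
exists (`|a| * C + C') => v vs; rewrite !fctE/=.
apply: le_trans (ler_normD _ _) _; rewrite mulrDl lerD ?GC//.
by rewrite /GRing.scale/= normrM -mulrA ler_wpM2l// FC.
Qed.

Lemma frac_dual0 s : dual s 0.
Proof.
split; first by move=> a u v _ _; rewrite /= /GRing.zero/= scaler0 addr0.
by exists 0 => v _; rewrite /= normr0 mul0r.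
Qed.

Lemma frac_dual_pivot s u : 0 <= s -> dual s (pivot ip u).
Proof.
move=> s0; split.
  by move=> a v w _ _; rewrite /pivot (ipDr ip) (ipZr ip).
exists (`|u| * lam 0%N `^ (- s)) => v vs.
apply: le_trans (ip_cauchy_schwarz ipn _ _) _.
by rewrite -mulrA ler_wpM2l//; exact: (norm_le_frac ipn basis).
Qed.

End fractional_duals.

(** The extended operators are defined as limits along a filter, so convergence has to be
    established first. The Cauchy property supplies it, and any one sequence running into the filter
    then computes the value. *)
Lemma cauchy_lim (R : realType) (I : Type) (F : set_system I) {FF : ProperFilter F}
    (p : nat -> I) (G : I -> R) : p @ \oo --> F ->
  (forall e, 0 < e -> exists2 U, F U & forall z z', U z -> U z' -> `|G z - G z'| < e) ->
  G (p n) @[n --> \oo] --> lim (G @ F).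
Proof.
move=> pF cG.
suff /cauchy_cvgP/cvg_ex [l Gl] : cauchy (G @ F).
  rewrite (cvg_lim (@Rhausdorff R) Gl).
  by apply: (@cvg_comp _ _ _ p G _ _ _ pF Gl).
apply/cauchy_ballP => e e0; have [U FU h] := cG e e0.
exists (G @` U, G @` U) => /=.
  have GU : F (G @^-1` (G @` U)) by apply: filterS FU => z Uz; exists z.
  by split; exact: GU.
by move=> [a b] /= [[z Uz <-] [z' Uz' <-]]; exact: h.
Qed.

Lemma small_factor (R : realFieldType) (M e : R) : 0 <= M -> 0 < e ->
  exists2 d, 0 < d & M * d < e.
Proof.
move=> M0 e0; have M1 : 0 < M + 1 by rewrite ltr_wpDl.
exists (e / (M + 1)); first exact: divr_gt0.
by rewrite mulrA ltr_pdivrMr// mulrC ltr_pM2l// ltrDl.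
Qed.

(** * Extensions by continuity, computed along spectral projections *)

Section extensions.
Context (R : realType) (H : completeNormedModType R) (ip : {dot H for idfun}).
Variables (lam : nat -> R) (phi : nat -> H).
Hypothesis ipn : forall x, ip x x = `|x| ^+ 2.
Hypothesis basis : hilbert_basis ip phi.
Hypothesis lam0 : forall k, 0 < lam k.
Hypothesis lam_ge : forall k, lam 0%N <= lam k.
Variable D : set H.
Hypothesis Dsub : subspace D.
Hypothesis Dphi : forall k, D (phi k).
Implicit Types (u v w : H) (s : R).

Local Notation coef := (coef ip phi).
Local Notation proj := (proj phi).
Local Notation dom := (frac_dom ip lam phi).
Local Notation norm := (frac_norm ip lam phi).
Local Notation dual := (frac_dual ip lam phi).
Local Notation pr n u := (proj n (coef u)).

Let domB s u v : dom s u -> dom s v -> dom s (u - v). Proof. exact: frac_domB. Qed.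
Let norm0 s u : 0 <= norm s u. Proof. exact: frac_norm_ge0. Qed.
Let normD s u v : dom s u -> dom s v -> norm s (u + v) <= norm s u + norm s v.
Proof. exact: frac_normD. Qed.
Let normB s u v : dom s u -> dom s v -> norm s (u - v) <= norm s u + norm s v.
Proof. exact: frac_normB. Qed.

Lemma subspaceB (V : set H) u v : subspace V -> V u -> V v -> V (u - v).
Proof. by move=> [_ VP] Vu Vv; rewrite addrC -scaleN1r; exact: VP. Qed.

Lemma subspace_proj n a : D (proj n a).
Proof.
case: Dsub => D0 DP;
elim: n => [|n IH]; first by rewrite /proj big_ord0.
by rewrite /proj big_ord_recr/= addrC; exact: DP.
Qed.

Lemma proj_linear n a u v : pr n (a *: u + v) = a *: pr n u + pr n v.
Proof.
rewrite /proj scaler_sumr -big_split/=; apply: eq_bigr => k _.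
by rewrite coefP scalerDl scalerA.
Qed.

Lemma linear_onB (W : lmodType R) (V : set H) (L : H -> W) u v :
  linear_on V L -> V u -> V v -> L (u - v) = L u - L v.
Proof.
by move=> VL Vu Vv; have := VL (-1) v u Vv Vu; rewrite !scaleN1r ![- _ + _]addrC.
Qed.

Lemma nbhs_in_proj s u : dom s u -> (fun n => pr n u) @ \oo --> nbhs_in ip lam phi D s u.
Proof.
move=> su U [e /= e0 eU].
have /cvgrPdist_lt/(_ e e0) := frac_norm_proj_cvg ipn basis lam0 su.
apply: filterS => n; rewrite sub0r normrN ger0_norm// => h.
by apply: eU; split => //; exact: subspace_proj.
Qed.

(** Projections of [u] lie in [D] and come arbitrarily close to [u], so no set of the filter is
    empty. *)
Lemma nbhs_in_proper s u : dom s u -> ProperFilter (nbhs_in ip lam phi D s u).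
Proof.
move=> su; apply: filter_from_proper; last first.
  move=> e /= e0.
  have [n _ /(_ _ (leqnn n)) h] := nbhs_in_proj su (ex_intro2 _ _ e e0 (fun x => id)).
  by exists (pr n u).
apply: filter_from_filter; first by exists 1 => /=.
move=> i j /= i0 j0; exists (Num.min i j); first by rewrite /= lt_min i0.
by move=> x [Dx]; rewrite lt_min => /andP[? ?].
Qed.

(** On [D] the functional is Lipschitz for [norm s], hence Cauchy along the filter. *)
Lemma ext_op_cvg s (L : H -> H) u v (M : R) : D `<=` dom s -> dom s u ->
  linear_on D L -> 0 <= M -> (forall x, D x -> `|ip (L x) v| <= M * norm s x) ->
  ip (L (pr n u)) v @[n --> \oo] --> ext_op ip lam phi D s L u v.
Proof.
move=> Ds su LL M0 Lb; have FF := nbhs_in_proper su.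
apply: (@cauchy_lim _ _ _ _ _ (fun x => ip (L x) v)); first exact: nbhs_in_proj.
have M2 : 0 <= 2 * M by rewrite mulr_ge0.
move=> e e0; have [d d0 dM] := small_factor M2 e0.
exists [set x | D x /\ norm s (x - u) < d]; first by exists d.
move=> z z' [Dz zu] [Dz' zu'].
rewrite -(ipBl ip) -(linear_onB LL)//.
apply: (le_lt_trans (Lb _ (subspaceB Dsub Dz Dz'))); apply: le_lt_trans dM.
rewrite mulrAC mulrC ler_wpM2r//.
rewrite (_ : z - z' = (z - u) - (z' - u)); last by rewrite opprB addrA subrK.
apply: (le_trans (normB (domB (Ds _ Dz) su) (domB (Ds _ Dz') su))).
by move: zu zu'; lra.
Qed.

Lemma ext_bilin_cvg s1 s2 (B : H -> H -> H) u w v (M : R) :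
  D `<=` dom s1 -> D `<=` dom s2 -> dom s1 u -> dom s2 w ->
  bilinear_on D B -> 0 <= M ->
  (forall x y, D x -> D y -> `|ip (B x y) v| <= M * norm s1 x * norm s2 y) ->
  ip (B (pr n u) (pr n w)) v @[n --> \oo] --> ext_bilin ip lam phi D s1 s2 B u w v.
Proof.
move=> D1 D2 su sw [BL BR] M0 Bb.
have FF := nbhs_in_proper su; have GG := nbhs_in_proper sw.
apply: (@cauchy_lim _ _ _ _ (fun n => (pr n u, pr n w)) (fun z => ip (B z.1 z.2) v)).
  by have h := cvg_pair (nbhs_in_proj su) (nbhs_in_proj sw); exact: h.
(* The sum of [norm s1 u + 1] and [norm s2 w + 1]: within distance 1 of [u] and [w], these bound the
   factor that is not a difference in each of the two terms below. *)
pose K := norm s1 u + norm s2 w + 2.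
have K0 : 0 <= K by rewrite !addr_ge0.
have M2 : 0 <= 2 * M * K by rewrite !mulr_ge0.
move=> e e0; have [d d0 dM] := small_factor M2 e0.
pose r := Num.min d 1.
have r0 : 0 < r by rewrite lt_min d0 ltr01.
have [rd r1] : r <= d /\ r <= 1 by rewrite /r !ge_min !lexx orbT.
exists ([set x | D x /\ norm s1 (x - u) < r] `*` [set x | D x /\ norm s2 (x - w) < r]).
  by exists ([set x | D x /\ norm s1 (x - u) < r], [set x | D x /\ norm s2 (x - w) < r]) => //=;
    split; exists r.
move=> [x y] [x' y'] /= [[/= Dx xu] [/= Dy yw]] [[/= Dx' xu'] [/= Dy' yw']].
have -> : ip (B x y) v - ip (B x' y') v = ip (B (x - x') y) v + ip (B x' (y - y')) v.
  rewrite (linear_onB (BL _ Dy))// (linear_onB (BR _ Dx'))// !(ipBl ip).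
  by rewrite addrA subrK.
apply: (le_lt_trans (ler_normD _ _)).
have dist s z z' t : dom s t -> dom s z -> dom s z' -> norm s (z - t) < r -> norm s (z' - t) < r ->
    norm s (z - z') <= 2 * r.
  move=> st sz sz' zt zt'.
  rewrite (_ : z - z' = (z - t) - (z' - t)); last by rewrite opprB addrA subrK.
  by apply: (le_trans (normB (domB sz st) (domB sz' st))); move: zt zt'; lra.
have near s z t : dom s t -> dom s z -> norm s (z - t) < r -> norm s z <= norm s t + 1.
  move=> st sz zt; rewrite -[z in leLHS](subrK t).
  by apply: (le_trans (normD (domB sz st) st)); move: zt r1; lra.
have b1 : `|ip (B (x - x') y) v| <= M * (2 * r) * (norm s2 w + 1).
  apply: (le_trans (Bb _ _ (subspaceB Dsub Dx Dx') Dy)).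
  apply: ler_pM => //; first by rewrite mulr_ge0.
    by rewrite ler_wpM2l//; apply: (dist _ _ _ u) => //; exact: D1.
  by apply: near => //; exact: D2.
have b2 : `|ip (B x' (y - y')) v| <= M * (norm s1 u + 1) * (2 * r).
  apply: (le_trans (Bb _ _ Dx' (subspaceB Dsub Dy Dy'))).
  apply: ler_pM => //; first by rewrite mulr_ge0.
    by rewrite ler_wpM2l//; apply: near => //; exact: D1.
  by apply: (dist _ _ _ w) => //; exact: D2.
apply: (le_lt_trans (lerD b1 b2)); apply: le_lt_trans dM.
rewrite (_ : _ + _ = 2 * M * K * r); last by rewrite /K; ring.
by rewrite ler_wpM2l// !mulr_ge0.
Qed.

End extensions.

Lemma powR_interpolation (R : realType) (s eps : R) : 0 < s <= 1 -> 0 < eps ->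
  exists2 K, 0 <= K & forall a, 0 < a -> a <= eps * a `^ (1 + s) + K * a `^ s.
Proof.
(* The threshold where [eps * a^s = 1]: above it the first term alone dominates [a]; below it
   [a = a^(1 - s) a^s <= M^(1 - s) a^s], by [s <= 1]. *)
move=> /andP[s0 s1] e0; pose M := eps `^ (- s^-1).
have M0 : 0 < M by exact: powR_gt0.
exists (M `^ (1 - s)); first exact: powR_ge0.
move=> a a0; have as0 : 0 < a `^ s by exact: powR_gt0.
have [aM|Ma] := leP a M.
  rewrite -[leLHS]add0r lerD//; first by rewrite mulr_ge0 ?powR_ge0// ltW.
  rewrite -[leLHS](powRr1 (ltW a0)) -[X in a `^ X](subrK s) powRD; last first.
    by rewrite (gt_eqF a0) implybT.
  apply: ler_wpM2r; first exact: ltW.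
  by apply: ge0_ler_powR; rewrite ?nnegrE ?subr_ge0// ltW.
rewrite -[leLHS]addr0 lerD//; last by rewrite mulr_ge0 ?powR_ge0.
rewrite powRD; last by rewrite (gt_eqF a0) implybT.
rewrite (powRr1 (ltW a0)) mulrCA ler_peMr//; first exact: ltW.
have : M `^ s <= a `^ s by apply: ge0_ler_powR; rewrite ?nnegrE// ltW.
rewrite /M -powRrM mulNr mulVf ?gt_eqF// powR_inv1 ?(ltW e0)// => h.
have : eps * eps^-1 <= eps * a `^ s by rewrite ler_pM2l.
by rewrite mulfV ?gt_eqF.
Qed.

(** * The linear operators on the fractional scale *)

Section linear_part.
Context (R : realType) (H : completeNormedModType R) (ip : {dot H for idfun}).
Variables (D : set H) (A S : H -> H) (B : H -> H -> H).
Variables (lam : nat -> R) (phi : nat -> H) (sigma : R).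
Hypothesis SA : structural_assumptions ip D A S B lam phi sigma.
Hypothesis sigma01 : 0 <= sigma <= 1.
Implicit Types (u v w : H) (s : R).

Local Notation coef := (coef ip phi).
Local Notation proj := (proj phi).
Local Notation dom := (frac_dom ip lam phi).
Local Notation norm := (frac_norm ip lam phi).
Local Notation dual := (frac_dual ip lam phi).
Local Notation pr n u := (proj n (coef u)).
Local Notation s1 := ((1 + sigma) / 2).
Local Notation s0 := (sigma / 2).
Local Notation sm := ((1 - sigma) / 2).

Let ipn : forall x, ip x x = `|x| ^+ 2. Proof. exact: sa_norm SA. Qed.
Let basis : hilbert_basis ip phi. Proof. exact: sa_basis SA. Qed.
Let lam0 : forall k, 0 < lam k. Proof. exact: sa_eigen_pos SA. Qed.
Let Dsub : subspace D. Proof. exact: sa_dom SA. Qed.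

Lemma eigen_ge k : lam 0%N <= lam k.
Proof.
by elim: k => // k IH; exact: le_trans IH (sa_eigen_mono SA k).
Qed.

Lemma dom_phi k : D (phi k).
Proof. by case: (sa_eigenvector SA k). Qed.

Lemma s1_le1 : s1 <= 1. Proof. by move: sigma01; lra. Qed.
Lemma sm_ge0 : 0 <= sm. Proof. by move: sigma01; lra. Qed.
Lemma s0_le_s1 : s0 <= s1. Proof. by lra. Qed.
Lemma s0_ge0 : 0 <= s0. Proof. by move: sigma01; lra. Qed.
Lemma s1_ge0 : 0 <= s1. Proof. by move: sigma01; lra. Qed.

Let norm0 s u : 0 <= norm s u. Proof. exact: frac_norm_ge0. Qed.

(** By self-adjointness the pair of [phi k] and [lam k *: phi k] lies in the graph of the adjoint,
    so [A] is diagonal on all of [D]. *)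
Lemma coef_A x k : D x -> coef (A x) k = lam k * coef x k.
Proof.
move=> Dx; have [_ /(_ (phi k) (lam k *: phi k)) [h _]] := sa_A_self_adjoint SA.
have := h (sa_eigenvector SA k) x Dx; rewrite ipZr; exact.
Qed.

(** Parseval's identity for [A x] gives the case [s = 1]; smaller exponents follow by monotonicity
    of the scale. *)
Lemma dom_sub s : s <= 1 -> D `<=` dom s.
Proof.
move=> s1 x Dx; apply: (frac_dom_mono lam0 eigen_ge s1).
have h := ltry (`|A x| ^+ 2); rewrite -(parseval ipn basis) in h.
rewrite frac_domE; apply: le_lt_trans h; rewrite le_eqVlt; apply/orP; left.
rewrite -(wsum_lp lam0); apply/eqP/eq_wsum => k.
by rewrite coef_A// powRr1// ltW.
Qed.

Lemma ip_coef_cvg u v : \sum_(k < n) coef u k * coef v k @[n --> \oo] --> ip u v.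
Proof.
rewrite (_ : (fun n => _) = (fun n => ip (pr n u) v)); last first.
  by apply/funext => n; rewrite ip_proj.
by apply: cvg_ip => //; exact: proj_coef_cvg.
Qed.

Lemma A_bound x v : D x -> dom sm v -> `|ip (A x) v| <= norm s1 x * norm sm v.
Proof.
move=> Dx vm; apply: (frac_pairing_le ipn basis lam0 (c := coef (A x))) => //.
- exact: (dom_sub s1_le1).
- by move=> k; rewrite coef_A// (_ : s1 + sm = 1) ?powRr1//; [exact: ltW|lra].
- exact: ip_coef_cvg.
Qed.

Lemma S_half_bound : exists2 C, 0 <= C & forall x, D x -> `|S x| <= C * norm (1 / 2) x.
Proof.
have [C Cb] := sa_S_bounded SA; exists `|C| => // x Dx.
by rewrite (le_trans (Cb _ Dx))// ler_wpM2r// ler_norm.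
Qed.

(* For sigma = 0 this rests on skew symmetry, which moves S to v, and for
   sigma > 0 on interpolation of lam between its powers sigma and 1 + sigma. *)
Lemma S_bound eps : 0 < eps -> exists2 K, 0 <= K & forall u v, D u -> dom sm v ->
  ip (S u) v ^+ 2 <= (eps * norm s1 u ^+ 2 + K * norm s0 u ^+ 2) * norm sm v ^+ 2.
Proof.
move=> e0; have [C C0 Cb] := S_half_bound.
have half : 1 / 2 <= 1 :> R by lra.
have [sg|sg] := eqVneq sigma 0.
  exists (C ^+ 2); first by rewrite exprn_ge0.
  move=> u v Du vm.
  rewrite (_ : norm s0 u = `|u|); last first.
    by rewrite (_ : s0 = 0) ?sg ?mul0r//; have [_ ->] := norm_frac0 ipn basis lam0 u.
  apply: (@le_trans _ _ (C ^+ 2 * `|u| ^+ 2 * norm sm v ^+ 2)); last first.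
    by rewrite ler_wpM2r ?exprn_ge0// lerDr mulr_ge0 ?exprn_ge0// ltW.
  suff h : `|ip (S u) v| <= C * `|u| * norm sm v.
    rewrite -real_normK ?num_real// -!exprMn ler_pXn2r// nnegrE// !mulr_ge0//.
  (* Here [sm = 1/2] and [v] need not lie in [D]: skew symmetry is applied to the projections of
     [v], and the bound passes to the limit. *)
  have c : `|ip (S u) (pr n v)| @[n --> \oo] --> `|ip (S u) v|.
    apply: cvg_norm; rewrite (ipC ip) (_ : (fun n => _) = (fun n => ip (pr n v) (S u))).
      by apply: cvg_ip => //; exact: proj_coef_cvg.
    by apply/funext => n; rewrite (ipC ip).
  rewrite -(cvg_lim (@Rhausdorff R) c); apply: limr_le; first exact: (cvgP _ c).
  apply: nearW => n; have Dv : D (pr n v) by exact: (subspace_proj Dsub dom_phi).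
  rewrite (sa_S_skew SA)// normrN (le_trans (ip_cauchy_schwarz ipn _ _))//.
  rewrite mulrAC mulrC ler_wpM2r//.
  have smE : sm = 1 / 2 by rewrite sg subr0.
  rewrite (le_trans (Cb _ Dv))// ler_wpM2l// smE.
  by apply: (frac_norm_proj_le ipn basis lam0); rewrite -smE.
have s01 : 0 < sigma <= 1 by move: sigma01 => /andP[h ->]; rewrite lt_neqAle eq_sym sg h.
pose c := lam 0%N `^ (- sm).
have c0 : 0 < c by exact: powR_gt0.
pose M := (C * c) ^+ 2.
have M0 : 0 <= M by rewrite exprn_ge0// mulr_ge0// ltW.
(* This makes [M] times the interpolation constant at most [eps]; the added 1 covers [M = 0]. *)
have eM : 0 < eps / (M + 1) by rewrite divr_gt0// ltr_wpDl.
have [K K0 Kb] := powR_interpolation s01 eM.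
exists (M * K); first by rewrite mulr_ge0.
move=> u v Du vm.
have hu := dom_sub half Du; have hu1 := dom_sub s1_le1 Du.
have hu0 := frac_dom_mono lam0 eigen_ge s0_le_s1 hu1.
(* Eigenvalue by eigenvalue, the weight [lam] is split between [lam^(1 + sigma)] and [lam^sigma]. *)
have interp : norm (1 / 2) u ^+ 2 <= eps / (M + 1) * norm s1 u ^+ 2 + K * norm s0 u ^+ 2.
  rewrite -lee_fin EFinD (EFinM (eps / _)) (EFinM K) !(frac_norm_sqr ipn basis lam0)//.
  rewrite -wsum_weightsZ; last by move=> k; exact: powR_ge0.
  rewrite -wsum_weightsD//; last 2 first.
  - by move=> k; rewrite mulr_ge0 ?powR_ge0// ltW.
  - by move=> k; exact: powR_ge0.
  rewrite -[leRHS]mul1e; apply: wsum_weights_le => k.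
  - exact: powR_ge0.
  - by rewrite addr_ge0// mulr_ge0 ?powR_ge0// ltW.
  - rewrite [leRHS]mul1r (_ : 2 * (1 / 2) = 1); last by lra.
    rewrite (_ : 2 * s1 = 1 + sigma); last by lra.
    rewrite (_ : 2 * s0 = sigma); last by lra.
    by rewrite powRr1 ?(ltW (lam0 k))//; exact: Kb.
have vn : `|v| <= c * norm sm v by apply: norm_le_frac => //; [exact: eigen_ge|exact: sm_ge0].
have h : `|ip (S u) v| <= C * norm (1 / 2) u * (c * norm sm v).
  rewrite (le_trans (ip_cauchy_schwarz ipn _ _))//.
  by apply: ler_pM => //; exact: Cb.
rewrite -real_normK ?num_real//.
apply: (@le_trans _ _ ((C * norm (1 / 2) u * (c * norm sm v)) ^+ 2)).
  by rewrite ler_pXn2r// nnegrE// ?mulr_ge0// ltW.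
rewrite (_ : _ ^+ 2 = M * norm (1 / 2) u ^+ 2 * norm sm v ^+ 2); last by rewrite /M; ring.
rewrite ler_wpM2r ?exprn_ge0//.
apply: (@le_trans _ _ (M * (eps / (M + 1) * norm s1 u ^+ 2 + K * norm s0 u ^+ 2))).
  by rewrite ler_wpM2l.
rewrite mulrDr (mulrA M K) lerD2r (mulrA M) ler_wpM2r ?exprn_ge0// mulrA.
rewrite ler_pdivrMr ?ltr_wpDl// mulrC ler_pM2l// lerDl//.
Qed.

End linear_part.

Lemma cvg_norm_le (R : realType) (a : nat -> R) (l b : R) :
  a @ \oo --> l -> (forall n, `|a n| <= b) -> `|l| <= b.
Proof.
move=> al ab; have c : `|a n| @[n --> \oo] --> `|l| by exact: cvg_norm.
by rewrite -(cvg_lim (@Rhausdorff R) c); apply: limr_le; [exact: (cvgP _ c)|exact: nearW].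
Qed.

Lemma cvg_linear_eq (R : realType) (a b c : nat -> R) (k l m q : R) :
  a @ \oo --> l -> b @ \oo --> m -> c @ \oo --> q ->
  (forall n, c n = k * a n + b n) -> q = k * l + m.
Proof.
move=> al bm cq cE; rewrite -(cvg_lim (@Rhausdorff R) cq).
rewrite (_ : c = fun n => k * a n + b n); last exact/funext.
by apply: (cvg_lim (@Rhausdorff R)); apply: cvgD => //; apply: cvgMr.
Qed.

Lemma linear_on_sum (R : realType) (H : completeNormedModType R) (W : lmodType R)
    (V : set H) (phi : nat -> H) (L : H -> W) n a : subspace V ->
  (forall k, V (phi k)) -> linear_on V L ->
  L (proj phi n a) = \sum_(k < n) a k *: L (phi k).
Proof.
move=> Vs Vphi VL; have [V0 _] := Vs.
elim: n => [|n IH].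
  by rewrite /proj !big_ord0; have := linear_onB VL V0 V0; rewrite !subrr.
rewrite big_ord_recr/= -IH addrC.
have := VL (a n) (phi n) (proj phi n a) (Vphi n) (subspace_proj Vs Vphi n a).
by rewrite /proj big_ord_recr/= addrC => ->.
Qed.

(** * The nonlinear term in coordinates and its Lipschitz estimate *)

Section nonlinearity.
Context (R : realType) (H : completeNormedModType R) (ip : {dot H for idfun}).
Variables (D : set H) (A S : H -> H) (B : H -> H -> H).
Variables (lam : nat -> R) (phi : nat -> H) (sigma : R).
Hypothesis SA : structural_assumptions ip D A S B lam phi sigma.
Hypothesis sigma01 : 0 <= sigma <= 1.
Implicit Types (u v w : H) (s : R).

Local Notation coef := (coef ip phi).
Local Notation proj := (proj phi).
Local Notation dom := (frac_dom ip lam phi).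
Local Notation norm := (frac_norm ip lam phi).
Local Notation dual := (frac_dual ip lam phi).
Local Notation pr n u := (proj n (coef u)).
Local Notation s1 := ((1 + sigma) / 2).
Local Notation s0 := (sigma / 2).
Local Notation sm := ((1 - sigma) / 2).
Local Notation extAS := (ext_op ip lam phi D s1 (fun x => A x + S x)).
Local Notation extS := (ext_op ip lam phi D s1 S).
Local Notation extB := (ext_bilin ip lam phi D ((sigma + 1) / 2) s0 B).
Local Notation w0 := (fun k => (lam k `^ (2 * s0))%R).
Local Notation w1 := (fun k => (lam k `^ (2 * s1))%R).
Local Notation wm := (fun k => (lam k `^ (- (2 * sm)))%R).

Let ipn : forall x, ip x x = `|x| ^+ 2. Proof. exact: sa_norm SA. Qed.
Let basis : hilbert_basis ip phi. Proof. exact: sa_basis SA. Qed.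
Let lam0 : forall k, 0 < lam k. Proof. exact: sa_eigen_pos SA. Qed.
Let lam_ge : forall k, lam 0%N <= lam k. Proof. exact: eigen_ge SA. Qed.
Let Dsub : subspace D. Proof. exact: sa_dom SA. Qed.
Let Dphi k : D (phi k). Proof. exact: dom_phi SA k. Qed.
Let Dpr n a : D (proj n a). Proof. exact: subspace_proj. Qed.
Let domP s a u v : dom s u -> dom s v -> dom s (a *: u + v).
Proof. exact: frac_domP. Qed.
Let domB s u v : dom s u -> dom s v -> dom s (u - v). Proof. exact: frac_domB. Qed.
Let domphi s k : dom s (phi k). Proof. exact: frac_dom_phi. Qed.
Let norm0 s u : 0 <= norm s u. Proof. exact: frac_norm_ge0. Qed.
Let normproj s u n : dom s u -> norm s (pr n u) <= norm s u.
Proof. exact: frac_norm_proj_le. Qed.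
Let D1 : D `<=` dom s1. Proof. exact: (dom_sub SA (s1_le1 sigma01)). Qed.
Let D0 : D `<=` dom s0. Proof. by apply: (dom_sub SA); move: sigma01; lra. Qed.
Let s1E : (sigma + 1) / 2 = s1. Proof. by rewrite addrC. Qed.
Let dom10 u : dom s1 u -> dom s0 u.
Proof. exact: (frac_dom_mono lam0 lam_ge (s0_le_s1 sigma)). Qed.

(** [S_bound] with [eps = 1], its weak norm being absorbed by the strong one. This crude form is
    what the extension of [S] by continuity needs. *)
Lemma S_simple_bound : exists2 M, 0 <= M & forall u v, D u -> dom sm v ->
  `|ip (S u) v| <= M * norm sm v * norm s1 u.
Proof.
have [K K0 Kb] := S_bound SA sigma01 (ltr01 : 0 < 1 :> R).
pose c := lam 0%N `^ (s0 - s1).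
have c0 : 0 <= c by exact: powR_ge0.
have M0 : 0 <= 1 + K * c ^+ 2 by rewrite addr_ge0// mulr_ge0// exprn_ge0.
exists (Num.sqrt (1 + K * c ^+ 2)); first exact: sqrtr_ge0.
move=> u v Du vm.
rewrite -(@ler_pXn2r _ 2)// ?nnegrE ?mulr_ge0 ?sqrtr_ge0//.
rewrite real_normK ?num_real// (le_trans (Kb _ _ Du vm))//.
rewrite !exprMn sqr_sqrtr// mulrAC ler_wpM2r ?exprn_ge0//.
rewrite [leRHS]mulrDl lerD2l -mulrA -exprMn ler_wpM2l//.
rewrite ler_pXn2r ?nnegrE ?mulr_ge0//.
by apply: (frac_norm_mono ipn basis lam0 lam_ge (s0_le_s1 sigma)); exact: D1.
Qed.

Lemma extS_cvg u v : dom s1 u -> dom sm v ->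
  ip (S (pr n u)) v @[n --> \oo] --> extS u v.
Proof.
move=> u1 vm; have [M M0 Mb] := S_simple_bound.
apply: (ext_op_cvg ipn basis lam0 Dsub Dphi (M := M * norm sm v)) => //.
- exact: sa_S_linear SA.
- by rewrite mulr_ge0.
- by move=> x Dx; exact: Mb.
Qed.

Lemma AS_linear : linear_on D (fun x => A x + S x).
Proof.
move=> a x y Dx Dy; rewrite (sa_A_linear SA)// (sa_S_linear SA)//.
by rewrite scalerDr addrACA.
Qed.

Lemma AS_bound : exists2 M, 0 <= M & forall u v, D u -> dom sm v ->
  `|ip (A u + S u) v| <= M * norm sm v * norm s1 u.
Proof.
have [M M0 Mb] := S_simple_bound; exists (1 + M); first by rewrite addr_ge0.
move=> u v Du vm; rewrite (ipDl ip) (le_trans (ler_normD _ _))//.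
rewrite mulrDl mul1r mulrDl lerD//; last exact: Mb.
by rewrite mulrC; exact: (A_bound SA).
Qed.

Lemma extAS_cvg u v : dom s1 u -> dom sm v ->
  ip (A (pr n u) + S (pr n u)) v @[n --> \oo] --> extAS u v.
Proof.
move=> u1 vm; have [M M0 Mb] := AS_bound.
apply: (ext_op_cvg (L := fun x => A x + S x) ipn basis lam0 Dsub Dphi (M := M * norm sm v)) => //.
- exact: AS_linear.
- by rewrite mulr_ge0.
- by move=> x Dx; exact: Mb.
Qed.

Lemma B_pr_bound : exists2 C, 0 < C & forall x y v, D x -> D y -> dom sm v ->
  `|ip (B x y) v| <= C * norm sm v * norm s1 x * norm s0 y.
Proof.
have [C C0 Cb] := sa_B_bounded SA; exists C => // x y v Dx Dy vm.
apply: (le_trans (Cb _ _ _ Dx Dy vm)); rewrite s1E.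
by rewrite le_eqVlt; apply/orP; left; apply/eqP; ring.
Qed.

Lemma extB_cvg u w v : dom s1 u -> dom s0 w -> dom sm v ->
  ip (B (pr n u) (pr n w)) v @[n --> \oo] --> extB u w v.
Proof.
move=> u1 wz vm; have [C C0 Cb] := B_pr_bound; rewrite s1E.
apply: (ext_bilin_cvg ipn basis lam0 Dsub Dphi (M := C * norm sm v)) => //.
- exact: sa_B_bilinear SA.
- by rewrite mulr_ge0// ltW.
- by move=> x y Dx Dy; exact: Cb.
Qed.

(** At an eigenvector the extension of [A] is multiplication by [lam k]; the diagonal part of the
    system is isolated here, and [extS] is left to the nonlinearity. *)
Lemma extAS_phi u k : dom s1 u -> extAS u (phi k) = lam k * coef u k + extS u (phi k).
Proof.
move=> u1.
apply: (@cvg_linear_eq _ (fun n => coef (pr n u) k) _ _ _ _ _ _ _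
    (extS_cvg u1 (domphi _ _)) (extAS_cvg u1 (domphi _ _))).
  apply: cvg_ip => //; exact: proj_coef_cvg.
by move=> n; rewrite (ipDl ip); congr (_ + _); exact: (coef_A SA).
Qed.

Lemma extAS_dual u : dom s1 u -> dual sm (extAS u).
Proof.
move=> u1; split.
  move=> a v w vm wm.
  apply: (cvg_linear_eq (extAS_cvg u1 vm) (extAS_cvg u1 wm) (extAS_cvg u1 (domP _ vm wm))).
  by move=> n; rewrite (ipDr ip) (ipZr ip).
have [M M0 Mb] := AS_bound; exists (M * norm s1 u) => v vm.
apply: (cvg_norm_le (extAS_cvg u1 vm)) => n.
rewrite (le_trans (Mb _ _ (Dpr _ _) vm))// mulrAC ler_wpM2r// ler_wpM2l//.
exact: normproj.
Qed.

Lemma extS_dual u : dom s1 u -> dual sm (extS u).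
Proof.
move=> u1; split.
  move=> a v w vm wm.
  apply: (cvg_linear_eq (extS_cvg u1 vm) (extS_cvg u1 wm) (extS_cvg u1 (domP _ vm wm))).
  by move=> n; rewrite (ipDr ip) (ipZr ip).
have [M M0 Mb] := S_simple_bound; exists (M * norm s1 u) => v vm.
apply: (cvg_norm_le (extS_cvg u1 vm)) => n.
rewrite (le_trans (Mb _ _ (Dpr _ _) vm))// mulrAC ler_wpM2r// ler_wpM2l//.
exact: normproj.
Qed.

Lemma extS_linear v : dom sm v -> linear_on (dom s1) (extS^~ v).
Proof.
move=> vm a u w u1 w1.
apply: (cvg_linear_eq (extS_cvg u1 vm) (extS_cvg w1 vm) (extS_cvg (domP _ u1 w1) vm)).
by move=> n; rewrite proj_linear (sa_S_linear SA)// (ipDl ip) (ipZl ip).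
Qed.

Lemma extB_bound : exists2 C, 0 < C & forall u w v, dom s1 u -> dom s0 w -> dom sm v ->
  `|extB u w v| <= C * norm s1 u * norm s0 w * norm sm v.
Proof.
have [C C0 Cb] := B_pr_bound; exists C => // u w v u1 wz vm.
apply: (cvg_norm_le (extB_cvg u1 wz vm)) => n.
rewrite (le_trans (Cb _ _ _ (Dpr _ _) (Dpr _ _) vm))//.
rewrite (_ : C * _ * _ * _ = C * norm s1 (pr n u) * norm s0 (pr n w) * norm sm v); last by ring.
rewrite ler_wpM2r//; apply: ler_pM => //; last exact: normproj.
  by rewrite mulr_ge0// ltW.
by rewrite ler_wpM2l ?(ltW C0)//; exact: normproj.
Qed.

Lemma extB_dual u w : dom s1 u -> dom s0 w -> dual sm (extB u w).
Proof.
move=> u1 wz; split.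
  move=> a v z vm zm.
  apply: (cvg_linear_eq (extB_cvg u1 wz vm) (extB_cvg u1 wz zm) (extB_cvg u1 wz (domP _ vm zm))).
  by move=> n; rewrite (ipDr ip) (ipZr ip).
have [C C0 Cb] := extB_bound; exists (C * norm s1 u * norm s0 w) => v vm.
exact: Cb.
Qed.

Lemma extB_linearl w v : dom s0 w -> dom sm v -> linear_on (dom s1) (fun u => extB u w v).
Proof.
move=> wz vm a u z u1 z1; have [BL _] := sa_B_bilinear SA.
apply: (cvg_linear_eq (extB_cvg u1 wz vm) (extB_cvg z1 wz vm) (extB_cvg (domP _ u1 z1) wz vm)).
by move=> n; rewrite proj_linear (BL _ (Dpr _ _))// (ipDl ip) (ipZl ip).
Qed.

Lemma extB_linearr u v : dom s1 u -> dom sm v -> linear_on (dom s0) (fun w => extB u w v).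
Proof.
move=> u1 vm a w z wz zz; have [_ BR] := sa_B_bilinear SA.
apply: (cvg_linear_eq (extB_cvg u1 wz vm) (extB_cvg u1 zz vm) (extB_cvg u1 (domP _ wz zz) vm)).
by move=> n; rewrite proj_linear (BR _ (Dpr _ _))// (ipDl ip) (ipZl ip).
Qed.

Lemma extS_bound eps : 0 < eps -> exists2 K, 0 <= K & forall u v, dom s1 u -> dom sm v ->
  extS u v ^+ 2 <= (eps * norm s1 u ^+ 2 + K * norm s0 u ^+ 2) * norm sm v ^+ 2.
Proof.
move=> e0; have [K K0 Kb] := S_bound SA sigma01 e0; exists K => // u v u1 vm.
have c : ip (S (pr n u)) v ^+ 2 @[n --> \oo] --> extS u v ^+ 2.
  by rewrite expr2; under eq_fun do rewrite expr2; apply: cvgM; exact: extS_cvg.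
rewrite -[leLHS]ger0_norm ?sqr_ge0//; apply: (cvg_norm_le c) => n.
rewrite ger0_norm ?sqr_ge0// (le_trans (Kb _ _ (Dpr _ _) vm))//.
rewrite ler_wpM2r ?exprn_ge0// lerD// ler_wpM2l// ?(ltW e0)//;
  rewrite ler_pXn2r ?nnegrE//; apply: normproj => //; exact: dom10.
Qed.

(** Finite combinations of eigenvectors lie in [D], where [S] and [B] can be evaluated directly. *)
Definition nonlin_approx n (x : nat -> R) k : R :=
  ip (S (proj n x)) (phi k) + ip (B (proj n x) (proj n x)) (phi k).

(* The value 0 where the w1-energy is infinite is junk; the Lipschitz estimate
   below holds there too, its right-hand side being +oo. *)
Definition nonlin (x : nat -> R) k : R :=
  if (wsum w1 x < +oo)%E then limn (fun n => nonlin_approx n x k) else 0.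

Lemma seq_dom s (x : nat -> R) : 0 <= s -> (wsum (fun k => lam k `^ (2 * s))%R x < +oo)%E ->
  coef (fromseq phi x) = x /\ dom s (fromseq phi x).
Proof.
move=> sge xoo.
have E : coef (fromseq phi x) = x.
  apply: coef_fromseq => //.
  apply: (@le_lt_trans _ _ ((lam 0%N `^ (0 - 2 * s))%:E * wsum (fun k => lam k `^ (2 * s))%R x)%E).
    apply: wsum_weights_le => // k; first exact: powR_ge0.
    by rewrite -[leLHS](powRr0 (lam k)); apply: lp_mono => //; rewrite mulr_ge0.
  by rewrite lte_mul_pinfty// ?lee_fin ?powR_ge0.
by split=> //; rewrite frac_domE E.
Qed.

Lemma nonlin_cvg u k : dom s1 u ->
  nonlin_approx n (coef u) k @[n --> \oo] --> extS u (phi k) + extB u u (phi k).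
Proof.
move=> u1; apply: cvgD; first exact: extS_cvg.
by apply: extB_cvg => //; exact: dom10.
Qed.

Lemma nonlinE u k : dom s1 u -> nonlin (coef u) k = extS u (phi k) + extB u u (phi k).
Proof.
move=> u1; have h := u1; rewrite frac_domE in h; rewrite /nonlin h.
exact: (cvg_lim (@Rhausdorff R) (nonlin_cvg u1)).
Qed.

Lemma nonlin0 k : nonlin (fun=> 0) k = 0.
Proof.
have P0 n : proj n (fun=> 0) = 0 by rewrite /proj big1// => i _; rewrite scale0r.
have S0 : S 0 = 0.
  by have := linear_onB (sa_S_linear SA) (Dphi 0) (Dphi 0); rewrite !subrr.
have B0 : B 0 0 = 0.
  have [BL _] := sa_B_bilinear SA.
  have D00 : D 0 by case: Dsub.
  by have := linear_onB (BL _ D00) D00 D00; rewrite !subrr.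
rewrite /nonlin; case: ifP => // _; rewrite (_ : (fun n => _) = fun=> 0).
  exact: (cvg_lim (@Rhausdorff R) (cvg_cst _)).
by apply/funext => n; rewrite /nonlin_approx P0 S0 B0 !(ip0l ip) addr0.
Qed.

(** Each [nonlin_approx n] is a polynomial in finitely many coordinates, and the set of times of
    finite energy is measurable, so the limit cut off to that set is measurable. *)
Lemma nonlin_measurable (x : R -> nat -> R) : (forall k, measurable_fun setT (x ^~ k)) ->
  forall k, measurable_fun setT (fun t => nonlin (x t) k).
Proof.
move=> mx k.
have w1ge j : 0 <= w1 j by exact: powR_ge0.
pose J := [set t | (wsum w1 (x t) < +oo)%E].
have mJ : measurable J.
  rewrite -[X in measurable X]setTI.
  exact: (emeasurable_fun_infty_o measurableT (measurable_wsum w1ge mx)).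
have mN n : measurable_fun setT (fun t => nonlin_approx n (x t) k).
  rewrite (_ : (fun t => _) = (fun t => \sum_(j < n) x t j * ip (S (phi j)) (phi k) +
      \sum_(i < n) \sum_(j < n) x t i * (x t j * ip (B (phi i) (phi j)) (phi k)))).
    apply: measurable_funD.
      by apply: measurable_sum => j; apply: measurable_funM.
    apply: measurable_sum => i; apply: measurable_sum => j.
    by apply: measurable_funM => //; apply: measurable_funM.
  apply/funext => t; rewrite /nonlin_approx; congr (_ + _).
    rewrite (linear_on_sum _ _ Dsub Dphi (sa_S_linear SA)) (ip_suml ip).
    by apply: eq_bigr => j _; rewrite (ipZl ip).
  have [BL BR] := sa_B_bilinear SA.
  rewrite (linear_on_sum n (x t) Dsub Dphi (BL _ (Dpr n (x t)))) (ip_suml ip).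
  apply: eq_bigr => i _.
  rewrite (ipZl ip) (linear_on_sum n (x t) Dsub Dphi (BR _ (Dphi i))) (ip_suml ip) mulr_sumr.
  by apply: eq_bigr => j _; rewrite (ipZl ip).
apply: (@measurable_fun_cvg _ _ _ _ (fun n t => \1_J t * nonlin_approx n (x t) k)).
  by move=> n; apply: measurable_funM => //; exact: measurable_indic.
move=> t _; rewrite indicE /nonlin; case: (pselect (J t)) => Jt.
  have [E u1] := seq_dom (s1_ge0 sigma01) Jt.
  rewrite mem_set// (_ : (wsum _ _ < +oo)%E = true)//.
  under eq_fun do rewrite mul1r.
  by have := @nonlin_cvg (fromseq phi (x t)) k u1; rewrite E => h; rewrite (cvg_lim (@Rhausdorff R) h).
rewrite memNset// (_ : (wsum _ _ < +oo)%E = false); last exact/negP.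
by under eq_fun do rewrite mul0r; exact: cvg_cst.
Qed.

(** By [wsum_inv_le] the difference only has to be tested on finite combinations of eigenvectors.
    There it splits into [S (u - w)], [B[u, u - w]] and [B[u - w, w]], each with its own bound. *)
Lemma nonlin_lipschitz_dom : exists2 C, 0 < C & exists2 K, 0 <= K &
  forall u w, dom s1 u -> dom s1 w ->
  (wsum wm (fun k => nonlin (coef u) k - nonlin (coef w) k)%R <=
    ((1 / 16 + C * norm s0 w ^+ 2) * norm s1 (u - w) ^+ 2 +
     (K + C * norm s1 u ^+ 2) * norm s0 (u - w) ^+ 2)%:E)%E.
Proof.
have [C C0 Cb] := extB_bound.
(* The square of a sum of three terms costs a factor 3, and [3 / 48 = 1 / 16]. *)
have e0 : 0 < 1 / 48 :> R by lra.
have [K K0 Kb] := extS_bound e0.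
exists (3 * C ^+ 2); first by rewrite mulr_gt0// exprn_gt0.
exists (3 * K); first by rewrite mulr_ge0.
move=> u w u1 w1; have d1 := domB u1 w1.
pose F v := (extS u v + extB u u v) - (extS w v + extB w w v).
have FE v : dom sm v -> F v = extS (u - w) v + extB u (u - w) v + extB (u - w) w v.
  move=> vm; rewrite /F.
  rewrite (linear_onB (extS_linear vm) u1 w1).
  rewrite (linear_onB (extB_linearr u1 vm) (dom10 u1) (dom10 w1)).
  by rewrite (linear_onB (extB_linearl (dom10 w1) vm) u1 w1); ring.
have Flin : linear_on (dom sm) F.
  move=> a v z vm zm; rewrite /F.
  have [Su _] := extS_dual u1; have [Sw _] := extS_dual w1.
  have [Bu _] := extB_dual u1 (dom10 u1); have [Bw _] := extB_dual w1 (dom10 w1).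
  by rewrite Su// Sw// Bu// Bw// /GRing.scale/=; ring.
rewrite (_ : wm = fun k => (lam k `^ (2 * sm))^-1); last first.
  by apply/funext => k; rewrite powRN.
apply: wsum_inv_le => [k|n v]; first exact: powR_gt0.
rewrite -(frac_norm_proj ipn basis lam0).
have pm : dom sm (proj n v) by exact: frac_dom_proj.
rewrite (_ : \sum_(k < n) _ = F (proj n v)); last first.
  rewrite (linear_on_proj basis _ _ Flin); apply: eq_bigr => k _.
  by rewrite !nonlinE.
rewrite FE//; set a := extS _ _; set b := extB _ _ _; set c := extB _ _ _.
have a2 := Kb _ _ d1 pm; rewrite -/a in a2.
have b2 : b ^+ 2 <= (C * norm s1 u * norm s0 (u - w) * norm sm (proj n v)) ^+ 2.
  rewrite -real_normK ?num_real// ler_pXn2r ?nnegrE ?mulr_ge0 ?(ltW C0)//.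
  by apply: Cb => //; exact: dom10.
have c2 : c ^+ 2 <= (C * norm s1 (u - w) * norm s0 w * norm sm (proj n v)) ^+ 2.
  rewrite -real_normK ?num_real// ler_pXn2r ?nnegrE ?mulr_ge0 ?(ltW C0)//.
  by apply: Cb => //; exact: dom10.
have abc : (a + b + c) ^+ 2 <= 3 * (a ^+ 2 + b ^+ 2 + c ^+ 2).
  by have := sqr_ge0 (a - b); have := sqr_ge0 (b - c); have := sqr_ge0 (a - c); nra.
apply: (le_trans abc).
have -> : (((1 / 16 + 3 * C ^+ 2 * norm s0 w ^+ 2) * norm s1 (u - w) ^+ 2 +
   (3 * K + 3 * C ^+ 2 * norm s1 u ^+ 2) * norm s0 (u - w) ^+ 2) * norm sm (proj n v) ^+ 2) =
  3 * ((1 / 48 * norm s1 (u - w) ^+ 2 + K * norm s0 (u - w) ^+ 2) * norm sm (proj n v) ^+ 2 +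
    (C * norm s1 u * norm s0 (u - w) * norm sm (proj n v)) ^+ 2 +
    (C * norm s1 (u - w) * norm s0 w * norm sm (proj n v)) ^+ 2) by field.
by rewrite ler_wpM2l// !lerD.
Qed.

(** Infinite values take over the role of the domain conditions. If [x] has infinite energy, the
    right-hand side is infinite unless [x = y]; if only [y] has, then so has the difference, whose
    coefficient is at least 1/16. *)
Lemma nonlin_lipschitz : exists2 C, 0 < C & exists2 K, 0 <= K & forall x y,
  (wsum wm (fun k => nonlin x k - nonlin y k)%R <=
    ((1 / 16)%:E + C%:E * wsum w0 y) * wsum w1 (fun k => x k - y k)%R +
    (K%:E + C%:E * wsum w1 x) * wsum w0 (fun k => x k - y k)%R)%E.
Proof.
have [C C0 [K K0 h]] := nonlin_lipschitz_dom.
exists C => //; exists K => // x y.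
have w0ge j : 0 <= w0 j by exact: powR_ge0.
have w1ge j : 0 <= w1 j by exact: powR_ge0.
have [xoo|] := ltP (wsum w1 x) +oo%E; last first.
  rewrite leye_eq => /eqP xoo.
  have [|dge] := leP (wsum w0 (fun k => x k - y k)%R) 0%E.
    move=> d0; have -> : y = x.
      apply/funext => k; apply/esym/eqP; rewrite -subr_eq0; apply/eqP.
      by apply: (wsum_eq0 w0ge (k := k) _ d0); exact: powR_gt0.
    rewrite (_ : (fun k => nonlin x k - nonlin x k) = fun=> 0); last first.
      by apply/funext => k; rewrite subrr.
    rewrite wsum0; apply: adde_ge0; apply: mule_ge0; rewrite ?wsum_ge0//;
      by apply: adde_ge0; rewrite ?lee_fin// ?mule_ge0// ?lee_fin ?wsum_ge0 ?(ltW C0)//; lra.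
  rewrite xoo gt0_muley ?lte_fin// addey// gt0_mulye// addey ?leey//.
  by rewrite gt_eqF// (@lt_le_trans _ _ 0%E)// mule_ge0 ?wsum_ge0//
    adde_ge0 ?lee_fin//  mule_ge0 ?wsum_ge0// lee_fin ltW.
have [yoo|] := ltP (wsum w1 y) +oo%E; last first.
  rewrite leye_eq => /eqP yoo.
  have doo : wsum w1 (fun k => x k - y k)%R = +oo%E.
    apply/eqP; rewrite -leye_eq leNgt; apply/negP => dlt.
    have : (wsum w1 (fun k => x k - (x k - y k))%R < +oo)%E.
      by apply: le_lt_trans (wsumB_le w1ge _ _) _; rewrite lte_add_pinfty// lte_mul_pinfty.
    rewrite (_ : (fun k => x k - (x k - y k))%R = y) ?yoo//.
    by apply/funext => k; rewrite opprB addrCA subrr addr0.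
  rewrite doo gt0_muley; last first.
    apply: (@lt_le_trans _ _ (1 / 16)%:E); first by rewrite lte_fin; lra.
    by rewrite leeDl// mule_ge0 ?wsum_ge0// lee_fin ltW.
  rewrite addye ?leey// gt_eqF// (@lt_le_trans _ _ 0%E)// mule_ge0 ?wsum_ge0//.
  by rewrite adde_ge0 ?lee_fin// mule_ge0 ?wsum_ge0// lee_fin ltW.
have [xE u1] := seq_dom (s1_ge0 sigma01) xoo.
have [yE v1] := seq_dom (s1_ge0 sigma01) yoo.
have dE : (fun k => x k - y k) = coef (fromseq phi x - fromseq phi y).
  by apply/funext => k; rewrite (coefB ip) xE yE.
have := h _ _ u1 v1; rewrite xE yE => /le_trans; apply.
set u := fromseq phi x in dE u1 xE *; set v := fromseq phi y in dE v1 yE *.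
have E0 : wsum w0 y = (norm s0 v ^+ 2)%:E.
  by rewrite (frac_norm_sqr ipn basis lam0) ?yE//; exact: dom10.
have E1 : wsum w1 x = (norm s1 u ^+ 2)%:E by rewrite (frac_norm_sqr ipn basis lam0) ?xE.
rewrite E0 E1 dE -!(frac_norm_sqr ipn basis lam0) -?EFinM -?EFinD -?EFinM -?EFinD//.
- by apply: domB; exact: dom10.
- exact: domB.
Qed.

End nonlinearity.

(** * Smooth functions built from [exp(- 1 / q)] *)

Section smooth_functions.
Context {R : realType}.
Implicit Types (p q : {poly R}) (f g h : R -> R).

Definition smooth f : Prop := forall n x, derivable (derive1n n f) x 1.

Lemma smooth_derive1 f : smooth f -> smooth (derive1 f).
Proof. by move=> sf n x; rewrite -derive1Sn; exact: sf. Qed.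

Lemma smooth_of_derive f g : smooth g -> (forall x : R, is_derive x 1 f (g x)) -> smooth f.
Proof.
move=> sg fg; have E : derive1 f = g.
  by apply/funext => x; rewrite derive1E derive_val.
case=> [|n] x; first by case: (fg x).
by rewrite derive1Sn E; exact: sg.
Qed.

Lemma smooth_is_derive f (x : R) : smooth f -> is_derive x 1 f (derive1 f x).
Proof. by move=> sf; rewrite derive1E; exact/derivableP/(sf 0%N). Qed.

Lemma smooth_lin f g (a b : R) : smooth f -> smooth g ->
  smooth (fun x => a * f x + b * g x).
Proof.
move=> sf sg n; elim: n f g sf sg => [|n IH] f g sf sg x.
  have [] // : is_derive x 1 (fun x => a * f x + b * g x) (a * derive1 f x + b * derive1 g x).
  have df := smooth_is_derive x sf; have dg := smooth_is_derive x sg.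
  exact: (is_deriveD (is_deriveZ _ df) (is_deriveZ _ dg)).
rewrite derive1Sn.
rewrite (_ : derive1 _ = fun x => a * derive1 f x + b * derive1 g x); last first.
  apply/funext => y; rewrite derive1E; apply: derive_val.
  have df := smooth_is_derive y sf; have dg := smooth_is_derive y sg.
  exact: (is_deriveD (is_deriveZ _ df) (is_deriveZ _ dg)).
by apply: IH; exact: smooth_derive1.
Qed.

(** Serves at the zeros of [q] in [flat], where the two branches of the definition can meet. *)
Lemma is_derive_quadratic f (x M : R) : (\forall y \near x, `|f y| <= M * (y - x) ^+ 2) ->
  is_derive x 1 f 0.
Proof.
move=> fM; have f0 : f x = 0.
  have := nbhs_singleton fM; rewrite subrr expr0n mulr0 normr_le0.
  by move=> /eqP.
have c : h^-1 *: (f (h *: 1 + x) - f x) @[h --> 0^'] --> (0 : R).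
  apply/cvgrPdist_le => e e0; rewrite f0.
  have M0 : 0 <= `|M| by [].
  have [d d0 Md] := small_factor M0 e0.
  move/nbhs_ballP : fM => [d' /= d'0 fM].
  near=> h.
  rewrite sub0r normrN subr0 normrZ normfV.
  have h0 : h != 0 by near: h; exact: nbhs_dnbhs_neq.
  have hd' : `|h| < d' by near: h; apply: dnbhs0_lt.
  have h1 : `|f (h *: 1 + x)| <= M * (h *: 1 + x - x) ^+ 2.
    by apply: fM; rewrite /ball/= opprD addrCA subrr addr0 normrN /GRing.scale/= mulr1.
  have hd : `|h| < d.
    by near: h; apply: dnbhs0_lt.
  rewrite mulrC ler_pdivrMr ?normr_gt0//.
  apply: (le_trans h1); rewrite addrK /GRing.scale/= mulr1.
  apply: (@le_trans _ _ (`|M| * `|h| ^+ 2)).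
    by rewrite real_normK ?num_real// ler_wpM2r ?sqr_ge0// ler_norm.
  rewrite expr2 mulrA ler_wpM2r//.
  by apply: ltW; apply: le_lt_trans Md; rewrite ler_wpM2l// ltW.
by apply: DeriveDef; [exact: (cvgP _ c)|exact: (cvg_lim (@Rhausdorff R) c)].
Unshelve. all: by end_near. Qed.

(* For fixed q this family is closed under differentiation, also at the zeros of q. *)
Definition flat q p n (x : R) : R :=
  if 0 < q.[x] then p.[x] * (q.[x])^-1 ^+ n * expR (- (q.[x])^-1) else 0.

(** From [exp t >= 1 + t >= t] at [t = 1 / (m y)], raised to the power [m]. *)
Lemma expR_inv_le (m : nat) (y : R) : (0 < m)%N -> 0 < y ->
  expR (- y^-1) <= m%:R ^+ m * y ^+ m.
Proof.
move=> m0 y0.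
have my : 0 < (m%:R * y) by rewrite mulr_gt0 ?ltr0n.
rewrite -exprMn expRN -[leRHS]invrK lef_pV2 ?posrE ?expR_gt0 ?invr_gt0 ?exprn_gt0//.
rewrite -exprVn.
have -> : y^-1 = m%:R * (m%:R * y)^-1 by rewrite invfM mulrA mulfV ?mul1r// pnatr_eq0 -lt0n.
rewrite expRM_natl.
rewrite ler_pXn2r ?nnegrE ?expR_ge0 ?invr_ge0 ?(ltW my)//.
by apply: le_trans (expR_ge1Dx _); rewrite lerDr.
Qed.

(** Where [q > 0] this is the product rule with common denominator [q^(n+2)]; where [q < 0] the
    function is locally 0. At a zero [x] of [q], [q = r ('X - x)], and [expR_inv_le] with exponent
    [n + 2] cancels the negative power of [q] and leaves a multiple of the square of [y - x]. *)
Lemma is_derive_flat q p n (x : R) :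
  is_derive x 1 (flat q p n)
    (flat q (p^`() * q ^+ 2 - (p * q^`() * q) *+ n + p * q^`()) n.+2 x).
Proof.
have hc (r : {poly R}) y : {for y, continuous (horner r)} by exact: continuous_horner.
have [q0|q0|q0] := ltgtP 0 q.[x].
- have dq : is_derive x 1 (horner q) q^`().[x].
    by rewrite derivE derive1E; exact/derivableP/derivable_horner.
  have dp : is_derive x 1 (horner p) p^`().[x].
    by rewrite derivE derive1E; exact/derivableP/derivable_horner.
  pose V (y : R) := (q.[y])^-1.
  have dV : is_derive x 1 V (- (q.[x]) ^- 2 *: q^`().[x]).
    by apply: is_deriveV => //; rewrite gt_eqF.
  have dE : is_derive x 1 (expR \o (- V)) (expR (- V x) * - (- (q.[x]) ^- 2 *: q^`().[x])).
    by apply: is_derive1_comp; exact: is_deriveN.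
  have VX m y : (V ^+ m) y = (q.[y])^-1 ^+ m.
    by elim: m => // m IH; rewrite !exprS -IH.
  have dF := is_deriveM (is_deriveM dp (is_deriveX n dV)) dE.
  have qx0 : q.[x] != 0 by rewrite gt_eqF.
  have -> : flat q (p^`() * q ^+ 2 - (p * q^`() * q) *+ n + p * q^`()) n.+2 x =
    (horner p * V ^+ n) x *: (expR (- V x) * - (- (q.[x]) ^- 2 *: q^`().[x])) +
    (expR \o (- V)) x *: (p.[x] *: ((n%:R * V x ^+ n.-1) *: (- (q.[x]) ^- 2 *: q^`().[x])) +
      (V ^+ n) x *: p^`().[x]).
    clear dF dE dV.
    rewrite /flat q0 !(hornerM, hornerD, hornerN, hornerXn, hornerMn) /GRing.scale/=.
    rewrite -[(horner p * V ^+ n) x]/(p.[x] * (V ^+ n) x) !VX -[(- V) x]/(- V x).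
    rewrite -[V x]/(q.[x])^-1 -mulr_natl.
    case: n => [|m] /=.
      by field.
    by rewrite !exprS; set b := _ ^+ m; field.
  apply: near_eq_is_derive dF.
  have := hc q x => /cvgr_gt/(_ 0 q0); apply: filterS => y qy.
  by rewrite -[LHS]/(p.[y] * (V ^+ n) y * expR (- V y)) VX /flat qy.
- rewrite /flat (ltNge 0 q.[x]) (ltW q0)/=.
  have c0 : is_derive x 1 (cst 0 : R -> R) 0 by exact: is_derive_cst.
  apply: near_eq_is_derive c0.
  have := hc q x => /cvgr_lt/(_ 0 q0); apply: filterS => y qy.
  by rewrite ltNge (ltW qy).
- rewrite {2}/flat -q0 ltxx.
  have /factor_theorem [r qr] : root q x by rewrite rootE -q0.
  pose K (y : R) := (n.+2%:R ^+ n.+2) * `|(p * r ^+ 2).[y]|.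
  have Kc : {for x, continuous K}.
    by apply: cvgM; [exact: cvg_cst|apply: cvg_norm; exact: hc].
  apply: (@is_derive_quadratic _ _ (K x + 1)).
  have : K x < K x + 1 by rewrite ltrDl.
  move: Kc => /cvgr_lt h /h; apply: filterS => y Ky.
  apply: (@le_trans _ _ (K y * (y - x) ^+ 2)); last first.
    by rewrite ler_wpM2r ?sqr_ge0// ltW.
  rewrite /flat; case: ifPn => [qy|_]; last first.
    by rewrite normr0 mulr_ge0 ?sqr_ge0// mulr_ge0// exprn_ge0.
  rewrite !normrM normrX (gtr0_norm (x := _^-1)) ?invr_gt0// (gtr0_norm (expR_gt0 _)).
  apply: (@le_trans _ _ (`|p.[y]| * (q.[y])^-1 ^+ n * (n.+2%:R ^+ n.+2 * q.[y] ^+ n.+2))).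
    by rewrite ler_wpM2l ?expR_inv_le// mulr_ge0// exprn_ge0// invr_ge0 ltW.
  have -> : q.[y] ^+ n.+2 = q.[y] ^+ n * (r.[y] * (y - x)) ^+ 2.
    by rewrite -addn2 exprD qr hornerM hornerXsubC.
  rewrite le_eqVlt; apply/orP; left; apply/eqP.
  rewrite /K hornerM horner_exp normrM normrX real_normK ?num_real//.
  have -> : (q.[y])^-1 ^+ n = (q.[y] ^+ n)^-1 by rewrite exprVn.
  by field; rewrite expf_neq0// gt_eqF.
Qed.

Lemma smooth_flat q p n : smooth (flat q p n).
Proof.
move=> m; elim: m p n => [|m IH] p n x; first by have [] := is_derive_flat q p n x.
rewrite derive1Sn (_ : derive1 _ =
    flat q (p^`() * q ^+ 2 - (p * q^`() * q) *+ n + p * q^`()) n.+2); first exact: IH.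
by apply/funext => y; rewrite derive1E; apply: derive_val; exact: is_derive_flat.
Qed.

Lemma smooth_continuous f : smooth f -> continuous f.
Proof.
by move=> sf x; apply/differentiable_continuous/derivable1_diffP; exact: (sf 0%N x).
Qed.

End smooth_functions.

(** * Bump functions and the du Bois-Reymond lemma *)

Section bumps.
Context {R : realType}.
Local Notation mu := (@lebesgue_measure R).
Implicit Types (c d x t T : R) (q : R -> R).

Definition bump c d : R -> R := flat (('X - c%:P) * (d%:P - 'X)) 1 0.

Lemma bumpE c d x : bump c d x =
  if 0 < (x - c) * (d - x) then expR (- ((x - c) * (d - x))^-1) else 0.
Proof. by rewrite /bump /flat !hornerE/= ?mul1r. Qed.

Lemma bump_smooth c d : smooth (bump c d).
Proof. exact: smooth_flat. Qed.

Lemma bump_ge0 c d x : 0 <= bump c d x.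
Proof. by rewrite bumpE; case: ifP => // _; exact: expR_ge0. Qed.

Lemma bump_gt0 c d x : c < x -> x < d -> 0 < bump c d x.
Proof. by move=> cx xd; rewrite bumpE mulr_gt0 ?subr_gt0// expR_gt0. Qed.

Lemma bump_le c d x : c < d -> x <= c -> bump c d x = 0.
Proof.
move=> cd xc; rewrite bumpE ltNge mulr_le0_ge0 ?subr_le0 ?subr_ge0//.
by rewrite (le_trans xc)// ltW.
Qed.

Lemma bump_ge c d x : c < d -> d <= x -> bump c d x = 0.
Proof.
move=> cd dx; rewrite bumpE ltNge mulr_ge0_le0 ?subr_le0 ?subr_ge0//.
by rewrite (le_trans _ dx)// ltW.
Qed.

Lemma bump_patch c d (D : set R) : c < d -> `[c, d] `<=` D -> bump c d \_ D = bump c d.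
Proof.
move=> cd cdD; apply/funext => x; rewrite patchE; case: ifPn => // /negP xD.
have [xc|cx] := leP x c; first by rewrite bump_le.
have [dx|xd] := leP d x; first by rewrite bump_ge.
by exfalso; apply/xD/mem_set/cdD; rewrite /= in_itv/= (ltW cx) (ltW xd).
Qed.

Lemma bump_integrable c d (D : set R) : c < d -> measurable D ->
  mu.-integrable D (EFin \o bump c d).
Proof.
move=> cd mD; apply: (@integrableS _ _ _ mu setT) => //.
rewrite -(bump_patch cd (fun x h => h)); apply: integrable_patch => //.
apply: continuous_compact_integrable; first exact: segment_compact.
by apply: continuous_subspaceT; apply: smooth_continuous; exact: bump_smooth.
Qed.

Definition mass c d : R := \int[mu]_x bump c d x.

Lemma bump_integral c d (D : set R) : c < d -> `[c, d] `<=` D ->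
  \int[mu]_(x in D) bump c d x = mass c d.
Proof. by move=> cd cdD; rewrite Rintegral_mkcond bump_patch. Qed.

Definition bump_prim c d x : R := \int[mu]_(t in `]-oo, x]) bump c d t.

Lemma is_derive_bump_prim c d x : c < d -> is_derive x 1 (bump_prim c d) (bump c d x).
Proof.
move=> cd; have x1 : x < x + 1 by rewrite ltrDl.
have bi : mu.-integrable `]-oo, x + 1] (EFin \o bump c d) by exact: bump_integrable.
have bc : {for x, continuous (bump c d)}.
  by apply: smooth_continuous; exact: bump_smooth.
have [|Fd FE] := continuous_FTC1 x1 bi _ bc; first by rewrite /= ltNyr.
rewrite /bump_prim; apply: DeriveDef; first exact: Fd.
by rewrite -derive1E; exact: FE.
Qed.

Lemma bump_prim_le c d x : c < d -> x <= c -> bump_prim c d x = 0.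
Proof.
move=> cd xc; rewrite /bump_prim (@eq_Rintegral _ _ _ mu _ (cst 0)) ?Rintegral_cst ?mul0r//.
move=> t; rewrite inE/= in_itv/= => tx; apply: bump_le => //; exact: le_trans xc.
Qed.

Lemma bump_prim_ge c d x : c < d -> d <= x -> bump_prim c d x = mass c d.
Proof.
move=> cd dx; apply: bump_integral => // t/=; rewrite !in_itv/= => /andP[_ td].
exact: le_trans dx.
Qed.

(** The mean value theorem for [bump_prim] writes the mass as [d - c] times a value of the bump
    inside the interval. *)
Lemma mass_gt0 c d : c < d -> 0 < mass c d.
Proof.
move=> cd.
have [|x] := @MVT R (bump_prim c d) (bump c d) c d cd (fun x _ => is_derive_bump_prim x cd).
  apply: derivable_within_continuous => x _.
  by have [] := is_derive_bump_prim x cd.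
rewrite in_itv/= => /andP[cx xd].
rewrite bump_prim_ge// bump_prim_le// subr0 => ->.
by rewrite mulr_gt0 ?subr_gt0// bump_gt0.
Qed.

Lemma bump_average T q a e : mu.-integrable `]0, T[ (EFin \o q) -> a \in `]0, T[ ->
  {for a, continuous q} -> 0 < e ->
  exists c d, [/\ 0 < c, c < d, d < T &
    `|\int[mu]_(t in `]0, T[) (bump c d t * q t) - mass c d * q a| <= e * mass c d].
Proof.
move=> qi; rewrite in_itv/= => /andP[a0 aT] qc e0.
have /nbhs_ballP[r /= r0 qr] : \forall t \near a, `|q a - q t| < e.
  by move/cvgrPdist_lt : qc; apply.
pose s := Num.min r (Num.min a (T - a)) / 2.
have m0 : 0 < Num.min r (Num.min a (T - a)) by rewrite !lt_min r0 a0 subr_gt0.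
have [mr ma mT] : [/\ Num.min r (Num.min a (T - a)) <= r,
    Num.min r (Num.min a (T - a)) <= a & Num.min r (Num.min a (T - a)) <= T - a].
  by rewrite !ge_min !lexx !orbT.
have cd : a - s < a + s by rewrite /s; lra.
exists (a - s), (a + s); split => //; try by rewrite /s; lra.
set c := a - s in cd *; set d := a + s in cd *.
have cdT : `[c, d] `<=` `]0, T[.
  by move=> t /=; rewrite !in_itv/= => /andP[]; rewrite /c /d /s => *; apply/andP; split; lra.
have mb (D : set R) : measurable D -> measurable_fun D (bump c d).
  by move=> mD; apply: (@integrable_measurable _ _ _ mu D) => //; exact: bump_integrable.
have bi : mu.-integrable `]0, T[ (EFin \o bump c d) by exact: bump_integrable.
have bqi : mu.-integrable `]0, T[ (EFin \o (fun t => bump c d t * q t)).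
  rewrite (_ : (fun t => _) = (fun t => q t * bump c d t)); last first.
    by apply/funext => t; rewrite mulrC.
  apply: integrable_bddM => //; first exact: mb.
  exists 1 => t _; rewrite ger0_norm ?bump_ge0// bumpE; case: ifP => // h.
  by rewrite -expR0 ler_expR oppr_le0 invr_ge0 ltW.
have bai : mu.-integrable `]0, T[ (EFin \o (fun t => bump c d t * q a)).
  rewrite (_ : (fun t => _) = (fun t => q a * bump c d t)); last first.
    by apply/funext => t; rewrite mulrC.
  exact: integrable_scale.
have dint : mu.-integrable `]0, T[ (EFin \o (fun t => bump c d t * q t - bump c d t * q a)).
  exact: integrable_diff.
rewrite -(bump_integral cd cdT) -RintegralZr// -RintegralB// -RintegralZl//.
apply: (le_trans (le_normr_Rintegral _ _)) => //; apply: le_Rintegral => //.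
- exact: (integrable_norm dint).
- exact: integrable_scale.
move=> t _; rewrite -mulrBr normrM (ger0_norm (bump_ge0 _ _ _)) mulrC.
have [tc|ct] := leP t c; first by rewrite bump_le// !mulr0.
have [dt|td] := leP d t; first by rewrite bump_ge// !mulr0.
rewrite ler_wpM2r ?bump_ge0// distrC; apply/ltW/qr.
by rewrite /ball/= ltr_norml; move: ct td; rewrite /c /d /s => *; apply/andP; split; lra.
Qed.

(** Two bumps near [a] and [b], each weighted by the mass of the other, have a difference of
    integral 0, so its primitive has compact support and is a test function. Testing shows that the
    two averages of [q] agree, and they approximate [q a] and [q b]. *)
Lemma du_bois_reymond T q : mu.-integrable `]0, T[ (EFin \o q) ->
  (forall t, t \in `]0, T[ -> {for t, continuous q}) ->
  (forall h, test_function T h -> \int[mu]_(t in `]0, T[) (derive1 h t * q t) = 0) ->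
  forall a b, a \in `]0, T[ -> b \in `]0, T[ -> q a = q b.
Proof.
move=> qi qc q0 a b aT bT; apply/eqP; rewrite -subr_eq0 -normr_le0.
apply/ler_addgt0Pl => e e0; rewrite addr0.
have e2 : 0 < e / 2 by rewrite divr_gt0.
have [c [d [c0 cd dT hc]]] := bump_average qi aT (qc _ aT) e2.
have [c' [d' [c0' cd' dT' hc']]] := bump_average qi bT (qc _ bT) e2.
have m0 := mass_gt0 cd; have m0' := mass_gt0 cd'.
pose h x := mass c' d' * bump_prim c d x + - mass c d * bump_prim c' d' x.
have hd x : is_derive x 1 h (mass c' d' * bump c d x + - mass c d * bump c' d' x).
  exact: (is_deriveD (is_deriveZ _ (is_derive_bump_prim x cd))
    (is_deriveZ _ (is_derive_bump_prim x cd'))).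
have hE : derive1 h = fun x => mass c' d' * bump c d x + - mass c d * bump c' d' x.
  by apply/funext => x; rewrite derive1E derive_val.
have ht : test_function T h.
  split.
    apply: (smooth_of_derive _ hd).
    by apply: smooth_lin; exact: bump_smooth.
  exists (Num.min c c'), (Num.max d d'); split.
  - by rewrite lt_min c0.
  - by rewrite gt_max dT.
  move=> x; rewrite in_itv/= negb_and -!ltNge lt_min gt_max => /orP[/andP[xc xc']|/andP[dx dx']].
    by rewrite /h (bump_prim_le cd (ltW xc)) (bump_prim_le cd' (ltW xc')) !mulr0 addr0.
  (* To the right of both bumps each primitive equals its mass, and the two products cancel. *)
  rewrite /h (bump_prim_ge cd (ltW dx)) (bump_prim_ge cd' (ltW dx')).
  by move: (mass c d) (mass c' d') => u v; rewrite mulNr mulrC subrr.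
have bqi u v : u < v -> mu.-integrable `]0, T[ (EFin \o (fun t => bump u v t * q t)).
  move=> uv; rewrite (_ : (fun t => _) = (fun t => q t * bump u v t)); last first.
    by apply/funext => t; rewrite mulrC.
  apply: integrable_bddM => //.
    by apply: (@integrable_measurable _ _ _ mu) => //; exact: bump_integrable.
  exists 1 => t _; rewrite ger0_norm ?bump_ge0// bumpE; case: ifP => // k.
  by rewrite -expR0 ler_expR oppr_le0 invr_ge0 ltW.
have := q0 h ht; rewrite hE.
rewrite (_ : (fun t => _) = (fun t => mass c' d' * (bump c d t * q t) +
    - mass c d * (bump c' d' t * q t))); last by apply/funext => t; rewrite mulrDl !mulrA.
rewrite RintegralD//; try by apply: integrable_scale => //; exact: bqi.
rewrite !RintegralZl//; try exact: bqi.
set X := \int[mu]_(t in _) _ in hc *; set Y := \int[mu]_(t in _) _ in hc' *.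
move: (mass c d) (mass c' d') m0 m0' X Y hc hc' => u v u0 v0 X Y.
rewrite !ler_norml => /andP[h1 h2] /andP[h3 h4] E.
have uv : 0 < u * v by rewrite mulr_gt0.
have k1 := ler_wpM2l (ltW v0) h1; have k2 := ler_wpM2l (ltW v0) h2.
have k3 := ler_wpM2l (ltW u0) h3; have k4 := ler_wpM2l (ltW u0) h4.
by apply/andP; split; rewrite -(ler_pM2l uv); move: k1 k2 k3 k4 E; lra.
Qed.

End bumps.

(** * Weak derivatives and primitives *)

Section weak_derivatives.
Context {R : realType}.
Local Notation mu := (@lebesgue_measure R).
Implicit Types (h a b z q : R -> R) (t T : R) (P Q : R -> Prop).

Lemma ae_imply P Q : {ae mu, forall t, P t} -> (forall t, P t -> Q t) ->
  {ae mu, forall t, Q t}.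
Proof.
move=> aP PQ; apply: filterS aP => //.
exact: (ae_filter_ringOfSetsType mu).
Qed.

Lemma ae_and P Q : {ae mu, forall t, P t} -> {ae mu, forall t, Q t} ->
  {ae mu, forall t, P t /\ Q t}.
Proof.
move=> aP aQ; apply: filterI => //.
exact: (ae_filter_ringOfSetsType mu).
Qed.

Lemma prim_oo T t a : t \in `[0, T] -> mu.-integrable `[0, T] (EFin \o a) ->
  prim a t = \int[mu]_(s in `]0, t[) a s.
Proof.
move=> tT ai.
have ait := integrable_sub tT ai.
have ai1 : mu.-integrable `]0, t] (EFin \o a).
  by apply: integrableS ait => //; exact: subset_itv_oc_cc.
have ai2 : mu.-integrable `]0, t[ (EFin \o a).
  by apply: integrableS ai1 => //; exact: subset_itv_oo_oc.
by rewrite /prim -Rintegral_itv_obnd_cbnd// -Rintegral_itv_bndo_bndc.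
Qed.

Lemma ae_eq_Rintegral (D : set R) a b : measurable D ->
  measurable_fun D a -> measurable_fun D b ->
  {ae mu, forall t, D t -> a t = b t} ->
  \int[mu]_(t in D) a t = \int[mu]_(t in D) b t.
Proof.
move=> mD ma mb ab; congr fine; apply: ae_eq_integral => //.
- exact/measurable_EFinP.
- exact/measurable_EFinP.
- by apply: (ae_imply ab) => t h Dt; rewrite h.
Qed.

Lemma is_prim_ae T x0 a b z : 0 <= T -> is_prim T x0 a z ->
  mu.-integrable `[0, T] (EFin \o b) ->
  {ae mu, forall t, t \in `]0, T[ -> a t = b t} -> is_prim T x0 b z.
Proof.
move=> T0 [ai za] bi ab; split=> // t tT; rewrite za//; congr (_ + _).
rewrite !(prim_oo tT)//.
have sub : `]0, t[ `<=` `[0, T].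
  move: tT; rewrite in_itv/= => /andP[_ tT] s /=; rewrite !in_itv/= => /andP[/ltW -> st].
  by rewrite (le_trans (ltW st)).
apply: ae_eq_Rintegral => //.
- by apply: (@integrable_measurable _ _ _ mu) => //; exact: integrableS ai.
- by apply: (@integrable_measurable _ _ _ mu) => //; exact: integrableS bi.
- apply: (ae_imply ab) => s h st; apply: h; move: st tT; rewrite /= !in_itv/=.
  by move=> /andP[-> st] /andP[_]; exact: lt_le_trans.
Qed.

Lemma test_function_derivative_continuous T h : test_function T h -> continuous (derive1 h).
Proof. by move=> [sh _]; apply: smooth_continuous; exact: smooth_derive1. Qed.

Lemma test_function_ends T h : test_function T h -> h 0 = 0 /\ h T = 0.
Proof.
move=> [_ [a [b [a0 bT hab]]]]; split; apply: hab; rewrite in_itv/= negb_and -!ltNge.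
  by rewrite a0.
by rewrite bT orbT.
Qed.

Lemma test_function_is_prim T h : 0 <= T -> test_function T h -> is_prim T 0 (derive1 h) h.
Proof.
move=> T0 th; have [sh _] := th; have h'c := test_function_derivative_continuous th.
have h'w (A : set R) : {within A, continuous (derive1 h)} by exact: continuous_subspaceT.
have hc := smooth_continuous sh.
split.
  by apply: continuous_compact_integrable; [exact: segment_compact|exact: h'w].
move=> t; rewrite in_itv/= => /andP[]; rewrite le_eqVlt => /predU1P[<- _|t0 tT].
  by rewrite prim0 addr0; have [] := test_function_ends th.
have dh : derivable_oo_LRcontinuous h 0 t.
  split; first by move=> x _; exact: (sh 0%N x).
    by apply: cvg_at_right_filter; exact: hc.
  by apply: cvg_at_left_filter; exact: hc.
have := continuous_FTC2 t0 (h'w _) dh (fun x _ => erefl).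
have [-> _] := test_function_ends th.
by rewrite /prim /Rintegral => ->; rewrite add0r/= subr0.
Qed.

(** The product rule on [[0, T]]; the boundary terms vanish with [h]. *)
Lemma is_prim_weak_derivative T x0 a z h : 0 <= T -> is_prim T x0 a z -> test_function T h ->
  \int[mu]_(t in `]0, T[) (derive1 h t * z t) = - \int[mu]_(t in `]0, T[) (h t * a t).
Proof.
move=> T0 za th; have hp := test_function_is_prim T0 th.
have TT : T \in `[0, T] by rewrite in_itv/= T0 lexx.
have [i /(_ T TT) E] := is_primM T0 hp za.
have [_ hT] := test_function_ends th.
have [h'i _] := hp; have [ai _] := za.
have i1 : mu.-integrable `[0, T] (EFin \o (fun t => derive1 h t * z t)).
  exact: (is_prim_integrableM T0 za).
have i2 : mu.-integrable `[0, T] (EFin \o (fun t => h t * a t)).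
  have := is_prim_integrableM T0 hp ai; congr (mu.-integrable _ (EFin \o _)).
  by apply/funext => t; rewrite mulrC.
move: E; rewrite hT !mul0r add0r primD// !(prim_oo TT)// => /eqP.
by rewrite eq_sym addr_eq0 => /eqP.
Qed.

(** [z - prim a] has weak derivative 0, so it is constant on the open interval by [du_bois_reymond],
    and up to the endpoints by continuity. *)
Lemma weak_derivative_is_prim T a z : 0 < T -> mu.-integrable `[0, T] (EFin \o a) ->
  {within `[0, T], continuous z} ->
  (forall h, test_function T h ->
    \int[mu]_(t in `]0, T[) (derive1 h t * z t) = - \int[mu]_(t in `]0, T[) (h t * a t)) ->
  is_prim T (z 0) a z.
Proof.
move=> T0 ai zc hz; split=> //; have T0' := ltW T0.
have pa : is_prim T 0 a (prim a) by split=> // t _; rewrite add0r.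
have pc := is_prim_continuous T0' pa.
pose q t := z t - prim a t.
have qc : {within `[0, T], continuous q} by move=> t; apply: cvgB; [exact: zc|exact: pc].
have qi : mu.-integrable `[0, T] (EFin \o q).
  by apply: continuous_compact_integrable => //; exact: segment_compact.
have zi : mu.-integrable `[0, T] (EFin \o z).
  by apply: continuous_compact_integrable => //; exact: segment_compact.
have pi : mu.-integrable `[0, T] (EFin \o prim a).
  by apply: continuous_compact_integrable => //; exact: segment_compact.
have oo (f : R -> R) : mu.-integrable `[0, T] (EFin \o f) -> mu.-integrable `]0, T[ (EFin \o f).
  by move=> fi; apply: integrableS fi => //; exact: subset_itv_oo_cc.
have := qc => /(continuous_within_itvP _ T0) [qo q0 qT].
have qq : forall s t, s \in `]0, T[ -> t \in `]0, T[ -> q s = q t.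
  apply: du_bois_reymond; [exact: oo|by move=> t tT; exact: qo|move=> h th].
  have h'i (f : R -> R) : mu.-integrable `[0, T] (EFin \o f) ->
      mu.-integrable `]0, T[ (EFin \o (fun t => derive1 h t * f t)).
    move=> fi; rewrite (_ : (fun t => _) = (fun t => f t * derive1 h t)); last first.
      by apply/funext => t; rewrite mulrC.
    apply: oo; have h'c := test_function_derivative_continuous th.
    have h'b : is_prim T 0 (derive1 h) h := test_function_is_prim T0' th.
    apply: integrable_bddM => //.
      by apply: within_continuous_measurable; exact: continuous_subspaceT.
    have h'w : {within `[0, T], continuous (fun t => `|derive1 h t|)}.
      by apply: continuous_subspaceT => t; apply: cvg_norm; exact: h'c.
    have [c _ hc] := EVT_max T0' h'w.
    by exists `|derive1 h c|.
  rewrite (_ : (fun t => _) = (fun t => derive1 h t * z t - derive1 h t * prim a t)); last first.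
    by apply/funext => t; rewrite mulrBr.
  rewrite RintegralB//; [|exact: h'i|exact: h'i].
  by rewrite hz// (is_prim_weak_derivative T0' pa th) subrr.
have mid : T / 2 \in `]0, T[ by rewrite in_itv/=; apply/andP; split; lra.
have e0 : q 0 = q (T / 2).
  apply: (cvg_unique (@Rhausdorff R) q0).
  apply: cvg_near_cst; near=> t; apply: qq => //; rewrite in_itv/=; apply/andP; split; near: t.
    exact: nbhs_right_gt.
  exact: nbhs_right_lt.
have eT : q T = q (T / 2).
  apply: (cvg_unique (@Rhausdorff R) qT).
  apply: cvg_near_cst; near=> t; apply: qq => //; rewrite in_itv/=; apply/andP; split; near: t.
    exact: nbhs_left_gt.
  exact: nbhs_left_lt.
move=> t; rewrite in_itv/= => /andP[t0 tT].
have qt : q t = q 0.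
  rewrite e0; move: t0 tT; rewrite le_eqVlt => /predU1P[<- _//|t0].
  rewrite le_eqVlt => /predU1P[->//|tT].
  by apply: qq => //; rewrite in_itv/= t0 tT.
by move: qt; rewrite /q prim0 subr0 => <-; rewrite subrK.
Unshelve. all: by end_near. Qed.

End weak_derivatives.

(** * Functions with values in a dual, tested at eigenvectors *)

Section dual_valued.
Context (R : realType) (H : completeNormedModType R) (ip : {dot H for idfun}).
Variables (lam : nat -> R) (phi : nat -> H).
Hypothesis ipn : forall x, ip x x = `|x| ^+ 2.
Hypothesis basis : hilbert_basis ip phi.
Hypothesis lam0 : forall k, 0 < lam k.
Hypothesis lam_ge : forall k, lam 0%N <= lam k.
Implicit Types (u v w : H) (s T : R) (F G : H -> R) (U W : R -> H -> R).
Local Notation mu := (@lebesgue_measure R).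
Local Notation coef := (coef ip phi).
Local Notation proj := (proj phi).
Local Notation dom := (frac_dom ip lam phi).
Local Notation norm := (frac_norm ip lam phi).
Local Notation dual := (frac_dual ip lam phi).
Local Notation dnorm := (dual_norm ip lam phi).

Lemma frac_dom_model s : l2_model (dom s) (norm s) (fun k u => coef u k) phi
  (fun k => lam k `^ (2 * s)).
Proof.
split.
- exact: frac_dom0.
- by move=> a x y; exact: frac_domP.
- by move=> a x y k _ _; exact: coefP.
- by move=> k; exact: frac_dom_phi.
- by move=> j k; exact: coef_phi.
- by move=> k; exact: powR_gt0.
- by move=> x _; exact: frac_norm_ge0.
- by move=> x xs; rewrite frac_norm_sqr.
Qed.

Lemma frac_dual_model s : 0 <= s -> l2_model (dual s) (dnorm s) (fun k F => F (phi k))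
  (fun k => pivot ip (phi k)) (fun k => lam k `^ (- (2 * s))).
Proof.
move=> s0; split.
- exact: frac_dual0.
- by move=> a x y; exact: frac_dualP.
- by [].
- by move=> k; exact: frac_dual_pivot.
- by move=> j k; exact: (coef_phi basis).
- by move=> k; exact: powR_gt0.
- by move=> F; exact: dual_norm_ge0.
- by move=> F Fs; rewrite dual_norm_sqr.
Qed.

Section square_integrable.
Variables (s : R) (I : set R).
Hypothesis s0 : 0 <= s.
Hypothesis mI : measurable I.
Hypothesis fI : (mu I < +oo)%E.
Local Notation L2 := (L2_space I (dual s) (dnorm s)).

(** The majorant is 1 plus the squared dual norm, by [d <= 1 + d^2]. It is independent of [v], so
    that integrals in time are bounded functionals of [v]. *)
Lemma dual_eval U : L2 U -> exists2 G : R -> R, mu.-integrable I (EFin \o G) &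
  forall v, dom s v -> measurable_fun I (fun t => U t v) /\
    forall t, I t -> `|U t v| <= norm s v * G t.
Proof.
move=> /(L2_spaceP (frac_dual_model s0) mI) [Us Um Ui].
pose w k := lam k `^ (- (2 * s)).
have w0 k : 0 <= w k by exact: powR_ge0.
pose Q t := wsum w (fun k => U t (phi k)).
have QE t : I t -> Q t = ((dnorm s (U t) ^+ 2)%:E).
  by move=> It; rewrite (dual_norm_sqr ipn basis lam0)//; exact: Us.
have Qf t : I t -> (fine (Q t))%:E = Q t by move=> It; rewrite QE.
have Qi : mu.-integrable I Q.
  apply/integrableP; split; first exact: measurable_wsum.
  rewrite (_ : (\int[mu]_(t in I) `|Q t| = \int[mu]_(t in I) Q t)%E)//.
  by apply: eq_integral => t _; rewrite gee0_abs// wsum_ge0.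
have Qr : mu.-integrable I (EFin \o (fun t => fine (Q t))).
  have e : {in I, Q =1 EFin \o (fun t => fine (Q t))}.
    by move=> t; rewrite inE => It; rewrite /= Qf.
  exact: eq_integrable Qi.
have c1 : mu.-integrable I (EFin \o (fun=> 1)).
  apply/integrableP; split; first exact/measurable_EFinP.
  by under eq_integral do rewrite /= normr1; rewrite integral_cst// mul1e.
exists (fun t => 1 + fine (Q t)); first exact: integrable_add.
move=> v vs; split.
  apply: (@measurable_fun_cvg _ _ _ _ (fun n t => \sum_(k < n) coef v k * U t (phi k))).
    by move=> n; apply: measurable_sum => k; apply: measurable_funM.
  by move=> t It; exact: (@frac_dual_cvg _ _ ip lam phi ipn basis lam0 s (U t) v (Us t It) vs).
move=> t It; apply: (le_trans (dual_norm_bound ipn basis lam0 (Us _ It) vs)).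
rewrite mulrC ler_wpM2l ?frac_norm_ge0// QE//=.
have d0 := dual_norm_ge0 ipn basis lam0 (Us _ It).
by have := sqr_ge0 (dnorm s (U t) - 1); nra.
Qed.

Lemma dual_eval_integrable U (m : R -> R) (M : R) v : L2 U -> measurable_fun I m ->
  (forall t, I t -> `|m t| <= M) -> dom s v ->
  mu.-integrable I (EFin \o (fun t => m t * U t v)).
Proof.
move=> LU mm mM vs; have [G Gi /(_ v vs) [Um UG]] := dual_eval LU.
rewrite (_ : (fun t => _) = (fun t => U t v * m t)); last first.
  by apply/funext => t; rewrite mulrC.
apply: integrable_bddM => //; first by exists M.
have Gi' : mu.-integrable I (EFin \o (fun t => norm s v * G t)) by exact: integrable_scale.
apply: (@integrable_le _ _ _ mu I mI _ _ Um _ Gi') => t It.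
by rewrite (le_trans (UG _ It))// ler_norm.
Qed.

Lemma dual_pairing U (m : R -> R) (M : R) : L2 U -> measurable_fun I m ->
  (forall t, I t -> `|m t| <= M) -> dual s (fun v => \int[mu]_(t in I) (m t * U t v)).
Proof.
move=> LU mm mM; have [G Gi GP] := dual_eval LU.
have [Us _ _] := (L2_spaceP (frac_dual_model s0) mI U).1 LU.
have mi v : dom s v -> mu.-integrable I (EFin \o (fun t => m t * U t v)).
  exact: dual_eval_integrable mM.
split.
  move=> a u v us vs; rewrite /GRing.scale/= -RintegralZl//; last exact: mi.
  rewrite -RintegralD//; [|apply: integrable_scale => //; exact: mi|exact: mi].
  apply: eq_Rintegral => t; rewrite inE => It.
  have [lin _] := Us t It; rewrite [X in m t * X]lin//.
  by rewrite -[_ *: _]/(a * _); ring.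
exists (\int[mu]_(t in I) (`|M| * G t)) => v vs.
have Gz : mu.-integrable I (EFin \o (fun t => `|M| * G t)) by exact: integrable_scale.
apply: (@le_trans _ _ (\int[mu]_(t in I) `|m t * U t v|)).
  by apply: le_normr_Rintegral => //; exact: mi.
rewrite -RintegralZr//; apply: le_Rintegral => //.
- exact: (integrable_norm (mi v vs)).
- rewrite (_ : (fun t => _) = (fun t => norm s v * (`|M| * G t))); last first.
    by apply/funext => t; rewrite mulrC.
  exact: integrable_scale.
- move=> t It; rewrite normrM -mulrA; apply: ler_pM => //.
    by rewrite (le_trans (mM _ It))// ler_norm.
  by rewrite mulrC; have [_ ->] := GP v vs.
Qed.

End square_integrable.

(** The defect of the identity, as a function of [v], belongs to the dual by [dual_pairing] and
    vanishes at all eigenvectors, hence on the whole domain by [frac_dual_cvg]. *)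
Lemma weak_derivative_coord T s U W : 0 <= s ->
  L2_space `]0, T[ (dual s) (dnorm s) U -> L2_space `]0, T[ (dual s) (dnorm s) W ->
  (forall h k, test_function T h ->
    \int[mu]_(t in `]0, T[) (derive1 h t * U t (phi k)) =
    - \int[mu]_(t in `]0, T[) (h t * W t (phi k))) ->
  weak_derivative ip lam phi T s U W.
Proof.
move=> s0 LU LW UW h th v vs.
have fI : (mu `]0%R, T[ < +oo)%E by rewrite lebesgue_measure_itv/=; case: ifP => //; rewrite ltry.
have bounded (m : R -> R) : continuous m -> measurable_fun `]0, T[ m /\
    exists M, forall t, t \in `]0, T[ -> `|m t| <= M.
  move=> mc; split; first by apply: measurable_funS (continuous_measurable_fun mc).
  have [T0|T0] := leP 0 T; last first.
    by exists 0 => t; rewrite in_itv/= => /andP[t0 tT]; move: (lt_trans t0 tT); rewrite ltNge (ltW T0).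
  have nw : {within `[0, T], continuous (fun t => `|m t|)}.
    by apply: continuous_subspaceT => t; apply: cvg_norm; exact: mc.
  have [c _ hc] := EVT_max T0 nw.
  by exists `|m c| => t tT; apply: hc; exact: (@subset_itv_oo_cc _ _ 0 T).
have [m1 [M1 b1]] := bounded _ (test_function_derivative_continuous th).
have [m2 [M2 b2]] := bounded _ (smooth_continuous th.1).
have d1 := dual_pairing s0 (measurable_itv _) fI LU m1 b1.
have d2 := dual_pairing s0 (measurable_itv _) fI LW m2 b2.
pose l := (1 : R) *: (fun v => \int[mu]_(t in `]0, T[) (derive1 h t * U t v)) +
  (fun v => \int[mu]_(t in `]0, T[) (h t * W t v)).
have dl : dual s l by exact: frac_dualP.
have lphi k : l (phi k) = 0.
  by rewrite /l -[LHS]/(1 * _ + _) mul1r UW// addNr.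
have c : (0 : R) @[n --> \oo] --> l v.
  have := @frac_dual_cvg _ _ ip lam phi ipn basis lam0 s l v dl vs.
  rewrite (_ : (fun n => _) = fun=> 0)//; apply/funext => n.
  by rewrite big1// => k _; rewrite lphi mulr0.
have l0 : l v = 0 by rewrite -(cvg_lim (@Rhausdorff R) c); exact: lim_cst.
by apply/eqP; rewrite -addr_eq0; move: l0; rewrite /l -[l in l = _]/(1 * _ + _) mul1r => ->.
Qed.

End dual_valued.

(** * Time integrals of weighted sums, up to null sets *)

Section sequence_integrals.
Context {R : realType}.
Local Notation mu := (@lebesgue_measure R).
Implicit Types (x y : R -> nat -> R) (w : nat -> R) (D : set R) (T : R).

Lemma integral_wsumB_fin D w x y : measurable D -> (forall k, 0 <= w k) ->
  (forall k, measurable_fun D (x ^~ k)) -> (forall k, measurable_fun D (y ^~ k)) ->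
  (\int[mu]_(t in D) wsum w (x t) < +oo)%E -> (\int[mu]_(t in D) wsum w (y t) < +oo)%E ->
  (\int[mu]_(t in D) wsum w (fun k => x t k - y t k)%R < +oo)%E.
Proof.
move=> mD w0 mx my xoo yoo.
have mw z : (forall k, measurable_fun D (z ^~ k)) -> measurable_fun D (fun t => wsum w (z t)).
  by move=> mz; exact: measurable_wsum.
apply: (@le_lt_trans _ _ (2%:E * \int[mu]_(t in D) wsum w (x t) +
    2%:E * \int[mu]_(t in D) wsum w (y t))%E); last first.
  by rewrite lte_add_pinfty// lte_mul_pinfty.
rewrite -!ge0_integralZl//; try by [exact: mw|move=> t _; exact: wsum_ge0].
rewrite -ge0_integralD//; last 4 first.
- by move=> t _; rewrite mule_ge0// wsum_ge0.
- by apply: emeasurable_funM => //; exact: mw.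
- by move=> t _; rewrite mule_ge0// wsum_ge0.
- by apply: emeasurable_funM => //; exact: mw.
apply: ge0_le_integral => //.
- by move=> t _; exact: wsum_ge0.
- by apply: mw => k; exact: measurable_funB.
- by apply: emeasurable_funD; apply: emeasurable_funM => //; exact: mw.
- by move=> t _; exact: wsumB_le.
Qed.

Lemma integral_wsum_oo T w x : (forall k, 0 <= w k) ->
  (forall k, measurable_fun setT (x ^~ k)) ->
  (\int[mu]_(t in `[0%R, T]) wsum w (x t) = \int[mu]_(t in `]0%R, T[) wsum w (x t))%E.
Proof.
move=> w0 mx.
have mw D : measurable D -> measurable_fun D (fun t => wsum w (x t)).
  by move=> mD; apply: measurable_wsum => // k; exact: measurable_funS (mx k).
by rewrite integral_itv_bndo_bndc; [rewrite integral_itv_obnd_cbnd//; exact: mw|exact: mw].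
Qed.

Lemma integral_wsum_ae T w x y : (forall k, 0 <= w k) ->
  (forall k, measurable_fun `]0, T[ (x ^~ k)) -> (forall k, measurable_fun `]0, T[ (y ^~ k)) ->
  {ae mu, forall t, t \in `]0, T[ -> forall k, x t k = y t k} ->
  (\int[mu]_(t in `]0%R, T[) wsum w (x t) = \int[mu]_(t in `]0%R, T[) wsum w (y t))%E.
Proof.
move=> w0 mx my xy; apply: ae_eq_integral => //; [exact: measurable_wsum..|].
apply: (ae_imply xy) => t h tT; apply: eq_wsum; exact: h.
Qed.

Lemma integrable_ae_eq T (a b : R -> R) :
  mu.-integrable `[0, T] (EFin \o a) -> measurable_fun `[0, T] b ->
  {ae mu, forall t, t \in `]0, T[ -> a t = b t} ->
  mu.-integrable `[0, T] (EFin \o b).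
Proof.
move=> /integrableP[am ai] bm ab; apply/integrableP; split; first exact/measurable_EFinP.
have oo (c : R -> R) : measurable_fun `[0, T] c ->
    (\int[mu]_(t in `[0%R, T]) `|(c t)%:E| =
     \int[mu]_(t in `]0%R, T[) `|(c t)%:E|)%E.
  move=> cm.
  have m (i : interval R) : [set` i] `<=` `[0, T] ->
      measurable_fun [set` i] (fun t => `|(c t)%:E|%E).
    by move=> iT; apply/measurable_EFinP/measurableT_comp => //; exact: measurable_funS cm.
  rewrite -integral_itv_obnd_cbnd; last exact: m (@subset_itv_oc_cc _ _ 0 T).
  by rewrite -integral_itv_bndo_bndc//; exact: m (@subset_itv_oo_cc _ _ 0 T).
have mS (c : R -> R) : measurable_fun `[0, T] c ->
    measurable_fun `]0, T[ (fun t => `|(c t)%:E|%E).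
  move=> cm; apply/measurable_EFinP/measurableT_comp => //.
  by apply: measurable_funS cm => //; exact: subset_itv_oo_cc.
have am' : measurable_fun `[0, T] a by exact/measurable_EFinP.
rewrite [X in (X < _)%E](oo b bm); rewrite [X in (X < _)%E](oo a am') in ai.
apply: le_lt_trans ai; rewrite le_eqVlt; apply/orP; left; apply/eqP.
apply: ae_eq_integral => //; [exact: mS|exact: mS|].
by apply: (ae_imply ab) => t h tT; rewrite h.
Qed.

End sequence_integrals.

(** * Equivalence of the Cauchy problem with the coordinate system *)

Section assembly.
Context (R : realType) (H : completeNormedModType R) (ip : {dot H for idfun}).
Variables (D : set H) (A S : H -> H) (B : H -> H -> H).
Variables (lam : nat -> R) (phi : nat -> H) (sigma T : R).
Hypothesis SA : structural_assumptions ip D A S B lam phi sigma.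
Hypothesis sigma01 : 0 <= sigma <= 1.
Hypothesis T0 : 0 < T.
Implicit Types (u v w : H) (s : R).

Local Notation mu := (@lebesgue_measure R).
Local Notation coef := (coef ip phi).
Local Notation dom := (frac_dom ip lam phi).
Local Notation norm := (frac_norm ip lam phi).
Local Notation dual := (frac_dual ip lam phi).
Local Notation dnorm := (dual_norm ip lam phi).
Local Notation s1 := ((1 + sigma) / 2).
Local Notation s0 := (sigma / 2).
Local Notation sm := ((1 - sigma) / 2).
Local Notation extAS := (ext_op ip lam phi D s1 (fun x => A x + S x)).
Local Notation extB := (ext_bilin ip lam phi D ((sigma + 1) / 2) s0 B).
Local Notation w0 := (fun k => (lam k `^ (2 * s0))%R).
Local Notation w1 := (fun k => (lam k `^ (2 * s1))%R).
Local Notation wm := (fun k => (lam k `^ (- (2 * sm)))%R).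
Local Notation N := (nonlin ip S B lam phi sigma).

Let ipn : forall x, ip x x = `|x| ^+ 2. Proof. exact: sa_norm SA. Qed.
Let basis : hilbert_basis ip phi. Proof. exact: sa_basis SA. Qed.
Let lam0 : forall k, 0 < lam k. Proof. exact: sa_eigen_pos SA. Qed.
Let lam_ge : forall k, lam 0%N <= lam k. Proof. exact: eigen_ge SA. Qed.
Let s10 : 0 <= s1. Proof. exact: s1_ge0. Qed.
Let s00 : 0 <= s0. Proof. exact: s0_ge0. Qed.
Let sm0 : 0 <= sm. Proof. exact: sm_ge0. Qed.
Let T0' : 0 <= T. Proof. exact: ltW. Qed.
Let w0_ge0 k : 0 <= w0 k. Proof. exact: powR_ge0. Qed.
Let w1_ge0 k : 0 <= w1 k. Proof. exact: powR_ge0. Qed.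
Let wm_ge0 k : 0 <= wm k. Proof. exact: powR_ge0. Qed.
Let mI : measurable (`]0, T[%classic : set R). Proof. exact: measurable_itv. Qed.

Lemma weight1 k : w1 k = lam k * w0 k.
Proof.
rewrite (_ : 2 * s1 = 1 + 2 * s0); last by lra.
by rewrite powRD ?(gt_eqF (lam0 k)) ?implybT// powRr1// ltW.
Qed.

Lemma weightm k : wm k = (lam k)^-1 * w0 k.
Proof.
rewrite (_ : - (2 * sm) = -1 + 2 * s0); last by lra.
by rewrite powRD ?(gt_eqF (lam0 k)) ?implybT// powR_inv1// ltW.
Qed.

(** In coordinates: [A] is an isometry from the domain of order [(1 + sigma) / 2] to the dual of
    order [(1 - sigma) / 2]. *)
Lemma wsum_m_lam (x : nat -> R) : wsum wm (fun k => lam k * x k) = wsum w1 x.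
Proof.
congr (limn _); apply/funext => n; apply: eq_bigr => k _; congr EFin.
by rewrite weight1 weightm; field; rewrite gt_eqF.
Qed.

(** [wm = lam^-2 w1], largest relative to [w1] at the lowest eigenvalue. It places the pivot image
    of a solution in the dual space. *)
Lemma wsum_m_1 (x : nat -> R) : (wsum wm x <= ((lam 0%N)^-1 ^+ 2)%:E * wsum w1 x)%E.
Proof.
apply: wsum_weights_le => // k; rewrite weight1 weightm (mulrA (_ ^+ 2)) ler_wpM2r//.
rewrite -[leLHS]mul1r -ler_pdivlMr ?invr_gt0// invrK -mulrA -expr2 exprVn.
rewrite mulrC ler_pdivlMr ?exprn_gt0// mul1r.
by rewrite ler_pXn2r// nnegrE ltW.
Qed.

Section data.
Variables (f : R -> H -> R) (g : H).
Hypothesis fL : L2_dual ip lam phi sigma T f.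
Hypothesis gs : dom s0 g.

(** [f] is constrained on the open interval only; the extension by 0 is measurable on the whole
    line. *)
Definition forcing (t : R) (k : nat) : R := ((fun t => f t (phi k)) \_ `]0, T[) t.

Let fdual t : t \in `]0, T[ -> dual sm (f t).
Proof. by have [h _ _] := (L2_spaceP (frac_dual_model ipn basis lam0 lam_ge sm0) mI f).1 fL; exact: h. Qed.

Let fmeas k : measurable_fun `]0, T[ (fun t => f t (phi k)).
Proof. by have [_ h _] := (L2_spaceP (frac_dual_model ipn basis lam0 lam_ge sm0) mI f).1 fL. Qed.

Let fint : (\int[mu]_(t in `]0%R, T[) wsum wm (fun k => f t (phi k)) < +oo)%E.
Proof. by have [_ _] := (L2_spaceP (frac_dual_model ipn basis lam0 lam_ge sm0) mI f).1 fL. Qed.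

Lemma forcing_measurable k : measurable_fun setT (forcing ^~ k).
Proof. exact: measurable_patch. Qed.

Lemma forcingE t k : t \in `]0, T[ -> forcing t k = f t (phi k).
Proof. by move=> tT; rewrite /forcing patchE mem_set. Qed.

Lemma forcing_integral : (\int[mu]_(t in `[0%R, T]) wsum wm (forcing t) =
  \int[mu]_(t in `]0%R, T[) wsum wm (fun k => f t (phi k)))%E.
Proof.
rewrite integral_wsum_oo//; last exact: forcing_measurable.
by apply: eq_integral => t; rewrite inE => tT; apply: eq_wsum => k; rewrite forcingE.
Qed.

Local Notation is_sol := (is_solution ip D A S B lam phi sigma T f g).
Local Notation solves_seq := (solves T lam w1 wm N forcing (coef g)).

Lemma sequence_to_solution x : solves_seq x -> exists2 u, is_sol u &
  {ae mu, forall t, t \in `]0, T[ -> forall k, coef (u t) k = x t k}.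
Proof.
move=> xsol; have [xm xP x1 xN] := xsol.
have Nm : forall x : R -> nat -> R, (forall k, measurable_fun setT (x ^~ k)) ->
    forall k, measurable_fun setT (fun t => N (x t) k).
  exact: (nonlin_measurable SA sigma01).
have foo : (\int[mu]_(t in `[0%R, T]) wsum wm (forcing t) < +oo)%E by rewrite forcing_integral.
have g0 : (wsum w0 (coef g) < +oo)%E by have := gs; rewrite frac_domE.
(* The majorant gives finite [w0]-energy at every time and, further below, continuity in time by
   dominated convergence. *)
have [b [boo xb]] : exists b : nat -> R, (wsum w0 b < +oo)%E /\
    forall t k, t \in `[0, T] -> `|x t k| <= `|b k|.
  have w00 k : 0 < w0 k by exact: powR_gt0.
  exact: (solves_dominated T0' lam0 w00 weightm Nm forcing_measurable xsol g0 foo).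
pose P t := (wsum w1 (x t) < +oo)%E.
have aeP : {ae mu, forall t, t \in `]0, T[ -> P t}.
  have Qi : mu.-integrable `[0, T] (fun t => wsum w1 (x t)).
    apply/integrableP; split.
      by apply: measurable_wsum => // k; apply: measurable_funS (xm k).
    rewrite (_ : (\int[mu]_(t in _) _ = \int[mu]_(t in `[0%R, T]) wsum w1 (x t))%E)//.
    by apply: eq_integral => t _; rewrite gee0_abs// wsum_ge0.
  apply: (ae_imply (integrable_ae _ Qi)) => // t h tT.
  by rewrite /P ltey_eq h//; exact: subset_itv_oo_cc tT.
(* Solutions lie in D(A^s1) at every time of ]0, T[, so x is altered on the null
   set where its energy is infinite; x itself gives the continuous representative. *)
pose u t : H := if P t then fromseq phi (x t) else 0.
pose z t k : R := if P t then x t k else 0.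
have uz t : coef (u t) = z t.
  rewrite /u /z; case: ifPn => // Pt; last by apply/funext => k; exact: (ip0l ip).
  by have [-> _] := seq_dom SA s10 Pt.
have u1 t : dom s1 (u t).
  rewrite /u; case: ifPn => // Pt; last exact: frac_dom0.
  by have [_ h] := seq_dom SA s10 Pt.
have mJ : measurable [set t | P t].
  rewrite -[X in measurable X]setTI.
  exact: (emeasurable_fun_infty_o measurableT (measurable_wsum w1_ge0 xm)).
have zm k : measurable_fun setT (z ^~ k).
  rewrite (_ : (fun t => _) = (fun t => \1_[set t | P t] t * x t k)).
    by apply: measurable_funM => //; exact: measurable_indic.
  apply/funext => t; rewrite indicE /z; case: ifPn => [Pt|/negP Pt].
    by rewrite mem_set// mul1r.
  by rewrite memNset// mul0r.
(* At the altered times [x t] has infinite energy, so [N (x t)] is the default value 0, which is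
   also [N] of the zero sequence. *)
have Nz t : N (z t) = N (x t).
  rewrite /z; have [//|/negPf Pt] := boolP (P t).
  by apply/funext => k; rewrite (nonlin0 SA) /nonlin -/(P t) Pt.
have zI (Z : set R) k : measurable Z -> measurable_fun Z (z ^~ k).
  by move=> mZ; exact: measurable_funS (zm k).
have NI (Z : set R) k : measurable Z -> measurable_fun Z (fun t => N (x t) k).
  by move=> mZ; exact: measurable_funS (Nm _ xm k).
have z1 : (\int[mu]_(t in `]0%R, T[) wsum w1 (z t) < +oo)%E.
  rewrite integral_wsum_oo in x1; [|exact: w1_ge0|exact: xm].
  apply: (@le_lt_trans _ _ (\int[mu]_(t in `]0%R, T[) wsum w1 (x t))%E); last exact: x1.
  apply: ge0_le_integral => //.
  - by move=> t _; exact: wsum_ge0.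
  - by apply: measurable_wsum => // k; exact: zI.
  - by apply: measurable_wsum => // k; exact: measurable_funS (xm k).
  - move=> t _; rewrite /z; case: (P t) => //.
    by rewrite [leLHS](_ : _ = 0%E) ?wsum_ge0//; exact: wsum0.
have uL : L2_space `]0, T[ (dom s1) (norm s1) u.
  apply/(L2_spaceP (frac_dom_model ipn basis lam0 s1) mI); split.
  - by move=> t _; exact: u1.
  - by move=> k; rewrite (_ : (fun t => _) = (z ^~ k)); [exact: zI|apply/funext => t; rewrite -uz].
  - rewrite (_ : (\int[mu]_(t in _) _)%E = (\int[mu]_(t in `]0%R, T[) wsum w1 (z t))%E)//.
    by apply: eq_integral => t _; rewrite -uz.
have piL : L2_dual ip lam phi sigma T (pivot ip \o u).
  apply/(L2_spaceP (frac_dual_model ipn basis lam0 lam_ge sm0) mI); split.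
  - by move=> t _; exact: frac_dual_pivot.
  - by move=> k; rewrite (_ : (fun t => _) = (z ^~ k)); [exact: zI|apply/funext => t; rewrite -uz].
  - apply: (@le_lt_trans _ _ (((lam 0%N)^-1 ^+ 2)%:E * \int[mu]_(t in `]0%R, T[) wsum w1 (z t))%E).
      rewrite -ge0_integralZl//; try by [apply: measurable_wsum => // k; exact: zI
        | move=> t _; exact: wsum_ge0 | rewrite lee_fin exprn_ge0// invr_ge0 ltW].
      apply: ge0_le_integral => //.
      + by move=> t _; exact: wsum_ge0.
      + apply: measurable_wsum => // k.
        by rewrite (_ : (fun t => _) = (z ^~ k)); [exact: zI|apply/funext => t; rewrite -uz].
      + by apply: emeasurable_funM => //; apply: measurable_wsum => // k; exact: zI.
      + by move=> t _; rewrite -uz; exact: wsum_m_1.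
    by rewrite lte_mul_pinfty// lee_fin exprn_ge0// invr_ge0 ltW.
(* The derivative is defined by the equation, which then holds at every time; what remains is that
   [w] lies in the right space and is the weak derivative of [u]. *)
pose w t v : R := f t v - extAS (u t) v - extB (u t) (u t) v.
have wE t k : w t (phi k) = f t (phi k) - lam k * z t k - N (x t) k.
  rewrite /w (extAS_phi SA sigma01)// -Nz -uz (nonlinE SA sigma01)//.
  by rewrite opprD !addrA opprD addrA.
have wdual t : t \in `]0, T[ -> dual sm (w t).
  move=> tT.
  have dA := extAS_dual SA sigma01 (u1 t).
  have dB : dual sm (extB (u t) (u t)).
    apply: (extB_dual SA sigma01 (u1 t)).
    exact: (frac_dom_mono lam0 lam_ge (s0_le_s1 sigma)).
  rewrite (_ : w t = (-1 : R) *: extB (u t) (u t) + ((-1 : R) *: extAS (u t) + f t)).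
    by apply: frac_dualP => //; apply: frac_dualP => //; exact: fdual.
  apply/funext => v; rewrite /w -[RHS]/(-1 * extB (u t) (u t) v + (-1 * extAS (u t) v + f t v)).
  by rewrite !mulN1r; ring.
have wkm k : measurable_fun `]0, T[ (fun t => w t (phi k)).
  rewrite (_ : (fun t => _) = (fun t => f t (phi k) - lam k * z t k - N (x t) k)); last first.
    by apply/funext => t; rewrite wE.
  apply: measurable_funB; last exact: NI.
  by apply: measurable_funB => //; apply: measurable_funM => //; exact: zI.
have wL : L2_dual ip lam phi sigma T w.
  apply/(L2_spaceP (frac_dual_model ipn basis lam0 lam_ge sm0) mI).
  split; [exact: wdual|exact: wkm|].
  rewrite (_ : (\int[mu]_(t in _) _)%E = (\int[mu]_(t in `]0%R, T[)
      wsum wm (fun k => (f t (phi k) - lam k * z t k) - N (x t) k)%R)%E); last first.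
    by apply: eq_integral => t _; apply: eq_wsum => k; rewrite wE.
  apply: (@integral_wsumB_fin _ _ wm (fun t k => f t (phi k) - lam k * z t k)
    (fun t => N (x t)) mI wm_ge0).
  - move=> k; apply: measurable_funB => //; apply: measurable_funM => //; exact: zI.
  - by move=> k; exact: NI.
  - apply: (@integral_wsumB_fin _ _ wm (fun t k => f t (phi k))
      (fun t k => lam k * z t k) mI wm_ge0); [exact: fmeas| |exact: fint|].
    + by move=> k; apply: measurable_funM => //; exact: zI.
    + rewrite (_ : (\int[mu]_(t in _) _)%E = (\int[mu]_(t in `]0%R, T[) wsum w1 (z t))%E)//.
      by apply: eq_integral => t _; exact: wsum_m_lam.
  - by move: xN; rewrite integral_wsum_oo//; exact: Nm.
have wd : time_derivative ip lam phi sigma T u w.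
  split=> //; apply: weak_derivative_coord => // h k th.
  have h'm : measurable_fun `]0, T[ (derive1 h).
    apply: measurable_funS (continuous_measurable_fun _) => //.
    exact: test_function_derivative_continuous th.
  have hm : measurable_fun `]0, T[ h.
    by apply: measurable_funS (continuous_measurable_fun (smooth_continuous th.1)).
  have xI : measurable_fun `]0, T[ (x ^~ k) by exact: measurable_funS (xm k).
  transitivity (\int[mu]_(t in `]0, T[) (derive1 h t * x t k)).
    apply: ae_eq_Rintegral => //.
    - apply: measurable_funM => //.
      by rewrite (_ : (fun t => _) = (z ^~ k)); [exact: zI|apply/funext => t; rewrite -uz].
    - exact: measurable_funM.
    - apply: (ae_imply aeP) => t Pt tT; congr (_ * _).
      by rewrite -[LHS]/(coef (u t) k) uz /z Pt.
  rewrite (is_prim_weak_derivative T0' (xP k) th); congr (- _).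
  apply: ae_eq_Rintegral => //.
  - apply: measurable_funM => //; apply: measurable_funD.
      by apply: measurable_funM.
    apply: measurable_funB; last exact: NI.
    by apply: measurable_funS (forcing_measurable k).
  - exact: measurable_funM.
  - apply: (ae_imply aeP) => t Pt tT; congr (_ * _).
    by rewrite wE forcingE// /z Pt//; ring.
exists u; last by apply: (ae_imply aeP) => t Pt tT k; rewrite uz /z Pt.
split; first by split=> //; split=> //; exists w.
- exists w => //; apply: aeW => t tT v _.
  by rewrite /w; ring.
have x0oo t : t \in `[0, T] -> (wsum w0 (x t) < +oo)%E.
  move=> tT; apply: le_lt_trans boo; apply: wsum_le => // n.
  apply: le_trans (wsum_partial_le w0_ge0 b n); rewrite lee_fin; apply: ler_sum => k _.
  rewrite ler_wpM2l// -(@real_normK _ (x t k)) ?num_real// -(@real_normK _ (b k)) ?num_real//.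
  by rewrite ler_pXn2r ?nnegrE//; exact: xb.
exists (fun t => fromseq phi (x t)); split.
- by apply: (ae_imply aeP) => t Pt tT; rewrite /u Pt.
- move=> t tT; have [tE ts] := seq_dom SA s00 (x0oo t tT); split => //.
  (* Each coordinate is continuous in time, and the differences are dominated by [2 b], so the
     [w0]-energy of the increment tends to 0. *)
  have c : fine (wsum w0 (fun k => x t' k - x t k)) @[t' --> within `[0, T]%classic (nbhs t)]
      --> (0 : R).
    apply: (wsum_dominated (b := fun k => 2 * b k)) => //.
    + by rewrite wsumZ// lte_mul_pinfty.
    + near=> t' => k; have tT' : t' \in `[0, T].
        by near: t'; exact: withinT.
      rewrite (le_trans (ler_normB _ _))// normrM (ger0_norm (x := 2))//.
      by have := xb t k tT; have := xb t' k tT'; lra.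
    + move=> k; rewrite -[X in _ --> X](subrr (x t k)); apply: cvgB; last exact: cvg_cst.
      have /subspace_continuousP := is_prim_continuous T0' (xP k).
      exact.
  apply/cvgrPdist_le => e e0; have e2 : 0 < e ^+ 2 by rewrite exprn_gt0.
  move/cvgrPdist_le : c => /(_ _ e2) h; near=> t'.
  have tT' : t' \in `[0, T] by near: t'; exact: withinT.
  have [tE' ts'] := seq_dom SA s00 (x0oo t' tT').
  have ds := frac_domB ts' ts.
  have : `|0 - fine (wsum w0 (fun k => x t' k - x t k))| <= e ^+ 2 by near: t'.
  rewrite (_ : (fun k => x t' k - x t k) = coef (fromseq phi (x t') - fromseq phi (x t))); last first.
    by apply/funext => k; rewrite (coefB ip) tE tE'.
  rewrite -(frac_norm_sqr ipn basis lam0)//= !sub0r !normrN normrX.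
  by rewrite ler_pXn2r ?nnegrE// ltW.
- have T00 : 0 \in `[0, T] by rewrite in_itv/= lexx.
  have [E _] := seq_dom SA s00 (x0oo 0 T00).
  apply: (coef_inj basis) => k; rewrite E.
  by have [_ /(_ 0 T00)] := xP k; rewrite prim0 addr0.
Unshelve. all: by end_near. Qed.

(** Coordinates are taken from the continuous representative, so that the initial value and the
    primitive are meaningful at every time; the weak equation then makes each coordinate a
    primitive. *)
Lemma solution_to_sequence (u : R -> H) : is_sol u -> exists2 y, solves_seq y &
  {ae mu, forall t, t \in `]0, T[ -> forall k, coef (u t) k = y t k}.
Proof.
move=> [[uL _] [w [wL wd] weq] [ub [ubu ubc ub0]]].
have [u1 um u1i] := (L2_spaceP (frac_dom_model ipn basis lam0 s1) mI u).1 uL.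
have [wdual wm' wi] := (L2_spaceP (frac_dual_model ipn basis lam0 lam_ge sm0) mI w).1 wL.
have Nm : forall x : R -> nat -> R, (forall k, measurable_fun setT (x ^~ k)) ->
    forall k, measurable_fun setT (fun t => N (x t) k).
  exact: (nonlin_measurable SA sigma01).
have phis k : dom sm (phi k) by exact: frac_dom_phi.
have fI : (mu `]0%R, T[ < +oo)%E by rewrite lebesgue_measure_itv/=; case: ifP => //; rewrite ltry.
pose c k t := coef (ub t) k.
have cc k : {within `[0, T], continuous (c k)}.
  apply/subspace_continuousP => t tT; have [ts tc] := ubc t tT.
  have q0 : 0 < Num.sqrt (w0 k) by rewrite sqrtr_gt0 powR_gt0.
  apply/cvgrPdist_le => e e0.
  have eq0 : 0 < e * Num.sqrt (w0 k) by rewrite mulr_gt0.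
  move/cvgrPdist_le : tc => /(_ _ eq0) h; near=> t'.
  have tT' : t' \in `[0, T] by near: t'; exact: withinT.
  have [ts' _] := ubc t' tT'.
  have ds := frac_domB ts' ts.
  have : `|0 - norm s0 (ub t' - ub t)| <= e * Num.sqrt (w0 k) by near: t'.
  rewrite sub0r normrN ger0_norm ?frac_norm_ge0// => h'.
  rewrite distrC /c -(coefB ip) -(ler_pM2r q0) (le_trans _ h')//.
  rewrite -(@ler_pXn2r _ 2)// ?nnegrE ?mulr_ge0 ?sqrtr_ge0 ?frac_norm_ge0//.
  rewrite exprMn real_normK ?num_real// sqr_sqrtr// mulrC -lee_fin.
  rewrite (frac_norm_sqr ipn basis lam0)//.
  exact: (wsum_term_le w0_ge0 (coef (ub t' - ub t)) k).
pose y t k := ((c k) \_ `[0, T]) t.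
have ym k : measurable_fun setT (y ^~ k).
  by apply: measurable_patch => //; exact: within_continuous_measurable.
have yE t k : t \in `[0, T] -> y t k = c k t by move=> tT; rewrite /y patchE mem_set.
have sub t : t \in `]0, T[ -> t \in `[0, T] by exact: subset_itv_oo_cc.
have aey : {ae mu, forall t, t \in `]0, T[ -> forall k, coef (u t) k = y t k}.
  by apply: (ae_imply ubu) => t h tT k; rewrite yE ?sub// /c h.
pose a k t := ((fun t => w t (phi k)) \_ `]0, T[) t.
have wint k : mu.-integrable `]0, T[ (EFin \o (fun t => w t (phi k))).
  have one : measurable_fun `]0, T[ (fun=> 1 : R) by [].
  have b1 t : `]0, T[%classic t -> `|1 : R| <= 1 by rewrite normr1.
  have := dual_eval_integrable ipn basis lam0 lam_ge sm0 mI fI wL one b1 (phis k).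
  by congr (mu.-integrable _ (EFin \o _)); apply/funext => t; rewrite mul1r.
have ai k : mu.-integrable `[0, T] (EFin \o a k).
  by apply: (@integrableS _ _ _ mu setT) => //; exact: integrable_patch.
have aE t k : t \in `]0, T[ -> a k t = w t (phi k) by move=> tT; rewrite /a patchE mem_set.
have yP k : is_prim T (coef g k) (a k) (y ^~ k).
  have cP : is_prim T (c k 0) (a k) (c k).
    apply: weak_derivative_is_prim => // h th.
    have h'm : measurable_fun `]0, T[ (derive1 h).
      apply: measurable_funS (continuous_measurable_fun _) => //.
      exact: test_function_derivative_continuous th.
    transitivity (\int[mu]_(t in `]0, T[) (derive1 h t * (pivot ip \o u) t (phi k))).
      apply: ae_eq_Rintegral => //.
      - apply: measurable_funM => //.
        by apply: measurable_funS (within_continuous_measurable (cc k)) => //; exact: subset_itv_oo_cc.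
      - apply: measurable_funM => //; exact: um.
      - by apply: (ae_imply aey) => t E tT; rewrite -yE ?sub// -E.
    rewrite (wd h th (phi k) (phis k)); congr (- _).
    by apply: eq_Rintegral => t; rewrite inE => tT; rewrite aE.
  move: cP; rewrite /c ub0 => -[_ cP]; split=> // t tT; rewrite yE//; exact: cP.
have yI (Z : set R) k : measurable Z -> measurable_fun Z (y ^~ k).
  by move=> mZ; exact: measurable_funS (ym k).
have NI (Z : set R) k : measurable Z -> measurable_fun Z (fun t => N (y t) k).
  by move=> mZ; exact: measurable_funS (Nm _ ym k).
(* In [evolution_equation] the null set comes before the test vector, so the coordinate equations
   hold for all [k] off a single null set. *)
have eqk : {ae mu, forall t, t \in `]0, T[ -> forall k,
    w t (phi k) = - lam k * y t k + (forcing t k - N (y t) k)}.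
  apply: (ae_imply (ae_and weq aey)) => t [E Ey] tT k.
  have := E tT (phi k) (phis k).
  have yu : y t = coef (u t) by apply/funext => j; rewrite Ey.
  rewrite (extAS_phi SA sigma01 k (u1 t tT)) forcingE// => <-.
  by rewrite yu (nonlinE SA sigma01 k (u1 t tT)); ring.
have y1 : (\int[mu]_(t in `]0%R, T[) wsum w1 (y t) < +oo)%E.
  rewrite -(@integral_wsum_ae _ T w1 (fun t => coef (u t)) y)// => k; exact: yI.
(* This finiteness is drawn from the equation: [N y = f - lam y - w] almost everywhere, and the
   three terms have finite energy. *)
have Nint : (\int[mu]_(t in `]0%R, T[) wsum wm (N (y t)) < +oo)%E.
  rewrite (@integral_wsum_ae _ T wm (fun t => N (y t))
    (fun t k => (f t (phi k) - lam k * y t k) - w t (phi k))); last 4 first.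
  - exact: wm_ge0.
  - by move=> k; exact: NI.
  - move=> k; apply: measurable_funB => //; apply: measurable_funB => //.
    by apply: measurable_funM => //; exact: yI.
  - apply: (ae_imply eqk) => t E tT k; rewrite (E tT) forcingE//; ring.
  apply: (@integral_wsumB_fin _ _ wm (fun t k => f t (phi k) - lam k * y t k)
    (fun t k => w t (phi k)) mI wm_ge0); [|exact: wm'| |exact: wi].
  - move=> k; apply: measurable_funB => //; apply: measurable_funM => //; exact: yI.
  - apply: (@integral_wsumB_fin _ _ wm (fun t k => f t (phi k))
      (fun t k => lam k * y t k) mI wm_ge0); [exact: fmeas| |exact: fint|].
    + by move=> k; apply: measurable_funM => //; exact: yI.
    + rewrite (_ : (\int[mu]_(t in _) _)%E = (\int[mu]_(t in `]0%R, T[) wsum w1 (y t))%E)//.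
      by apply: eq_integral => t _; exact: wsum_m_lam.
exists y; last exact: aey.
split; first exact: ym.
- move=> k.
  have bi : mu.-integrable `[0, T]
      (EFin \o (fun t => - lam k * y t k + (forcing t k - N (y t) k))).
    apply: (integrable_ae_eq (ai k)).
      apply: measurable_funD; first by apply: measurable_funM => //; exact: yI.
      apply: measurable_funB; last exact: NI.
      by apply: measurable_funS (forcing_measurable k).
    by apply: (ae_imply eqk) => t E tT; rewrite aE// E.
  apply: (is_prim_ae T0' (yP k) bi).
  by apply: (ae_imply eqk) => t E tT; rewrite aE// E.
- by rewrite integral_wsum_oo.
- by rewrite integral_wsum_oo//; exact: Nm.
Unshelve. all: by end_near. Qed.

End data.
End assembly.

Theorem theorem2p2 (R : realType) (H : completeNormedModType R)
    (ip : {dot H for idfun}) (D : set H) (A S : H -> H) (B : H -> H -> H)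
    (lam : nat -> R) (phi : nat -> H) (sigma T : R) :
  0 < T -> 0 <= sigma <= 1 ->
  structural_assumptions ip D A S B lam phi sigma ->
  exists2 r : R, 0 < r &
    forall (f : R -> H -> R) (g : H),
      L2_dual ip lam phi sigma T f ->
      frac_dom ip lam phi (sigma / 2) g ->
      L2_dual_norm ip lam phi sigma T f + frac_norm ip lam phi (sigma / 2) g
        < r ->
      exists2 u : R -> H,
        is_solution ip D A S B lam phi sigma T f g u &
        forall u' : R -> H,
          is_solution ip D A S B lam phi sigma T f g u' ->
          {ae (@lebesgue_measure R), forall t, t \in `]0, T[ -> u' t = u t}.

Proof.
move=> T0 sigma01 SA.
have ipn := sa_norm SA; have basis := sa_basis SA; have lam0 := sa_eigen_pos SA.
have lam_ge := eigen_ge SA; have sm0 := sm_ge0 sigma01.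
have [C C0 [K K0 lip]] := nonlin_lipschitz SA sigma01.
pose w0 k := lam k `^ (2 * (sigma / 2)).
have w00 k : 0 < w0 k by exact: powR_gt0.
have [r r0 wp] := system_wellposed (ltW T0) lam0 w00 (weight1 SA) (weightm SA) (ltW C0) K0
  (nonlin0 SA) (nonlin_measurable SA sigma01) lip.
(* The system measures squared norms: [a + b < sqrt r] with [a, b >= 0] gives [a^2 + b^2 <= r]. *)
exists (Num.sqrt r); first by rewrite sqrtr_gt0.
move=> f g fL gs small.
have mI : measurable (`]0, T[%classic : set R) by exact: measurable_itv.
have fd : forall t, t \in `]0, T[ -> frac_dual ip lam phi ((1 - sigma) / 2) (f t).
  have [h _ _] := (L2_spaceP (frac_dual_model ipn basis lam0 lam_ge sm0) mI f).1 fL.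
  by move=> t tT; exact: h.
have fn : (L2_dual_norm ip lam phi sigma T f ^+ 2)%:E =
    (\int[@lebesgue_measure R]_(s in `[0%R, T]) wsum
      (fun k => (lam k `^ (- (2 * ((1 - sigma) / 2))))%R) (forcing phi T f s))%E.
  rewrite (forcing_integral SA sigma01 fL) /L2_dual_norm /L2_norm.
  have E : L2_sqint `]0, T[%classic (dual_norm ip lam phi ((1 - sigma) / 2)) f =
     (\int[@lebesgue_measure R]_(t in `]0%R, T[) wsum
      (fun k => (lam k `^ (- (2 * ((1 - sigma) / 2))))%R) (fun k => f t (phi k)))%E.
    apply: eq_integral => t; rewrite inE => tT.
    by rewrite (dual_norm_sqr ipn basis lam0)//; exact: fd.
  have [_ fin] := fL; rewrite -E.
  have E0 : (0 <= L2_sqint `]0%R, T[%classic (dual_norm ip lam phi ((1 - sigma) / 2)%R) f)%E.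
    by apply: integral_ge0 => t _; rewrite lee_fin sqr_ge0.
  by rewrite sqr_sqrtr ?fine_ge0// fineK// ge0_fin_numE.
have [|x xs xu] := wp (forcing phi T f) (coef ip phi g) (forcing_measurable SA sigma01 fL).
  rewrite -fn -(frac_norm_sqr ipn basis lam0 gs) -EFinD lee_fin.
  have n0 : 0 <= frac_norm ip lam phi (sigma / 2) g by exact: frac_norm_ge0.
  have m0 : 0 <= L2_dual_norm ip lam phi sigma T f by exact: sqrtr_ge0.
  have s0 := sqrtr_ge0 r; rewrite -[leRHS]sqr_sqrtr ?(ltW r0)//.
  move: small n0 m0 s0; set a := frac_norm _ _ _ _ _; set b := L2_dual_norm _ _ _ _ _ _.
  by set c := Num.sqrt r; nra.
have [u us ux] := sequence_to_solution SA sigma01 T0 fL gs xs.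
exists u => // u' us'.
have [y ys uy] := solution_to_sequence SA sigma01 T0 fL us'.
(* The two sequences agree at every time of [[0, T]]; the only loss is the null sets where [u] and
   [u'] differ from them. *)
apply: (ae_imply (ae_and ux uy)) => t [h h'] tT.
apply: (coef_inj basis) => k; rewrite h// h'//; apply: xu => //.
exact: subset_itv_oo_cc tT.
Qed.
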